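(* Let $n\in\mathbb{N}$, $n\ge 1$, and let $f\in L^1(\mathbb{R}^n)$ be real-valued. Let $Rf=(R_1f,\dots,R_nf)$ denote the vector Riesz transform of $f$. Then $$\|Rf\|_{L^{1,\infty}(\mathbb{R}^n)}:=\sup_{\lambda>0}\lambda\,\big|\{x\in\mathbb{R}^n\colon |Rf(x)|>\lambda\}\big|\le 2\,\|f\|_{L^1(\mathbb{R}^n)},$$ where $|Rf(x)|=\big(\sum_{j=1}^n|R_jf(x)|^2\big)^{1/2}$ is the Euclidean norm.
   Context: For $j\in\{1,\dots,n\}$ and $f\in C_c^\infty(\mathbb{R}^n)$ the $j$-th Riesz transform is $$R_jf(x):=\frac{\Gamma\left(\frac{n+1}{2}\right)}{\pi^{\frac{n+1}{2}}}\,\mathrm{p.v.}\int_{\mathbb{R}^n}\frac{y_j-x_j}{|y-x|^{n+1}}f(y)\,dy .$$ With the convention $\widehat f(\xi)=\int_{\mathbb{R}^n} f(x)e^{-2\pi i x\cdot\xi}\,dx$, $R_j$ is the Fourier multiplier operator with symbol $i\xi_j/|\xi|$ (so $R=\nabla(-\Delta)^{-1/2}$), and this defines $R_j$ on $L^2(\mathbb{R}^n)$. For $f\in L^1(\mathbb{R}^n)$, $R_jf$ is understood in the usual sense: the unique extension of $R_j$ from $L^1(\mathbb{R}^n)\cap L^2(\mathbb{R}^n)$ to $L^1(\mathbb{R}^n)$ that is continuous into measurable functions with convergence in measure (equivalently, the principal value integral above, which exists for almost every $x$). $|E|$ denotes the Lebesgue measure of a set $E$. *)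

(* Defs.v *)
From HB Require Import structures.
From mathcomp Require Import all_boot all_order all_algebra.
From mathcomp Require Import all_classical all_reals all_analysis.
Set Implicit Arguments.
Unset Strict Implicit.
Unset Printing Implicit Defensive.
Import Order.TTheory GRing.Theory Num.Theory.
Import numFieldNormedType.Exports.
Local Open Scope classical_set_scope.
Local Open Scope ring_scope.

(* R^n is [n.-tuple (measurableTypeR R)]; the sigma-algebra that the library
   puts on tuples is the product of the Borel sigma-algebras of R, that is the
   Borel sigma-algebra of R^n. *)
Notation euclid R n := (n.-tuple (measurableTypeR R)).

Definition tcons (R : realType) n (p : measurableTypeR R * euclid R n) :
  euclid R n.+1 := [tuple of p.1 :: p.2].

(* n-dimensional Lebesgue measure on the Borel sets of R^n, as an iterated
   product of the one-dimensional Lebesgue measure; see [leb_box]. *)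
Fixpoint leb (R : realType) (n : nat) : set (euclid R n) -> \bar R :=
  match n with
  | 0 => \d_ [tuple]
  | m.+1 =>
    pushforward ((@lebesgue_measure R) \x (@leb R m))%E (@tcons R m)
  end.

Section lebesgue_measure_Rn.
Context {R : realType}.
Local Open Scope ereal_scope.

Lemma measurable_tcons n : measurable_fun setT (@tcons R n).
Proof.
exact: (@measurable_cons _ _ _ (measurableTypeR R) fst n snd).
Qed.

Lemma thead_tcons n (p : measurableTypeR R * euclid R n) :
  thead (tcons p) = p.1.
Proof. by []. Qed.

Lemma behead_tcons n (p : measurableTypeR R * euclid R n) :
  [tuple of behead (tcons p)] = p.2.
Proof. exact/val_inj. Qed.

Let lebS_sigma_finite n (m : {sigma_finite_measure set (euclid R n) -> \bar R}) :
  sigma_finite setT (pushforward ((@lebesgue_measure R) \x m) (@tcons R n)).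
Proof.
have [F FT mF] := sigma_finiteT (@lebesgue_measure R).
have [G GT mG] := sigma_finiteT m.
have fset : forall i j : nat, pushforward (lebesgue_measure \x m) (@tcons R n)
     [set x | F i (thead x) /\ G j [tuple of behead x]] =
     lebesgue_measure (F i) * m (G j).
  move=> i j; rewrite -product_measure1E; [|exact: (mF i).1|exact: (mG j).1].
  congr ((lebesgue_measure \x m) _).
  rewrite /pushforward; apply/seteqP; split=> p;
    by rewrite /= thead_tcons behead_tcons.
pose p k : nat * nat := odflt (0%N, 0%N) (unpickle k).
exists (fun k => [set x | F (p k).1 (thead x) /\ G (p k).2 [tuple of behead x]]).
  apply/seteqP; split=> // x _.
  have [i _ Fi] : (\bigcup_i F i) (thead x) by rewrite -FT.
  have [j _ Gj] : (\bigcup_i G i) [tuple of behead x] by rewrite -GT.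
  by exists (pickle (i, j)) => //; rewrite /p pickleK.
move=> k; split; last first.
  by rewrite fset; apply: lte_mul_pinfty => //; [|exact: (mG _).2];
    rewrite ge0_fin_numE//; exact: (mF _).2.
apply: measurableI.
- rewrite -[X in measurable X]setTI.
  exact: (@measurable_tnth _ (measurableTypeR R) n.+1 ord0) (mF _).1.
- rewrite -[X in measurable X]setTI.
  exact: (@measurable_behead _ (measurableTypeR R) n) (mG _).1.
Qed.

Let leb_sigma_finite_measure n :
  {m : {sigma_finite_measure set (euclid R n) -> \bar R} | @leb R n = m}.
Proof.
elim: n => [|n [m lebE]].
  by exists (\d_ ([tuple] : euclid R 0)).
pose mu : {measure set (euclid R n.+1) -> \bar R} :=
  measure_function_pushforward__canonical__measure_function_Measure
    ((@lebesgue_measure R) \x m) (@measurable_tcons n).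
pose nu : {sigma_finite_measure set (euclid R n.+1) -> \bar R} :=
  HB.pack (mu : set _ -> \bar R) mu
    (Measure_isSigmaFinite.Build _ _ _ mu (lebS_sigma_finite m)).
by exists nu => /=; rewrite lebE.
Qed.

Let leb0 n : @leb R n set0 = 0.
Proof. by have [m ->] := leb_sigma_finite_measure n; exact: measure0. Qed.
Let leb_ge0 n A : 0 <= @leb R n A.
Proof. by have [m ->] := leb_sigma_finite_measure n; exact: measure_ge0. Qed.
Let leb_sigma_additive n : semi_sigma_additive (@leb R n).
Proof.
by have [m ->] := leb_sigma_finite_measure n;
  exact: measure_semi_sigma_additive.
Qed.
HB.instance Definition _ n := isMeasure.Build _ _ _ (@leb R n)
  (@leb0 n) (@leb_ge0 n) (@leb_sigma_additive n).
Let leb_sigma_finite n : sigma_finite setT (@leb R n).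
Proof. by have [m ->] := leb_sigma_finite_measure n; exact: sigma_finiteT. Qed.
HB.instance Definition _ n := Measure_isSigmaFinite.Build _ _ _ (@leb R n)
  (@leb_sigma_finite n).

Lemma leb_box n (A : 'I_n -> set (measurableTypeR R)) :
  (forall i, measurable (A i)) ->
  leb [set x : euclid R n | forall i, A i (tnth x i)] =
  \prod_(i < n) lebesgue_measure (A i).
Proof.
elim: n A => [|n IH] A mA.
  by rewrite big_ord0 /= /dirac indicE mem_set// => -[].
rewrite big_ord_recl -(IH (fun i => A (lift ord0 i)) (fun i => mA _)).
have mB : measurable
    [set x : euclid R n | forall i, A (lift ord0 i) (tnth x i)].
  rewrite (_ : [set _ | _] =
    \bigcap_(i in [set: 'I_n]) ((@tnth n _ ^~ i) @^-1` A (lift ord0 i))).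
    apply: fin_bigcap_measurable => // i _; rewrite -[X in measurable X]setTI.
    exact: (@measurable_tnth _ (measurableTypeR R) n i) (mA _).
  by apply/seteqP; split=> x Ax i => [_|]; exact: Ax.
rewrite -product_measure1E ?mA//.
rewrite [LHS]/= /pushforward; congr ((lebesgue_measure \x @leb R n) _).
apply/seteqP; split=> [[x t]|[x t]] /=.
  move=> At; split; first by have := At ord0; rewrite tnth0.
  by move=> i; have := At (lift ord0 i); rewrite tnthS.
move=> [Ax At] i; case: (unliftP ord0 i) => [j|] ->; rewrite ?tnthS ?tnth0//.
Qed.

End lebesgue_measure_Rn.

Section riesz_transform.
Context {R : realType}.

Definition enorm n (x : 'I_n -> R) : R := Num.sqrt (\sum_(i < n) x i ^+ 2).

Definition Gamma (s : R) : R :=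
  \int[lebesgue_measure]_(t in `]0, +oo[) (t `^ (s - 1) * expR (- t)).

Definition riesz_cst (n : nat) : R :=
  Gamma (n.+1%:R / 2) / pi `^ (n.+1%:R / 2).

Definition riesz_trunc n (j : 'I_n) (f : euclid R n -> R) (e : R)
    (x : euclid R n) : R :=
  \int[@leb R n]_(y in [set y | e < enorm (fun i => tnth y i - tnth x i)])
    ((tnth y j - tnth x j) /
       enorm (fun i => tnth y i - tnth x i) ^+ n.+1 * f y).

(* For integrable f the principal value exists at almost every x; on the
   remaining null set the value of [lim] is a meaningless default. *)
Definition riesz n (j : 'I_n) (f : euclid R n -> R) (x : euclid R n) : R :=
  riesz_cst n * lim (riesz_trunc j f e x @[e --> 0^'+]).

Definition weak_L1 n (g : euclid R n -> R) : \bar R :=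
  ereal_sup
    [set (l%:E * leb [set x | (l < g x)%R])%E | l in [set l : R | 0 < l]].

End riesz_transform.

(* Main.v *)
(* A sandpile (obstacle) decomposition at height [l] replaces the
   Calderon-Zygmund decomposition and yields the constant 2.  Let [H] be the
   heat operator at time [tau], [q < 1], and [B = (1 - q H)^(-1/2)], so that
   [sqrt tau * grad B f] approximates the Riesz transform of [f].  The operator
   [P = 1 - B^(-1)] has nonnegative coefficients and mass less than 1.  Pouring
   [f >= 0] on the space and toppling with [P] whatever exceeds [l] gives
   [B f = B g + u], where [0 <= g <= l], [int g <= int f], and [g = l] where
   [u > 0], so that [|{u > 0}| <= |f|_1 / l].  Since [(1 - q H) B^2 = 1], the
   Dirichlet energy of [B g] is at most [int g^2 <= l |f|_1], and Chebyshev's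
   inequality bounds the set where its gradient exceeds [l] by [|f|_1 / l]
   again.  Off [{u > 0}] the gradient of [u] is negligible: up to a small
   error [u <= q H u] where [u > 0], so little of [u] leaks across the boundary.
   The positive and negative parts of [f] are decomposed separately and recombined
   in the Dirichlet form.

   With [tau = t / K], [q = 1 - K^(-2)] and [K -> oo] one obtains the heat
   version of the Riesz transform truncated at time [t]; it is an average of
   the truncated integrals [riesz_trunc] against a Gamma density, whence the
   theorem as [t -> 0].  All limits are taken on superlevel sets. *)

Require Import Defs.
From HB Require Import structures.
From mathcomp Require Import all_boot all_order all_algebra.
From mathcomp Require Import all_classical all_reals all_analysis.
From mathcomp Require Import measurable_realfun zify ring lra.
Import Order.TTheory GRing.Theory Num.Theory.
Import numFieldNormedType.Exports.
Local Open Scope classical_set_scope.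
Local Open Scope ring_scope.

(** * Coefficients of (1 - x)^(-1/2) *)

(** The signs of [f] cost nothing: in the Dirichlet form the cross term of the retained heights g1,
    g2 >= 0 has a favourable sign, so the energy is bounded as for a single function of mass |f|_1,
    and the constant stays 1 + 1. The obstacle is the gradient of [u] at points where u = 0.
    Cauchy-Schwarz asks for H (u^2) there, while [u] is controlled only through u <= k0 + q H u on
    {u > 0}, whose error k0 has mass of order |f|_1 / sqrt K. Testing with min(u, e) controls u
    min(u, e) at cost e |f|_1 / sqrt K, which allows [e] of order sqrt K. Values of [u] above [e]
    occur only far from x, because B maps bounded data to functions that are Lipschitz at scale sqrt
    tau up to a factor log K; their Gaussian share is negligible since log^4 K is small against K.
    Dropping the first [K] terms of B makes the data bounded, as the remaining powers of H have run
    for time at least t; it is also what truncates the Riesz transform at time t. With t and the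
    tolerance eta fixed, K -> oo leaves an error of order eta / sqrt t in measure; then eta = t ->
    0. *)

Definition sconv (R : realType) (al be : nat -> R) (k : nat) : R :=
  \sum_(i < k.+1) al i * be (k - i)%N.
Arguments sconv {R}.

Section power_series_coefficients.
Context (R : realType).
Implicit Types (al be ga : nat -> R).

(** Truncation at any order above [k] loses nothing, so commutativity and associativity are borrowed
    from polynomials. *)
Lemma sconv_coef al be N k : (k < N)%N ->
  sconv al be k = ((\poly_(i < N) al i) * (\poly_(i < N) be i))`_k.
Proof.
move=> kN; rewrite coefM /sconv; apply: eq_bigr => i _.
by rewrite !coef_poly !(leq_ltn_trans _ kN) ?leq_subr// -ltnS.
Qed.

Lemma sconvC al be k : sconv al be k = sconv be al k.
Proof. by rewrite !(sconv_coef _ _ k.+1)// mulrC. Qed.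

Lemma sconvA al be ga k : sconv al (sconv be ga) k = sconv (sconv al be) ga k.
Proof.
transitivity ((\poly_(i < k.+1) al i * (\poly_(i < k.+1) be i * \poly_(i < k.+1) ga i))`_k).
  rewrite coefM /sconv; apply: eq_bigr => i _.
  by rewrite coef_poly ltn_ord -/(sconv be ga _) (sconv_coef be ga k.+1)// ltnS leq_subr.
rewrite mulrA coefM /sconv; apply: eq_bigr => i _.
by rewrite coef_poly ltnS leq_subr -/(sconv al be _) (sconv_coef al be k.+1).
Qed.

Lemma sconvDl al be ga k : sconv (fun i => al i + be i) ga k = sconv al ga k + sconv be ga k.
Proof. by rewrite /sconv -big_split; apply: eq_bigr => i _; rewrite mulrDl. Qed.

Lemma eq_sconvl al be ga k : (forall i, al i = be i) -> sconv al ga k = sconv be ga k.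
Proof. by move=> ab; apply: eq_bigr => i _; rewrite ab. Qed.

Lemma sconv_delta0 al k : sconv (fun i => (i == 0)%:R) al k = al k.
Proof.
rewrite /sconv big_ord_recl/= mul1r subn0 big1 ?addr0// => i _.
by rewrite mul0r.
Qed.

Definition shift1 al k : R := if k is k'.+1 then al k' else 0.

Lemma sconv_shift1 al be k : sconv (shift1 al) be k = shift1 (sconv al be) k.
Proof.
case: k => [|k]; rewrite /sconv big_ord_recl/= mul0r ?big_ord0 ?add0r//.
Qed.

Lemma sconv_ge0 al be k : (forall i, 0 <= al i) -> (forall i, 0 <= be i) -> 0 <= sconv al be k.
Proof. by move=> a0 b0; apply: sumr_ge0 => i _; rewrite mulr_ge0. Qed.

Lemma sconv_geom al be q k :
  sconv (fun i => al i * q ^+ i) (fun i => be i * q ^+ i) k = sconv al be k * q ^+ k.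
Proof.
rewrite /sconv mulr_suml; apply: eq_bigr => i _.
have ik : (i <= k)%N by rewrite -ltnS.
by rewrite mulrACA -exprD subnKC.
Qed.

(* [cb k = binomial (2 k) k / 4 ^ k] are the coefficients of [(1 - x)^(-1/2)],
   [ca] those of [1 - (1 - x)^(1/2)]. *)
Fixpoint cb (k : nat) : R := if k is k'.+1 then cb k' * ((2 * k' + 1)%N%:R / (2 * k' + 2)%N%:R) else 1.

Definition ca (k : nat) : R := if k is k'.+1 then cb k' - cb k'.+1 else 0.

Lemma cb_gt0 k : 0 < cb k.
Proof. by elim: k => //= k IH; rewrite mulr_gt0// divr_gt0// ltr0n ?addn1 ?addn2. Qed.

Lemma cbS_le k : cb k.+1 <= cb k.
Proof.
rewrite /= ger_pMr ?cb_gt0// ler_pdivrMr ?mul1r ?ler_nat ?ltr0n ?addn2//.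
by rewrite addn1.
Qed.

Lemma cb_nonincreasing k m : (k <= m)%N -> cb m <= cb k.
Proof. by elim: m => [|m IH]; rewrite leq_eqVlt => /predU1P[->|]// /IH /(le_trans (cbS_le m)). Qed.

Lemma cb_le1 k : cb k <= 1.
Proof. exact: (cb_nonincreasing 0). Qed.

Lemma ca_ge0 k : 0 <= ca k.
Proof. by case: k => //= k; rewrite subr_ge0; exact: cbS_le. Qed.

(** With y = (1 - x)^(-1/2) one has (1 - x) y = (1 - x)^(1/2), that is y + (1 - (1 - x)^(1/2)) = 1 +
    x y. *)
Lemma cb_ca k : cb k + ca k = (k == 0)%:R + shift1 cb k.
Proof. by case: k => [|k] /=; rewrite ?addr0// add0r addrC subrK. Qed.

(* The generating function [y = sum cb k x^k] satisfies [2 (1 - x) y' = y], so [(1 - x) y^2] is constant. *)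
Lemma sconv_cb k : sconv cb cb k = 1.
Proof.
have cbE i : 2 * i.+1%:R * cb i.+1 = (2 * i%:R + 1) * cb i.
  have -> : cb i.+1 = cb i * ((2 * i + 1)%N%:R / (2 * i + 2)%N%:R) by [].
  have -> : (2 * i + 1)%N%:R = 2 * i%:R + 1 :> R by rewrite natrD natrM.
  have -> : (2 * i + 2)%N%:R = 2 * i.+1%:R :> R by rewrite -natrM mulnS addnC.
  by field; rewrite addrC natr1 pnatr_eq0.
elim: k => [|k IH]; first by rewrite /sconv big_ord1 mulr1.
apply: (@mulfI _ k.+1%:R); first by rewrite pnatr_eq0.
rewrite mulr1.
pose W (m : nat) := \sum_(i < m.+1) i%:R * (cb i * cb (m - i)%N).
(* [W] holds the coefficients of x y' y = x (y^2)' / 2; reversing the order of summation symmetrizes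
   it. *)
have W2 m : 2 * W m = m%:R * sconv cb cb m.
  have -> : 2 * W m = W m + W m by ring.
  rewrite {2}/W (reindex_inj rev_ord_inj)/= /W -big_split/= /sconv mulr_sumr.
  apply: eq_bigr => i _; have im : (i <= m)%N by rewrite -ltnS.
  by rewrite subSS subKn// natrB// [cb (m - i)%N * _]mulrC; ring.
rewrite -W2 /W big_ord_recl/= mul0r add0r mulr_sumr.
transitivity (\sum_(i < k.+1) (2 * i%:R + 1) * (cb i * cb (k - i)%N)).
  apply: eq_bigr => i _; rewrite subSS mulrA mulrA -[bump 0 i]/(i.+1).
  by rewrite -/(cb i.+1) cbE mulrA.
transitivity (2 * W k + sconv cb cb k).
  rewrite /W mulr_sumr /sconv -big_split/=; apply: eq_bigr => i _; ring.
by rewrite W2 IH mulr1 -natr1.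
Qed.

(** This is [cb_ca] multiplied by y: as y^2 = 1 / (1 - x) has constant coefficients, y^2 and x y^2
    differ only at index 0. *)
Lemma cb_sconv_ca k : cb k = (k == 0)%:R + sconv ca cb k.
Proof.
have E : sconv (fun i => cb i + ca i) cb k = sconv (fun i => (i == 0)%:R + shift1 cb i) cb k.
  by apply: eq_sconvl => i; exact: cb_ca.
move: E; rewrite !sconvDl sconv_cb sconv_delta0 sconv_shift1.
case: k => [|k] /=; rewrite ?sconv_cb; lra.
Qed.

Definition cb_tail K k : R := if (k < K)%N then 0 else cb k.

(* The coefficients of [(1 - x)^(1/2) * sum_(k >= K) cb k x^k]: dropping the first
   [K] terms of the resolvent amounts to smoothing the data by a nonnegative series. *)
Definition cmu K k : R := if (k < K)%N then 0 else \sum_(j < K) cb j * ca (k - j)%N.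

Lemma cmu_ge0 K k : 0 <= cmu K k.
Proof.
rewrite /cmu; case: ifP => // _; apply: sumr_ge0 => j _.
by rewrite mulr_ge0 ?ca_ge0// ltW// cb_gt0.
Qed.

Lemma cb_tail_ge0 K k : 0 <= cb_tail K k.
Proof. by rewrite /cb_tail; case: ifP => // _; rewrite ltW// cb_gt0. Qed.

(** For k >= K this is y = 1 + a y with the product split at [K]: the terms containing [cb j] with j
    < K form [cmu], the others the convolution with the tail. *)
Lemma cb_tail_cmu K k : (0 < K)%N -> cb_tail K k = cmu K k + sconv ca (cb_tail K) k.
Proof.
move=> K0; rewrite sconvC /sconv /cb_tail /cmu; case: ltnP => kK.
  rewrite add0r big1// => i _.
  by rewrite (leq_ltn_trans _ kK) ?mul0r// -ltnS.
have := cb_sconv_ca k; rewrite gtn_eqF ?(leq_trans K0)// add0r sconvC /sconv => ->.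
rewrite -!(big_mkord xpredT (fun i => cb i * ca (k - i)%N)).
rewrite -(big_mkord xpredT (fun i => (if (i < K)%N then 0 else cb i) * ca (k - i)%N)).
rewrite (@big_cat_nat _ _ _ K)//=; last by rewrite ltnW.
congr (_ + _); rewrite [RHS](@big_cat_nat _ _ _ K)//=; last by rewrite ltnW.
have -> : \sum_(0 <= i < K) (if (i < K)%N then 0 else cb i) * ca (k - i)%N = 0.
  by rewrite big_mkord big1// => i _; rewrite ltn_ord mul0r.
rewrite add0r.
by apply: eq_big_nat => i /andP[Ki _]; rewrite ltnNge Ki.
Qed.

(** Multiplying T = mu + a T by y gives y T = y mu + y a T, while y = 1 + a y gives y T = T + a y T;
    the common term cancels. *)
Lemma sconv_cb_cmu K k : (0 < K)%N -> sconv cb (cmu K) k = cb_tail K k.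
Proof.
move=> K0.
have E : sconv cb (cb_tail K) k = sconv cb (cmu K) k + sconv cb (sconv ca (cb_tail K)) k.
  rewrite ![sconv cb _ k]sconvC -sconvDl; apply: eq_sconvl => i; exact: cb_tail_cmu.
have E2 : sconv cb (cb_tail K) k = cb_tail K k + sconv (sconv ca cb) (cb_tail K) k.
  rewrite -[in RHS](sconv_delta0 (cb_tail K)) -sconvDl; apply: eq_sconvl => i; exact: cb_sconv_ca.
move: E; rewrite sconvA (eq_sconvl (sconv cb ca) (sconv ca cb)) ?E2 => [|i]; last exact: sconvC.
by move/addIr.
Qed.

(** Multiplying [cb_ca] by [cmu K] shows that the defect of [cmu] is T - x T for the tail T. Its
    coefficients vanish below [K], equal [cb K] at [K] and are nonpositive beyond, [cb] being
    decreasing; the single positive jump is of order K^(-1/2). *)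
Lemma cmu_le K k : (0 < K)%N ->
  cmu K k <= sconv ca (cmu K) k + (if k == K then cb K else 0).
Proof.
move=> K0.
have E : sconv (fun i => cb i + ca i) (cmu K) k =
         sconv (fun i => (i == 0)%:R + shift1 cb i) (cmu K) k.
  by apply: eq_sconvl => i; exact: cb_ca.
move: E; rewrite !sconvDl sconv_delta0 sconv_shift1 sconv_cb_cmu//.
have -> : shift1 (sconv cb (cmu K)) k = shift1 (cb_tail K) k.
  by case: k => //= k; rewrite sconv_cb_cmu.
case: k => [|k] /=; first by rewrite /cb_tail K0; case: eqP; have := cb_gt0 K; lra.
rewrite /cb_tail; have [kK|kK|kK] := ltngtP k.+1 K.
- by lra.
- by have := cbS_le k; lra.
- by rewrite -kK; lra.
Qed.

Lemma cb_sqr_le k : cb k ^+ 2 * k.+1%:R <= 1.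
Proof.
elim: k => [|k IH]; first by rewrite expr1n mulr1.
apply: le_trans IH; rewrite /= exprMn -mulrA; apply: ler_wpM2l; first exact: sqr_ge0.
rewrite expr_div_n mulrAC ler_pdivrMr ?exprn_gt0 ?ltr0n ?addn2//.
rewrite -!natrX -!natrM ler_nat.
by rewrite !expnS !expn0; nia.
Qed.

Lemma cb_le_sqrt k : cb k <= (Num.sqrt k.+1%:R)^-1.
Proof.
rewrite -[leLHS](@ger0_norm _ (cb k) (ltW (cb_gt0 k))) -sqrtr_sqr -sqrtrV ?ler0n//.
apply: ler_wsqrtr.
by rewrite -[leRHS]mul1r ler_pdivlMr ?ltr0n// cb_sqr_le.
Qed.

End power_series_coefficients.

(** * Power series in a symmetric Markov operator *)

Section markov_operator.
Context d (T : measurableType d) (R : realType).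
Context (mu : {sigma_finite_measure set T -> \bar R}) (h : T -> T -> R).
Local Open Scope ereal_scope.

(** With nonnegative extended values every exchange of sums and integrals is an instance of Tonelli.
    Differences are avoided by moving negative terms across equations, and finiteness is checked
    only where a term is cancelled. *)
Definition nnm (f : T -> \bar R) :=
  measurable_fun setT f /\ forall x, 0 <= f x.

Definition Hop (f : T -> \bar R) (x : T) : \bar R :=
  \int[mu]_y ((h x y)%:E * f y).

Definition Sop (al : nat -> R) (f : T -> \bar R) (x : T) : \bar R :=
  \sum_(k <oo) (al k)%:E * iter k Hop f x.

Context (h0 : forall x y, (0 <= h x y)%R)
  (mh : measurable_fun setT (fun z : T * T => h z.1 z.2))
  (hC : forall x y, h x y = h y x)
  (h1 : forall x, \int[mu]_y (h x y)%:E = 1).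

Lemma nneseriesMl (c : \bar R) (f : nat -> \bar R) : 0 <= c -> (forall k, 0 <= f k) ->
  \sum_(k <oo) c * f k = c * \sum_(k <oo) f k.
Proof.
move=> c0 f0; rewrite -!ge0_integral_count//; last by move=> k; rewrite mule_ge0.
by rewrite ge0_integralZl.
Qed.

Lemma nnm_cst (c : R) : (0 <= c)%R -> nnm (cst c%:E).
Proof. by move=> c0; split=> // x; rewrite lee_fin. Qed.

Lemma nnmD f g : nnm f -> nnm g -> nnm (fun x => f x + g x).
Proof.
move=> [mf f0] [mg g0]; split; first exact: emeasurable_funD.
by move=> x; rewrite adde_ge0.
Qed.

Lemma nnmM f g : nnm f -> nnm g -> nnm (fun x => f x * g x).
Proof.
move=> [mf f0] [mg g0]; split; first exact: emeasurable_funM.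
by move=> x; rewrite mule_ge0.
Qed.

Lemma nnmZ (c : R) f : (0 <= c)%R -> nnm f -> nnm (fun x => c%:E * f x).
Proof. by move=> c0 nf; apply: nnmM => //; exact: nnm_cst. Qed.

Lemma nnm_nneseries (f : nat -> T -> \bar R) :
  (forall k, nnm (f k)) -> nnm (fun x => \sum_(k <oo) f k x).
Proof.
move=> nf; split.
  by apply: ge0_emeasurable_sum => [k x _ _|k _]; [exact: (nf k).2|exact: (nf k).1].
by move=> x; apply: nneseries_ge0 => k _ _; exact: (nf k).2.
Qed.

Lemma measurable_kernel_section x : measurable_fun setT (h x).
Proof. exact: (measurableT_comp mh (pair1_measurable x)). Qed.

Lemma nnm_kernelM x f : nnm f -> nnm (fun y => (h x y)%:E * f y).
Proof.
move=> nf; apply: nnmM => //; split=> [|y]; last by rewrite lee_fin.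
by apply/measurable_EFinP; exact: measurable_kernel_section.
Qed.

Lemma nnm_kernelM2 f g : nnm f -> nnm g ->
  measurable_fun setT (fun z : T * T => f z.1 * ((h z.1 z.2)%:E * g z.2)).
Proof.
move=> [mf f0] [mg g0]; apply: emeasurable_funM.
  exact: (measurableT_comp mf).
apply: emeasurable_funM; first exact/measurable_EFinP.
exact: (measurableT_comp mg).
Qed.

Lemma nnm_Hop f : nnm f -> nnm (Hop f).
Proof.
move=> nf; split; last first.
  by move=> x; apply: integral_ge0 => y _; exact: (nnm_kernelM x _ nf).2.
have -> : Hop f = fubini_F mu (fun z : T * T => cst 1 z.1 * ((h z.1 z.2)%:E * f z.2)).
  by apply/funext => x; rewrite /fubini_F/=; apply: eq_integral => y _; rewrite mul1e.
apply: measurable_fun_fubini_tonelli_F => /=.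
  by apply: (nnm_kernelM2 (cst 1)) => //; exact: nnm_cst.
by move=> z; rewrite mul1e; exact: (nnm_kernelM z.1 _ nf).2.
Qed.

Lemma nnm_iter_Hop k f : nnm f -> nnm (iter k Hop f).
Proof. by move=> nf; elim: k => //= k IH; exact: nnm_Hop. Qed.

Lemma HopD f g x : nnm f -> nnm g -> Hop (fun y => f y + g y) x = Hop f x + Hop g x.
Proof.
move=> nf ng; rewrite /Hop -ge0_integralD//; last 4 first.
- by move=> y _; exact: (nnm_kernelM x _ nf).2.
- exact: (nnm_kernelM x _ nf).1.
- by move=> y _; exact: (nnm_kernelM x _ ng).2.
- exact: (nnm_kernelM x _ ng).1.
by apply: eq_integral => y _; rewrite ge0_muleDr// ?nf.2 ?ng.2.
Qed.

Lemma HopZ (c : R) f x : (0 <= c)%R -> nnm f ->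
  Hop (fun y => c%:E * f y) x = c%:E * Hop f x.
Proof.
move=> c0 nf; rewrite /Hop -ge0_integralZl//; last 2 first.
- exact: (nnm_kernelM x _ nf).1.
- by move=> y _; exact: (nnm_kernelM x _ nf).2.
by apply: eq_integral => y _; rewrite muleCA.
Qed.

Lemma Hop_le f g x : nnm f -> nnm g -> (forall y, f y <= g y) -> Hop f x <= Hop g x.
Proof.
move=> nf ng fg; apply: ge0_le_integral => //.
- by move=> y _; exact: (nnm_kernelM x _ nf).2.
- exact: (nnm_kernelM x _ nf).1.
- exact: (nnm_kernelM x _ ng).1.
by move=> y _; apply: lee_wpmul2l; [rewrite lee_fin|].
Qed.

Lemma Hop_nneseries (f : nat -> T -> \bar R) x : (forall k, nnm (f k)) ->
  Hop (fun y => \sum_(k <oo) f k y) x = \sum_(k <oo) Hop (f k) x.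
Proof.
move=> nf; rewrite /Hop -integral_nneseries//; last 2 first.
- by move=> k; exact: (nnm_kernelM x _ (nf k)).1.
- by move=> k y _; exact: (nnm_kernelM x _ (nf k)).2.
apply: eq_integral => y _; rewrite nneseriesZl// => k _; exact: (nf k).2.
Qed.

Lemma Hop_cst (c : R) x : (0 <= c)%R -> Hop (cst c%:E) x = c%:E.
Proof.
move=> c0; rewrite /Hop/= ge0_integralZr ?h1 ?mul1e//.
- by apply/measurable_EFinP; exact: measurable_kernel_section.
- by move=> y _; rewrite lee_fin.
Qed.

Lemma integral_Hop_sym f g : nnm f -> nnm g ->
  \int[mu]_x (f x * Hop g x) = \int[mu]_x (Hop f x * g x).
Proof.
move=> nf ng.
have -> : \int[mu]_x (f x * Hop g x) = \int[mu]_x \int[mu]_y (f x * ((h x y)%:E * g y)).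
  apply: eq_integral => x _; rewrite /Hop ge0_integralZl ?nf.2//.
  - exact: (nnm_kernelM x _ ng).1.
  - by move=> y _; exact: (nnm_kernelM x _ ng).2.
have n0 z : 0 <= f z.1 * ((h z.1 z.2)%:E * g z.2).
  by rewrite mule_ge0 ?nf.2// (nnm_kernelM _ _ ng).2.
rewrite (fubini_tonelli _ (nnm_kernelM2 _ _ nf ng) n0).
apply: eq_integral => y _ /=; rewrite /Hop -ge0_integralZr ?ng.2//.
- by apply: eq_integral => x _; rewrite hC muleA [f x * _]muleC.
- exact: (nnm_kernelM y _ nf).1.
- by move=> x _; exact: (nnm_kernelM y _ nf).2.
Qed.

Lemma integral_Hop f : nnm f -> \int[mu]_x Hop f x = \int[mu]_x f x.
Proof.
move=> nf; have := integral_Hop_sym _ _ (nnm_cst 1 ler01) nf.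
under eq_integral do rewrite /= mul1e.
move=> ->; apply: eq_integral => x _.
by rewrite Hop_cst// mul1e.
Qed.

Lemma iter_HopD k f g x : nnm f -> nnm g ->
  iter k Hop (fun y => f y + g y) x = iter k Hop f x + iter k Hop g x.
Proof.
move=> nf ng; elim: k x => //= k IH x.
rewrite -HopD; try exact: nnm_iter_Hop.
by congr (Hop _ x); apply/funext.
Qed.

Lemma iter_Hop_le k f g x : nnm f -> nnm g -> (forall y, f y <= g y) ->
  iter k Hop f x <= iter k Hop g x.
Proof.
move=> nf ng fg; elim: k x => //= k IH x.
by apply: Hop_le => //; exact: nnm_iter_Hop.
Qed.

Lemma iter_Hop_cst k (c : R) x : (0 <= c)%R -> iter k Hop (cst c%:E) x = c%:E.
Proof.
move=> c0; elim: k x => //= k IH x.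
rewrite (_ : iter k Hop (cst c%:E) = cst c%:E) ?Hop_cst//; exact/funext.
Qed.

Lemma iter_Hop_nneseries k (f : nat -> T -> \bar R) x : (forall k, nnm (f k)) ->
  iter k Hop (fun y => \sum_(i <oo) f i y) x = \sum_(i <oo) iter k Hop (f i) x.
Proof.
move=> nf; elim: k x => //= k IH x.
rewrite -Hop_nneseries; last by move=> i; exact: nnm_iter_Hop.
by congr (Hop _ x); apply/funext.
Qed.

Lemma iter_HopZ k (c : R) f x : (0 <= c)%R -> nnm f ->
  iter k Hop (fun y => c%:E * f y) x = c%:E * iter k Hop f x.
Proof.
move=> c0 nf; elim: k x => //= k IH x.
rewrite -HopZ//; last exact: nnm_iter_Hop.
by congr (Hop _ x); apply/funext.
Qed.

Lemma integral_iter_Hop_sym k f g : nnm f -> nnm g ->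
  \int[mu]_x (f x * iter k Hop g x) = \int[mu]_x (iter k Hop f x * g x).
Proof.
elim: k f => //= k IH f nf ng.
rewrite integral_Hop_sym//; last exact: nnm_iter_Hop.
by rewrite IH//; [rewrite -iterSr|exact: nnm_Hop].
Qed.

Lemma integral_iter_Hop k f : nnm f -> \int[mu]_x iter k Hop f x = \int[mu]_x f x.
Proof.
by move=> nf; elim: k => //= k IH; rewrite integral_Hop//; exact: nnm_iter_Hop.
Qed.

Lemma nnm_SopT k (al : nat -> R) f : (forall i, (0 <= al i)%R) -> nnm f ->
  nnm (fun x => (al k)%:E * iter k Hop f x).
Proof. by move=> al0 nf; apply: nnmZ => //; exact: nnm_iter_Hop. Qed.

Lemma nnm_Sop al f : (forall i, (0 <= al i)%R) -> nnm f -> nnm (Sop al f).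
Proof. by move=> al0 nf; apply: nnm_nneseries => k; exact: nnm_SopT. Qed.

Lemma SopD al f g x : (forall i, (0 <= al i)%R) -> nnm f -> nnm g ->
  Sop al (fun y => f y + g y) x = Sop al f x + Sop al g x.
Proof.
move=> al0 nf ng; rewrite /Sop -nneseriesD; last 2 first.
- by move=> k _ _; exact: (nnm_SopT k _ _ al0 nf).2.
- by move=> k _ _; exact: (nnm_SopT k _ _ al0 ng).2.
apply: eq_eseriesr => k _; rewrite iter_HopD// ge0_muleDr//.
- exact: (nnm_iter_Hop _ _ nf).2.
- exact: (nnm_iter_Hop _ _ ng).2.
Qed.

Lemma Sop_nneseries al (f : nat -> T -> \bar R) x : (forall i, (0 <= al i)%R) ->
  (forall k, nnm (f k)) ->
  Sop al (fun y => \sum_(i <oo) f i y) x = \sum_(i <oo) Sop al (f i) x.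
Proof.
move=> al0 nf; rewrite /Sop -nneseries_interchange; last first.
  by move=> k i; exact: (nnm_SopT k _ _ al0 (nf i)).2.
apply: eq_eseriesr => k _; rewrite iter_Hop_nneseries// nneseriesZl// => i _.
exact: (nnm_iter_Hop _ _ (nf i)).2.
Qed.

Lemma Sop_le al f g x : (forall i, (0 <= al i)%R) -> nnm f -> nnm g ->
  (forall y, f y <= g y) -> Sop al f x <= Sop al g x.
Proof.
move=> al0 nf ng fg; apply: lee_nneseries => [k _ _|k _].
  exact: (nnm_SopT k _ _ al0 nf).2.
by apply: lee_wpmul2l; [rewrite lee_fin|exact: iter_Hop_le].
Qed.

Lemma Sop_lel al be f x : (forall i, (0 <= al i)%R) -> (forall i, (al i <= be i)%R) ->
  nnm f -> Sop al f x <= Sop be f x.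
Proof.
move=> al0 ab nf; apply: lee_nneseries => [k _ _|k _].
  exact: (nnm_SopT k _ _ al0 nf).2.
by apply: lee_wpmul2r; [exact: (nnm_iter_Hop _ _ nf).2|rewrite lee_fin].
Qed.

Lemma SopDl al be f x : (forall i, (0 <= al i)%R) -> (forall i, (0 <= be i)%R) ->
  nnm f -> Sop (fun k => al k + be k)%R f x = Sop al f x + Sop be f x.
Proof.
move=> al0 be0 nf; rewrite /Sop -nneseriesD; last 2 first.
- by move=> k _ _; exact: (nnm_SopT k _ _ al0 nf).2.
- by move=> k _ _; exact: (nnm_SopT k _ _ be0 nf).2.
by apply: eq_eseriesr => k _; rewrite EFinD ge0_muleDl ?lee_fin.
Qed.

Lemma Sop_cst al (c : R) x : (forall i, (0 <= al i)%R) -> (0 <= c)%R ->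
  Sop al (cst c%:E) x = c%:E * \sum_(k <oo) (al k)%:E.
Proof.
move=> al0 c0; rewrite -nneseriesZl; last by move=> k _; rewrite lee_fin.
by apply: eq_eseriesr => k _; rewrite iter_Hop_cst// muleC.
Qed.

Lemma integral_Sop al f : (forall i, (0 <= al i)%R) -> nnm f ->
  \int[mu]_x Sop al f x = \sum_(k <oo) (al k)%:E * \int[mu]_x f x.
Proof.
move=> al0 nf; rewrite integral_nneseries//; last 2 first.
- by move=> k; exact: (nnm_SopT k _ _ al0 nf).1.
- by move=> k x _; exact: (nnm_SopT k _ _ al0 nf).2.
apply: eq_eseriesr => k _; rewrite ge0_integralZl ?integral_iter_Hop ?lee_fin//.
- exact: (nnm_iter_Hop _ _ nf).1.
- by move=> x _; exact: (nnm_iter_Hop _ _ nf).2.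
Qed.

Lemma integral_Sop_sym al f g : (forall i, (0 <= al i)%R) -> nnm f -> nnm g ->
  \int[mu]_x (f x * Sop al g x) = \int[mu]_x (Sop al f x * g x).
Proof.
move=> al0 nf ng.
transitivity (\sum_(k <oo) \int[mu]_x (f x * ((al k)%:E * iter k Hop g x))).
  rewrite -integral_nneseries//; last 2 first.
  - by move=> k; exact: (nnmM _ _ nf (nnm_SopT k _ _ al0 ng)).1.
  - by move=> k x _; exact: (nnmM _ _ nf (nnm_SopT k _ _ al0 ng)).2.
  apply: eq_integral => x _.
  by rewrite nneseriesMl ?nf.2// => k; exact: (nnm_SopT k _ _ al0 ng).2.
transitivity (\sum_(k <oo) \int[mu]_x ((al k)%:E * iter k Hop f x * g x)); last first.
  rewrite -integral_nneseries//; last 2 first.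
  - by move=> k; exact: (nnmM _ _ (nnm_SopT k _ _ al0 nf) ng).1.
  - by move=> k x _; exact: (nnmM _ _ (nnm_SopT k _ _ al0 nf) ng).2.
  apply: eq_integral => x _; rewrite muleC -nneseriesMl ?ng.2//.
    by apply: eq_eseriesr => k _; rewrite muleC.
  by move=> k; exact: (nnm_SopT k _ _ al0 nf).2.
apply: eq_eseriesr => k _.
under eq_integral do rewrite muleCA.
under [RHS]eq_integral do rewrite -muleA.
rewrite !ge0_integralZl ?lee_fin ?integral_iter_Hop_sym//.
- exact: (nnmM _ _ (nnm_iter_Hop k _ nf) ng).1.
- by move=> x _; exact: (nnmM _ _ (nnm_iter_Hop k _ nf) ng).2.
- exact: (nnmM _ _ nf (nnm_iter_Hop k _ ng)).1.
- by move=> x _; exact: (nnmM _ _ nf (nnm_iter_Hop k _ ng)).2.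
Qed.

Lemma nneseries_delta (m : nat) (c : \bar R) : 0 <= c ->
  \sum_(k <oo) (if k == m then c else 0) = c.
Proof.
move=> c0; rewrite (@nneseriesD1 _ _ m) ?eqxx//=; last by move=> k _; case: eqP.
by rewrite eseries0 ?adde0// => k _ /negbTE ->.
Qed.

Lemma Sop_conv al be f x : (forall i, (0 <= al i)%R) -> (forall i, (0 <= be i)%R) ->
  nnm f -> Sop (sconv al be) f x = Sop al (Sop be f) x.
Proof.
move=> al0 be0 nf.
have it0 k y : 0 <= iter k Hop f y by exact: (nnm_iter_Hop _ _ nf).2.
pose F i j := (al i * be j)%:E * iter (i + j) Hop f x.
have F0 i j : 0 <= F i j by rewrite mule_ge0 ?lee_fin ?mulr_ge0.
transitivity (\sum_(i <oo) \sum_(j <oo) F i j); last first.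
  apply: eq_eseriesr => i _.
  rewrite (_ : iter i Hop (Sop be f) x = \sum_(j <oo) iter i Hop (fun y => (be j)%:E * iter j Hop f y) x).
    rewrite -nneseriesZl; last first.
      by move=> j _; exact: (nnm_iter_Hop _ _ (nnm_SopT j _ _ be0 nf)).2.
    apply: eq_eseriesr => j _; rewrite iter_HopZ//; last exact: nnm_iter_Hop.
    by rewrite -iterD /F EFinM muleA.
  by rewrite -iter_Hop_nneseries// => j; exact: nnm_SopT.
(* Each term becomes a series in [k] supported at k = i + j, so that summation along diagonals
   reduces to exchanges of nonnegative series. *)
transitivity (\sum_(i <oo) \sum_(j <oo) \sum_(k <oo) (if k == (i + j)%N then F i j else 0)); last first.
  apply: eq_eseriesr => i _; apply: eq_eseriesr => j _; exact: nneseries_delta.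
have D0 i j k : 0 <= (if k == (i + j)%N then F i j else 0) by case: ifP.
transitivity (\sum_(i <oo) \sum_(k <oo) \sum_(j <oo) (if k == (i + j)%N then F i j else 0)); last first.
  by apply: eq_eseriesr => i _; rewrite nneseries_interchange.
rewrite nneseries_interchange; last by move=> i k; apply: nneseries_ge0 => j _ _.
apply: eq_eseriesr => k _.
transitivity (\sum_(i <oo) (if (i <= k)%N then F i (k - i)%N else 0)).
  rewrite (@nneseries_split _ _ 0 k.+1); last by move=> i _; case: ifP.
  rewrite add0n eseries0 ?adde0; last by move=> i ki _; rewrite leqNgt ki.
  rewrite big_mkord /sconv.
  have ik (i : 'I_k.+1) : (i <= k)%N by rewrite -ltnS.
  under [RHS]eq_bigr => i _ do rewrite ik /F subnKC//.
  rewrite -sumEFin ge0_sume_distrl// => i _.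
  by rewrite lee_fin mulr_ge0.
apply: eq_eseriesr => i _; case: leqP => ik; last first.
  rewrite eseries0// => j _ _; case: eqP => // kij.
  by move: ik; rewrite kij ltnNge leq_addr.
rewrite -[LHS](@nneseries_delta (k - i)%N)//.
apply: eq_eseriesr => j _.
have -> : (k == (i + j)%N) = (j == (k - i)%N) by rewrite -{1}(subnKC ik) eqn_add2l eq_sym.
by case: eqP => // ->.
Qed.

Lemma eqe_cancel (a b c : \bar R) : c \is a fin_num -> a + c = b + c -> a = b.
Proof. by move=> fc /(congr1 (fun z => z - c)); rewrite !addeK. Qed.

Lemma le_bounded_fin (f : \bar R) (c : R) : 0 <= f -> f <= c%:E -> f \is a fin_num.
Proof. by move=> f0 fc; rewrite ge0_fin_numE// (le_lt_trans fc)// ltry. Qed.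

(** * Toppling: retained height and odometer *)

Section sandpile.
Context (al : nat -> R) (rho : R) (al0 : forall i, (0 <= al i)%R)
  (rhoE : \sum_(k <oo) (al k)%:E = rho%:E) (rho1 : (rho < 1)%R).
Context (F : T -> \bar R) (M l : R) (nF : nnm F) (M0 : (0 <= M)%R)
  (FM : forall x, F x <= M%:E) (l0 : (0 < l)%R)
  (iF : \int[mu]_x F x < +oo).

(* Parallel toppling: the excess over [l] is redistributed by the operator of [al];
   [odometer x] is the total mass toppled at [x]. *)
Fixpoint sand (k : nat) : T -> \bar R := match k with
  | 0 => F
  | k.+1 => fun x => mine (sand k x) l%:E +
              Sop al (fun y => maxe (sand k y - l%:E) 0) x
  end.

Definition sand_low k x := mine (sand k x) l%:E.
Definition sand_exc k x := maxe (sand k x - l%:E) 0.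
Definition odometer x := \sum_(k <oo) sand_exc k x.
Definition settled x := limn (sand_low ^~ x).

Lemma nnm_sand_exc k : nnm (sand k) -> nnm (sand_exc k).
Proof.
move=> ns; split; last by move=> x; rewrite le_max lexx orbT.
apply: measurable_maxe => //; apply: emeasurable_funB => //; exact: ns.1.
Qed.

Lemma nnm_sand_low k : nnm (sand k) -> nnm (sand_low k).
Proof.
move=> ns; split; last by move=> x; rewrite le_min ns.2/= lee_fin ltW.
by apply: measurable_mine => //; exact: ns.1.
Qed.

Lemma nnm_sand k : nnm (sand k).
Proof.
elim: k => //= k IH; apply: nnmD; first exact: nnm_sand_low.
by apply: nnm_Sop => //; exact: nnm_sand_exc.
Qed.

Let nlow k := nnm_sand_low k (nnm_sand k).
Let nexc k := nnm_sand_exc k (nnm_sand k).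

Lemma sand_split k x : sand_low k x + sand_exc k x = sand k x.
Proof.
have := (nnm_sand k).2 x; rewrite /sand_low /sand_exc.
case: (sand k x) => [r r0| _|]//.
rewrite -EFinB -EFin_min -EFin_max -EFinD; congr EFin.
by case: (leP r l) => rl; [rewrite max_r|rewrite max_l]; lra.
Qed.

Lemma sum_weights_ge0 : (0 <= rho)%R.
Proof. by rewrite -lee_fin -rhoE; apply: nneseries_ge0 => k _ _; rewrite lee_fin. Qed.

(** The fixed point of c -> M + rho c, hence a bound preserved by the recursion of the partial
    odometers. *)
Let C := (M / (1 - rho))%R.

Let C_ge0 : (0 <= C)%R.
Proof. by rewrite divr_ge0// subr_ge0 ltW. Qed.

Let CE : (M + C * rho = C)%R.
Proof. by rewrite /C; field; rewrite gt_eqF// subr_gt0. Qed.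

Let U k x := \sum_(j < k) sand_exc j x.

Let nU k : nnm (U k).
Proof.
split; first by apply: emeasurable_sum => j; exact: (nexc _).1.
by move=> x; apply: sume_ge0 => j _; exact: (nexc _).2.
Qed.

(** Conservation of mass, telescoped. The left side has one more excess than the right because the
    last one has been removed but not yet redistributed. *)
Lemma sand_partial k x :
  sand_low k x + \sum_(j < k.+1) sand_exc j x =
  F x + Sop al (fun y => \sum_(j < k) sand_exc j y) x.
Proof.
elim: k x => [|k IH] x.
  rewrite big_ord_recl big_ord0 adde0 sand_split/=.
  rewrite (_ : (fun y => _) = cst 0%:E); last by apply/funext => y; rewrite big_ord0.
  by rewrite Sop_cst// mul0e adde0.
rewrite big_ord_recr/= addeCA sand_split [sand k.+1 x]/=.
rewrite addeA [\sum_(_ < _) _ + _]addeC -/(sand_low k x) IH -addeA; congr (_ + _).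
rewrite -SopD//; [|exact: nU|exact: nexc].
by congr (Sop al _ x); apply/funext => y; rewrite big_ord_recr.
Qed.

Lemma sum_sand_exc_le k x : U k x <= C%:E.
Proof.
elim: k x => [|k IH] x; first by rewrite /U big_ord0 lee_fin.
have := sand_partial k x; rewrite -/(U k.+1 x) -/(U k) => E.
apply: (@le_trans _ _ (F x + Sop al (U k) x)).
  by rewrite -E leeDr// (nlow k).2.
apply: (@le_trans _ _ (M%:E + Sop al (cst C%:E) x)).
  by apply: leeD => //; apply: Sop_le => //; exact: nnm_cst.
by rewrite Sop_cst// rhoE -EFinM -EFinD CE.
Qed.

Lemma nnm_odometer : nnm odometer.
Proof. by apply: nnm_nneseries => k; exact: nexc. Qed.

Lemma odometer_partial_cvg x : (U k x) @[k --> \oo] --> odometer x.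
Proof.
rewrite /U; under eq_fun do rewrite -(big_mkord xpredT (fun j => sand_exc j x)).
by apply: is_cvg_nneseries => k _ _; exact: (nexc k).2.
Qed.

Lemma odometer_le x : odometer x <= (M / (1 - rho))%:E.
Proof.
rewrite -(cvg_lim _ (odometer_partial_cvg x))//.
apply: lime_le; first by apply/cvg_ex; eexists; exact: odometer_partial_cvg.
by apply: nearW => k; exact: sum_sand_exc_le.
Qed.

(** Only the part above [l] is ever removed, so the retained height can only gain from the
    redistribution. *)
Lemma sand_low_nd x : {homo (sand_low ^~ x) : i j / (i <= j)%N >-> i <= j}.
Proof.
apply/nondecreasing_seqP => k; rewrite /sand_low /= le_min; apply/andP; split; last first.
  by rewrite ge_min lexx orbT.
by rewrite leeDl//; exact: (nnm_Sop _ _ al0 (nexc k)).2.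
Qed.

Lemma settled_cvg x : (sand_low k x) @[k --> \oo] --> settled x.
Proof. by apply: ereal_nondecreasing_is_cvgn; exact: sand_low_nd. Qed.

Lemma settled_ge k x : sand_low k x <= settled x.
Proof.
apply: lime_ge; first by apply/cvg_ex; eexists; exact: settled_cvg.
by exists k => // j /= kj; exact: sand_low_nd.
Qed.

Lemma settled_le x : settled x <= l%:E.
Proof.
apply: lime_le; first by apply/cvg_ex; eexists; exact: settled_cvg.
by apply: nearW => k; rewrite ge_min lexx orbT.
Qed.

Lemma nnm_settled : nnm settled.
Proof.
split.
  apply: (emeasurable_fun_cvg sand_low) => [k|x _]; first exact: (nlow k).1.
  exact: settled_cvg.
by move=> x; apply: le_trans (settled_ge 0 x); exact: (nlow 0).2.
Qed.

(** If anything was toppled at x, the retained height was [l] at that step, and it never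
    decreases. *)
Lemma odometer_gt0 x : 0 < odometer x -> settled x = l%:E.
Proof.
move=> u0; apply/eqP; rewrite eq_le settled_le/=.
have [k ek] : exists k, 0 < sand_exc k x.
  apply: contrapT => /forallNP H; move: u0; rewrite /odometer eseries0 ?ltxx// => k _ _.
  by apply/eqP; rewrite eq_le (nexc k).2 andbT leNgt; apply/negP.
apply: le_trans (settled_ge k x); rewrite /sand_low le_min lexx andbT.
by move: ek; rewrite /sand_exc lt_max ltxx orbF sube_gt0 => /ltW.
Qed.

Lemma odometerE x : settled x + odometer x = F x + Sop al odometer x.
Proof.
have H1 : (sand_low k x + U k.+1 x) @[k --> \oo] --> settled x + odometer x.
  apply: cvgeD; [|exact: settled_cvg|].
    rewrite ge0_adde_def// inE; [exact: nnm_settled.2|exact: nnm_odometer.2].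
  by have := odometer_partial_cvg x; rewrite -(cvg_shiftS (U ^~ x)).
have H2 : (sand_low k x + U k.+1 x) @[k --> \oo] --> F x + Sop al odometer x.
  rewrite /U; under eq_fun do rewrite sand_partial.
  apply: cvgeD; [|exact: cvg_cst|].
    by rewrite ge0_adde_def// inE ?nF.2// (nnm_Sop _ _ al0 nnm_odometer).2.
  rewrite /odometer Sop_nneseries//.
  rewrite (_ : (fun k => _) = (fun k => \sum_(0 <= j < k) Sop al (sand_exc j) x)).
    by apply: is_cvg_nneseries => k _ _; exact: (nnm_Sop _ _ al0 (nexc k)).2.
  apply/funext; elim=> [|k IH].
    rewrite (_ : (fun y => _) = cst 0%:E); last by apply/funext => y; rewrite big_ord0.
    by rewrite Sop_cst// mul0e big_nil.
  rewrite big_nat_recr//= -IH -SopD//; last exact: nU.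
  by congr (Sop al _ x); apply/funext => y; rewrite big_ord_recr.
by rewrite -(cvg_lim _ H1)// (cvg_lim _ H2).
Qed.

(** The fixed-point bound again, now for integrals. Finiteness is what allows the odometer to be
    cancelled in the global mass balance and tested in the energy estimate. *)
Lemma integral_odometer_lty : \int[mu]_x odometer x < +oo.
Proof.
have [r0 iFr] : exists r : R, \int[mu]_x F x = r%:E.
  exists (fine (\int[mu]_x F x)); rewrite fineK// ge0_fin_numE//.
  by apply: integral_ge0 => x _; exact: nF.2.
have r00 : (0 <= r0)%R by rewrite -lee_fin -iFr; apply: integral_ge0 => x _; exact: nF.2.
have iU k : \int[mu]_x U k x <= (r0 / (1 - rho))%:E.
  elim: k => [|k IH].
    under eq_integral do rewrite /U big_ord0.
    by rewrite integral0 lee_fin divr_ge0// subr_ge0 ltW.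
  apply: (@le_trans _ _ (\int[mu]_x (F x + Sop al (U k) x))).
    apply: ge0_le_integral => //.
    - by move=> x _; exact: (nU _).2.
    - exact: (nU _).1.
    - exact: (nnmD _ _ nF (nnm_Sop _ _ al0 (nU k))).1.
    - by move=> x _; rewrite -sand_partial leeDr// (nlow k).2.
  rewrite ge0_integralD//; last 4 first.
  - by move=> x _; exact: nF.2.
  - exact: nF.1.
  - by move=> x _; exact: (nnm_Sop _ _ al0 (nU k)).2.
  - exact: (nnm_Sop _ _ al0 (nU k)).1.
  rewrite integral_Sop//.
  have -> : \sum_(j <oo) (al j)%:E * \int[mu]_x U k x = rho%:E * \int[mu]_x U k x.
    rewrite -rhoE muleC -nneseriesMl//; last by apply: integral_ge0 => x _; exact: (nU k).2.
    by apply: eq_eseriesr => j _; rewrite muleC.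
  rewrite iFr; apply: (@le_trans _ _ (r0%:E + rho%:E * (r0 / (1 - rho))%:E)).
    by apply: leeD => //; apply: lee_wpmul2l => //; rewrite lee_fin sum_weights_ge0.
  have E : (r0 + rho * (r0 / (1 - rho)) = r0 / (1 - rho))%R.
    by field; rewrite gt_eqF// subr_gt0.
  by rewrite -EFinM -EFinD E.
apply: (@le_lt_trans _ _ (r0 / (1 - rho))%:E); last exact: ltry.
have cvU : (\int[mu]_x U k x) @[k --> \oo] --> \int[mu]_x odometer x.
  have -> : \int[mu]_x odometer x = \int[mu]_x (limn (U ^~ x)).
    by apply: eq_integral => x _; rewrite (cvg_lim _ (odometer_partial_cvg x)).
  apply: cvg_monotone_convergence => //.
  - by move=> k; exact: (nU k).1.
  - by move=> k x _; exact: (nU k).2.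
  - move=> x _; apply/nondecreasing_seqP => k; rewrite /U big_ord_recr/=.
    by rewrite leeDl// (nexc k).2.
rewrite -(cvg_lim _ cvU)//; apply: lime_le; first by apply/cvg_ex; eexists; exact: cvU.
by apply: nearW => k; exact: iU.
Qed.

(** Integrating [odometerE]: redistribution returns only the fraction rho <= 1 of the toppled
    mass. *)
Lemma integral_settled_le : \int[mu]_x settled x <= \int[mu]_x F x.
Proof.
have E : \int[mu]_x settled x + \int[mu]_x odometer x =
         \int[mu]_x F x + rho%:E * \int[mu]_x odometer x.
  have -> : rho%:E * \int[mu]_x odometer x = \int[mu]_x Sop al odometer x.
    rewrite integral_Sop//; last exact: nnm_odometer.
    rewrite -rhoE muleC -nneseriesMl//; last by apply: integral_ge0 => x _; exact: nnm_odometer.2.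
    by apply: eq_eseriesr => j _; rewrite muleC.
  rewrite -!ge0_integralD//; first by apply: eq_integral => x _; exact: odometerE.
  - by move=> x _; exact: nF.2.
  - exact: nF.1.
  - by move=> x _; exact: (nnm_Sop _ _ al0 nnm_odometer).2.
  - exact: (nnm_Sop _ _ al0 nnm_odometer).1.
  - by move=> x _; exact: nnm_settled.2.
  - exact: nnm_settled.1.
  - by move=> x _; exact: nnm_odometer.2.
  - exact: nnm_odometer.1.
have fo : \int[mu]_x odometer x \is a fin_num.
  rewrite ge0_fin_numE ?integral_odometer_lty//.
  by apply: integral_ge0 => x _; exact: nnm_odometer.2.
rewrite -(leeD2rE _ _ fo) E; apply: leeD => //.
rewrite -[leRHS]mul1e; apply: lee_wpmul2r; last by rewrite lee_fin ltW.
by apply: integral_ge0 => x _; exact: nnm_odometer.2.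
Qed.

End sandpile.

Lemma Hop_le_cst f (c : R) x : nnm f -> (0 <= c)%R -> (forall y, f y <= c%:E) ->
  Hop f x <= c%:E.
Proof.
move=> nf c0 fc; rewrite -[leRHS](Hop_cst c x c0).
by apply: Hop_le => //; exact: nnm_cst.
Qed.

Lemma Sop_le_cst al f (c s : R) x : (forall i, (0 <= al i)%R) -> nnm f -> (0 <= c)%R ->
  \sum_(k <oo) (al k)%:E = s%:E -> (forall y, f y <= c%:E) ->
  Sop al f x <= (c * s)%:E.
Proof.
move=> al0 nf c0 sE fc; rewrite EFinM -sE -(Sop_cst _ _ x)//.
by apply: Sop_le => //; exact: nnm_cst.
Qed.

Lemma fin_num_integral_nnm f : nnm f -> \int[mu]_x f x < +oo ->
  \int[mu]_x f x \is a fin_num.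
Proof. by move=> nf ?; rewrite ge0_fin_numE// integral_ge0// => x _; exact: nf.2. Qed.

Lemma integralD_nnm f g : nnm f -> nnm g ->
  \int[mu]_x (f x + g x) = \int[mu]_x f x + \int[mu]_x g x.
Proof.
move=> nf ng; rewrite ge0_integralD//.
- by move=> x _; exact: nf.2.
- exact: nf.1.
- by move=> x _; exact: ng.2.
- exact: ng.1.
Qed.

Lemma integralZ_nnm (c : R) f : nnm f -> (0 <= c)%R ->
  \int[mu]_x (c%:E * f x) = c%:E * \int[mu]_x f x.
Proof.
move=> nf c0; rewrite ge0_integralZl//; first exact: nf.1.
by move=> x _; exact: nf.2.
Qed.

Lemma le_integral_nnm f g : nnm f -> nnm g -> (forall x, f x <= g x) ->
  \int[mu]_x f x <= \int[mu]_x g x.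
Proof.
move=> nf ng fg; apply: ge0_le_integral => //.
- by move=> x _; exact: nf.2.
- exact: nf.1.
- exact: ng.1.
Qed.

Lemma double_le (a b : \bar R) : 0 <= a -> 0 <= b -> a + a <= b + b -> a <= b.
Proof.
case: a => [a| |]// _; case: b => [b| |]// _; rewrite ?leey//.
by rewrite -!EFinD !lee_fin; lra.
Qed.

(** Rearrangement inequality: truncation at [e] preserves the order of [a] and [b]. *)
Lemma min_rearrangement (e a b : R) :
  (Num.min a e * b + a * Num.min b e <= a * Num.min a e + b * Num.min b e)%R.
Proof.
have : (0 <= (a - b) * (Num.min a e - Num.min b e))%R.
  have [ab|ba] := leP a b.
    by rewrite mulr_le0 ?subr_le0// le_min !ge_min ab lexx ?orbT.
  by rewrite mulr_ge0 ?subr_ge0 ?(ltW ba)// le_min !ge_min (ltW ba) lexx ?orbT.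
rewrite mulrBl !mulrBr; lra.
Qed.

(* The inequality [u <= k0 + q H u] is tested against [min(u, e)]. *)
Lemma supersolution_energy (q e kap : R) (u : T -> R) (k0 : T -> \bar R) :
  (0 < q)%R -> (q <= 1)%R -> (0 < e)%R -> (0 <= kap)%R ->
  measurable_fun setT u -> (forall x, 0 <= u x)%R ->
  \int[mu]_x (u x)%:E < +oo -> nnm k0 -> \int[mu]_x k0 x <= kap%:E ->
  (forall x, (0 < u x)%R -> (u x)%:E <= k0 x + q%:E * Hop (EFin \o u) x) ->
  q%:E * \int[mu]_x ((\1_[set x | u x = 0%R] x)%:E *
                     Hop (fun y => (u y * Num.min (u y) e)%:E) x) <= (e * kap)%:E.
Proof.
move=> q0 q1 e0 kap0 mu_ u0 iu nk0 ik uk0.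
have nE (f : T -> R) : measurable_fun setT f -> (forall x, 0 <= f x)%R -> nnm (EFin \o f).
  by move=> mf f0; split=> [|x]; [exact/measurable_EFinP|rewrite /= lee_fin].
pose phi x := Num.min (u x) e.
have phi0 x : (0 <= phi x)%R by rewrite le_min u0 ltW.
have mphi : measurable_fun setT phi by exact: measurable_minr.
have nu : nnm (EFin \o u) by exact: nE.
have nphi : nnm (EFin \o phi) by exact: nE.
pose up x := (u x * phi x)%R.
have nup : nnm (EFin \o up).
  by apply: nE => [|x]; [exact: measurable_funM|rewrite mulr_ge0].
have mO : measurable [set x | u x = 0%R].
  by have := mu_ measurableT [set 0%R] (measurable_set1 _); rewrite setTI.
pose Oc : T -> R := \1_[set x | u x = 0%R].
pose O : T -> R := \1_(~` [set x | u x = 0%R]).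
have nOc : nnm (EFin \o Oc) by apply: nE => //; exact: measurable_indic.
have nO : nnm (EFin \o O).
  by apply: nE => //; apply: measurable_indic; exact: measurableC.
have OOc x : (O x + Oc x = 1)%R.
  by rewrite /O /Oc !indicE in_setC; case: (_ \in _) => /=; rewrite ?addr0 ?add0r.
have Oprop x : (u x = 0 /\ phi x = 0)%R \/ O x = 1%R.
  have [ux|ux] := eqVneq (u x) 0%R.
    by left; split=> //; rewrite /phi ux; apply/min_idPl/ltW.
  by right; rewrite /O indicE mem_set//=; exact/eqP.
have O0 x : (0 <= O x)%R by [].
(* The integral [N] of u phi splits as B + D, according as one step of H ends where u > 0 or where u
   = 0. The hypothesis tested with phi gives N <= e kap + q A, and rearrangement gives A <= B; hence
   q D = q N - q B <= N - q A <= e kap. *)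
pose A := \int[mu]_x ((phi x)%:E * Hop (EFin \o u) x).
pose N := \int[mu]_x (up x)%:E.
pose B := \int[mu]_x ((up x)%:E * Hop (EFin \o O) x).
pose D := \int[mu]_x ((Oc x)%:E * Hop (EFin \o up) x).
have nHu := nnm_Hop _ nu. have nHphi := nnm_Hop _ nphi. have nHup := nnm_Hop _ nup.
have nHO := nnm_Hop _ nO. have nHOc := nnm_Hop _ nOc.
rewrite -/D.
have n1 := nnmM _ _ nphi nHu. have n2 := nnmM _ _ nu nHphi.
have n3 := nnmM _ _ nup nHO. have n4 := nnmM _ _ nO nHup.
have n5 := nnmM _ _ nHOc nup. have n6 := nnmM _ _ nOc nHup.
have NE : B + D = N.
  rewrite /D (integral_Hop_sym _ _ nOc nup) /B -(integralD_nnm _ _ n3 n5).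
  apply: eq_integral => x _; rewrite [X in _ + X]muleC -ge0_muleDr; [|exact: nHO.2|exact: nHOc.2].
  rewrite -(HopD _ _ x nO nOc) (_ : (fun y => _) = cst 1%:E).
    by rewrite Hop_cst ?mule1.
  by apply/funext => y /=; rewrite -EFinD OOc.
have finN : N \is a fin_num.
  apply: (fin_num_integral_nnm _ nup).
  apply: (@le_lt_trans _ _ (\int[mu]_x (e%:E * (u x)%:E))).
    apply: (le_integral_nnm _ _ nup); first by apply: (nnmZ _ _ (ltW e0) nu).
    by move=> x; rewrite /= -EFinM lee_fin /up mulrC ler_wpM2r// ge_min lexx orbT.
  rewrite (integralZ_nnm _ _ nu (ltW e0)).
  by rewrite lte_mul_pinfty ?lee_fin ?ltW.
have N1 : N <= (e * kap)%:E + q%:E * A.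
  have nq1 := nnmZ _ _ (ltW q0) n1. have nek := nnmZ _ _ (ltW e0) nk0.
  rewrite /A -(integralZ_nnm _ _ n1 (ltW q0)).
  apply: (@le_trans _ _ (\int[mu]_x (e%:E * k0 x + q%:E * ((phi x)%:E * Hop (EFin \o u) x)))).
    apply: (le_integral_nnm _ _ nup (nnmD _ _ nek nq1)) => x.
    have [xu|xu] := eqVneq (u x) 0%R.
      by rewrite /= /up xu mul0r adde_ge0 ?nek.2 ?nq1.2.
    apply: (@le_trans _ _ ((phi x)%:E * (k0 x + q%:E * Hop (EFin \o u) x))).
      rewrite /= /up EFinM muleC lee_wpmul2l ?lee_fin// uk0//.
      by rewrite lt_neqAle eq_sym xu u0.
    rewrite ge0_muleDr ?nk0.2 ?(nnmZ _ _ (ltW q0) nHu).2// [q%:E * ((phi x)%:E * _)]muleCA.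
    rewrite leeD2r// lee_wpmul2r ?nk0.2// lee_fin ge_min lexx orbT//.
  rewrite (integralD_nnm _ _ nek nq1) leeD2r// (integralZ_nnm _ _ nk0 (ltW e0)).
  by rewrite EFinM lee_wpmul2l// lee_fin ltW.
have A0 : 0 <= A by apply: integral_ge0 => x _; exact: n1.2.
have B0 : 0 <= B by apply: integral_ge0 => x _; exact: n3.2.
have D0 : 0 <= D by apply: integral_ge0 => x _; exact: n6.2.
(* Doubling symmetrizes both bilinear forms; their integrands under the kernel then compare
   pointwise. *)
have AB : A <= B.
  have : A + A <= B + B.
    have -> : A + A = \int[mu]_x ((phi x)%:E * Hop (EFin \o u) x + (u x)%:E * Hop (EFin \o phi) x).
      rewrite (integralD_nnm _ _ n1 n2); congr (_ + _).
      by rewrite (integral_Hop_sym _ _ nu nphi); apply: eq_integral => x _; rewrite muleC.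
    have -> : B + B = \int[mu]_x ((up x)%:E * Hop (EFin \o O) x + (O x)%:E * Hop (EFin \o up) x).
      rewrite (integralD_nnm _ _ n3 n4); congr (_ + _).
      by rewrite (integral_Hop_sym _ _ nO nup); apply: eq_integral => x _; rewrite muleC.
    apply: (le_integral_nnm _ _ (nnmD _ _ n1 n2) (nnmD _ _ n3 n4)) => x.
    change ((phi x)%:E * Hop (EFin \o u) x + (u x)%:E * Hop (EFin \o phi) x <=
      (up x)%:E * Hop (EFin \o O) x + (O x)%:E * Hop (EFin \o up) x).
    have [[ux phx]|Ox] := Oprop x.
      by rewrite ux phx !mul0e adde0; exact: (nnmD _ _ n3 n4).2.
    have up0 : (0 <= up x)%R by rewrite mulr_ge0.
    rewrite Ox mul1e.
    have za := nnmZ _ _ (phi0 x) nu. have zb := nnmZ _ _ (u0 x) nphi.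
    have zc := nnmZ _ _ up0 nO.
    rewrite -(HopZ _ _ x (phi0 x) nu) -(HopZ _ _ x (u0 x) nphi) -(HopZ _ _ x up0 nO).
    rewrite -(HopD _ _ x za zb) -(HopD _ _ x zc nup).
    apply: (Hop_le _ _ x (nnmD _ _ za zb) (nnmD _ _ zc nup)) => y /=.
    rewrite -!EFinM -!EFinD lee_fin.
    have [[uy phy]|Oy] := Oprop y.
      by rewrite /up uy phy !mulr0 !addr0 mulr_ge0 ?O0 ?up0.
    by rewrite Oy mulr1; exact: min_rearrangement.
  refine (double_le A B A0 B0).
move: finN N1 AB NE A0 B0 D0.
case: (N) => [n| |]// _; case: (A) => [a| |]//; case: (B) => [b| |]//; case: (D) => [dd| |]//.
rewrite -!EFinM -!EFinD !lee_fin => N1 AB [NE] a0 b0 d0.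
have : (q * a <= q * b)%R by rewrite ler_pM2l.
have : (q * n <= n)%R by rewrite ler_piMl// -NE addr_ge0.
rewrite -NE mulrDr; lra.
Qed.

(** * Obstacle identity and energy of the inverse square root B *)

Section dirichlet_form.
Context (al be : nat -> R) (rho S q : R)
  (al0 : forall i, (0 <= al i)%R) (be0 : forall i, (0 <= be i)%R)
  (rhoE : \sum_(k <oo) (al k)%:E = rho%:E) (rho1 : (rho < 1)%R)
  (SE : \sum_(k <oo) (be k)%:E = S%:E)
  (q0 : (0 < q)%R) (q1 : (q <= 1)%R)
  (beE : forall f x, nnm f -> Sop be f x = f x + Sop al (Sop be f) x)
  (beE' : forall f x, nnm f -> Sop be f x = f x + Sop be (Sop al f) x)
  (be_al : forall f x, nnm f ->
    Sop be f x + Sop al f x = f x + q%:E * Hop (Sop be f) x).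

Let rho_ge0 := sum_weights_ge0 al rho al0 rhoE.

Let S0 : (0 <= S)%R.
Proof. by rewrite -lee_fin -SE; apply: nneseries_ge0 => k _ _; rewrite lee_fin. Qed.

Section obstacle.
Context (F : T -> \bar R) (M l : R) (nF : nnm F) (M0 : (0 <= M)%R)
  (FM : forall x, F x <= M%:E) (l0 : (0 < l)%R)
  (iF : \int[mu]_x F x < +oo).

Let u := odometer al F l.
Let g := settled al F l.
Let nu : nnm u := nnm_odometer al al0 F l nF l0.
Let ng : nnm g := nnm_settled al al0 F l nF l0.
Let C := (M / (1 - rho))%R.
Let C0 : (0 <= C)%R. Proof. by rewrite divr_ge0// subr_ge0 ltW. Qed.
Let uC x : u x <= C%:E. Proof. exact: odometer_le. Qed.
Let gl x : g x <= l%:E. Proof. exact: settled_le. Qed.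

(** Apply B to g + u = F + P u and use B u = u + B P u; the term B P u is finite and cancels. *)
Lemma resolvent_obstacle x : Sop be F x = Sop be g x + u x.
Proof.
have fB f (c : R) : nnm f -> (0 <= c)%R -> (forall y, f y <= c%:E) ->
    Sop be f x \is a fin_num.
  move=> nf c0 fc; apply: (le_bounded_fin _ (c * S)); first exact: (nnm_Sop _ _ be0 nf).2.
  exact: Sop_le_cst.
have nPu : nnm (Sop al u) by exact: nnm_Sop.
have fPu : Sop be (Sop al u) x \is a fin_num.
  apply: (fB _ (C * rho)%R) => //; first by rewrite mulr_ge0.
  by move=> y; exact: Sop_le_cst.
have := congr1 (fun f => Sop be f x) (funext (odometerE al al0 F l nF l0 : forall x, _)).
rewrite -/u -/g SopD// SopD// (beE' u)// addeA.
by move/(eqe_cancel _ _ _ fPu).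
Qed.

Context (k0 : T -> \bar R) (nk0 : nnm k0)
  (Fk0 : forall x, F x <= Sop al F x + k0 x).

(** Subtracting the identities B + P = 1 + q H B at [F] and at [g] gives u = q H u + (F - P F) - (g
    - P g). Where u > 0 the last bracket is l - P g, which is nonnegative because g <= l and P has
    mass at most 1; the first bracket is at most [k0]. *)
Lemma odometer_le_Hop x : 0 < u x -> u x <= k0 x + q%:E * Hop u x.
Proof.
move=> ux; have [->|] := eqVneq (k0 x) +oo.
  rewrite addye ?leey// gt_eqF// (lt_le_trans (ltNyr 0))// mule_ge0 ?lee_fin ?(ltW q0)//.
  exact: (nnm_Hop _ nu).2.
move=> k0oo; have gx : g x = l%:E by exact: odometer_gt0.
have nB f : nnm f -> nnm (Sop be f) by exact: nnm_Sop.
have finB f (c : R) y : nnm f -> (0 <= c)%R -> (forall y, f y <= c%:E) ->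
    Sop be f y \is a fin_num.
  move=> nf c0 fc; apply: (le_bounded_fin _ (c * S)); first exact: (nnm_Sop _ _ be0 nf).2.
  exact: Sop_le_cst.
have finP f (c : R) y : nnm f -> (0 <= c)%R -> (forall y, f y <= c%:E) ->
    Sop al f y \is a fin_num.
  move=> nf c0 fc; apply: (le_bounded_fin _ (c * rho)); first exact: (nnm_Sop _ _ al0 nf).2.
  exact: Sop_le_cst.
have finH f (c : R) y : nnm f -> (0 <= c)%R -> (forall y, f y <= c%:E) ->
    Hop f y \is a fin_num.
  move=> nf c0 fc; apply: (le_bounded_fin _ c); first exact: (nnm_Hop _ nf).2.
  exact: Hop_le_cst.
have EF := be_al F x nF; have Eg := be_al g x ng.
have HB : Hop (Sop be F) x = Hop (Sop be g) x + Hop u x.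
  rewrite -HopD//; last exact: nB.
  by congr (Hop _ x); apply/funext => y; exact: resolvent_obstacle.
have Pg : Sop al g x <= l%:E.
  apply: (@le_trans _ _ (l * rho)%:E); first by apply: Sop_le_cst => //; exact: ltW.
  by rewrite lee_fin ler_piMr// ltW.
have := Fk0 x; move: EF Eg; rewrite resolvent_obstacle HB gx.
have := nk0.2 x; move: k0oo.
have := FM x; have := nF.2 x.
have := finB g l x ng (ltW l0) gl.
have := finP F M x nF M0 FM.
have := finP g l x ng (ltW l0) gl.
have := finH u C x nu C0 uC.
have : Hop (Sop be g) x \is a fin_num.
  apply: (finH _ (l * S)%R); [exact: nB|by rewrite mulr_ge0// ltW|].
  by move=> y; apply: Sop_le_cst => //; exact: ltW.
have : u x \is a fin_num by exact: (le_bounded_fin _ C (nu.2 x) (uC x)).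
move: Pg.
case: (F x) => [Fx| |]//; case: (u x) => [ur| |]//; case: (Hop (Sop be g) x) => [b| |]//.
case: (Hop u x) => [c| |]//; case: (Sop al g x) => [d'| |]//; case: (Sop al F x) => [e| |]//.
case: (Sop be g x) => [v| |]//.
case: (k0 x) => [k| |]//.
rewrite -?EFinM -!EFinD -?EFinM !lee_fin => Pg _ _ _ _ _ _ _ _ _ _ [EF] [Eg] FP.
lra.
Qed.

End obstacle.

Lemma fin_pairing (f g : T -> \bar R) (c : R) : nnm f -> nnm g -> (0 <= c)%R ->
  (forall x, g x <= c%:E) -> \int[mu]_x f x < +oo ->
  \int[mu]_x (f x * g x) \is a fin_num.
Proof.
move=> nf ng c0 gc fi; apply: (fin_num_integral_nnm _ (nnmM _ _ nf ng)).
apply: (@le_lt_trans _ _ (\int[mu]_x (c%:E * f x))).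
  apply: (le_integral_nnm _ _ (nnmM _ _ nf ng) (nnmZ _ _ c0 nf)) => x.
  by rewrite muleC lee_wpmul2r ?nf.2.
by rewrite (integralZ_nnm _ _ nf c0) lte_mul_pinfty.
Qed.

(** In operator form (1 - q H) B = 1 - P, the operator P is symmetric, and (1 - P) B = 1: so the
    form of 1 - q H at (B g1, B g2) is the pairing of g1 with g2. *)
Lemma resolvent_pairing (g1 g2 : T -> \bar R) (l : R) : nnm g1 -> nnm g2 ->
  (0 <= l)%R -> (forall x, g1 x <= l%:E) -> (forall x, g2 x <= l%:E) ->
  \int[mu]_x g1 x < +oo ->
  \int[mu]_x (Sop be g1 x * Sop be g2 x) =
  \int[mu]_x (g1 x * g2 x) + q%:E * \int[mu]_x (Hop (Sop be g1) x * Sop be g2 x).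
Proof.
move=> n1 n2 l_ge0 g1l g2l i1.
have nv1 := nnm_Sop _ _ be0 n1; have nv2 := nnm_Sop _ _ be0 n2.
have nP1 := nnm_Sop _ _ al0 n1; have nPv2 := nnm_Sop _ _ al0 nv2.
have nHv1 := nnm_Hop _ nv1.
have qHv1 := nnmZ _ _ (ltW q0) nHv1.
have E1 : \int[mu]_x (Sop be g1 x * Sop be g2 x) + \int[mu]_x (Sop al g1 x * Sop be g2 x) =
  \int[mu]_x (g1 x * Sop be g2 x) + q%:E * \int[mu]_x (Hop (Sop be g1) x * Sop be g2 x).
  rewrite -(integralZ_nnm _ _ (nnmM _ _ nHv1 nv2) (ltW q0)).
  have nqq : nnm (fun x => q%:E * (Hop (Sop be g1) x * Sop be g2 x)).
    exact: (nnmZ _ _ (ltW q0) (nnmM _ _ nHv1 nv2)).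
  rewrite -(integralD_nnm _ _ (nnmM _ _ nv1 nv2) (nnmM _ _ nP1 nv2)).
  rewrite -(integralD_nnm _ _ (nnmM _ _ n1 nv2) nqq).
  apply: eq_integral => x _.
  rewrite -ge0_muleDl; [|exact: nv1.2|exact: nP1.2].
  rewrite (be_al g1 x n1) ge0_muleDl; [|exact: n1.2|exact: qHv1.2].
  by rewrite muleA.
have E2 : \int[mu]_x (g1 x * Sop be g2 x) =
    \int[mu]_x (g1 x * g2 x) + \int[mu]_x (Sop al g1 x * Sop be g2 x).
  rewrite -(integral_Sop_sym _ _ _ al0 n1 nv2).
  rewrite -(integralD_nnm _ _ (nnmM _ _ n1 n2) (nnmM _ _ n1 nPv2)).
  apply: eq_integral => x _.
  by rewrite -ge0_muleDr ?n2.2 ?nPv2.2// -(beE g2 x n2).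
have fin : \int[mu]_x (Sop al g1 x * Sop be g2 x) \is a fin_num.
  rewrite -(integral_Sop_sym _ _ _ al0 n1 nv2).
  have lS : (0 <= l * S)%R by rewrite mulr_ge0.
  apply: (fin_pairing _ _ (l * S * rho)%R n1 nPv2 _ _ i1); first by rewrite mulr_ge0.
  move=> x; apply: (Sop_le_cst _ _ _ _ _ al0 nv2 lS rhoE) => y.
  exact: (Sop_le_cst _ _ _ _ _ be0 n2 l_ge0 SE g2l).
apply: (eqe_cancel _ _ _ fin).
by rewrite E1 E2 addeAC.
Qed.

(** With w = v1 - v2 the left side equals 2 |g1 - g2|^2 - 2 (1 - q) |w|^2 in L^2 norms. The last
    term is dropped, and so is the cross term of |g1 - g2|^2, the heights being nonnegative; finally
    |g|^2 is at most [l] times the mass of g. *)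
Lemma resolvent_dirichlet_bound (g1 g2 : T -> \bar R) (v1 v2 : T -> R) (l G1 G2 : R) :
  nnm g1 -> nnm g2 -> (0 <= l)%R -> (forall x, g1 x <= l%:E) -> (forall x, g2 x <= l%:E) ->
  \int[mu]_x g1 x <= G1%:E -> \int[mu]_x g2 x <= G2%:E ->
  (forall x, (v1 x)%:E = Sop be g1 x) -> (forall x, (v2 x)%:E = Sop be g2 x) ->
  q%:E * \int[mu]_x \int[mu]_y (h x y * ((v1 y - v2 y) - (v1 x - v2 x)) ^+ 2)%:E
    <= (2 * l * (G1 + G2))%:E.
Proof.
move=> n1 n2 l_ge0 g1l g2l i1 i2 v1E v2E.
have i1' : \int[mu]_x g1 x < +oo by exact: (le_lt_trans i1 (ltry _)).
have i2' : \int[mu]_x g2 x < +oo by exact: (le_lt_trans i2 (ltry _)).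
have lS : (0 <= l * S)%R by rewrite mulr_ge0.
pose w1 : T -> \bar R := EFin \o v1. pose w2 : T -> \bar R := EFin \o v2.
have w1E : w1 = Sop be g1 by apply/funext.
have w2E : w2 = Sop be g2 by apply/funext.
have nw1 : nnm w1 by rewrite w1E; exact: nnm_Sop.
have nw2 : nnm w2 by rewrite w2E; exact: nnm_Sop.
have mv1 : measurable_fun setT v1 by apply/measurable_EFinP; exact: nw1.1.
have mv2 : measurable_fun setT v2 by apply/measurable_EFinP; exact: nw2.1.
have v10 x : (0 <= v1 x)%R by rewrite -lee_fin (nw1.2 x).
have v20 x : (0 <= v2 x)%R by rewrite -lee_fin (nw2.2 x).
have w1le x : w1 x <= (l * S)%:E by rewrite w1E; exact: Sop_le_cst.
have w2le x : w2 x <= (l * S)%:E by rewrite w2E; exact: Sop_le_cst.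
have iw g : nnm g -> \int[mu]_x g x < +oo -> \int[mu]_x Sop be g x < +oo.
  move=> ng ig; rewrite (integral_Sop _ _ be0 ng).
  under eq_eseriesr do rewrite muleC.
  rewrite nneseriesMl; [|by apply: integral_ge0 => x _; exact: ng.2|by move=> k; rewrite lee_fin].
  by rewrite SE muleC lte_mul_pinfty.
have iw1 : \int[mu]_x w1 x < +oo by rewrite w1E; exact: iw.
have iw2 : \int[mu]_x w2 x < +oo by rewrite w2E; exact: iw.
have nH1 := nnm_Hop _ nw1. have nH2 := nnm_Hop _ nw2.
have H1le x : Hop w1 x <= (l * S)%:E by exact: Hop_le_cst.
have H2le x : Hop w2 x <= (l * S)%:E by exact: Hop_le_cst.
pose I i j := \int[mu]_x (i x * j x). pose J i j := \int[mu]_x (Hop i x * j x).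
have JC i j : nnm i -> nnm j -> J i j = J j i.
  move=> ni nj; rewrite /J -(integral_Hop_sym _ _ ni nj).
  by apply: eq_integral => x _; rewrite muleC.
have I11 : I w1 w1 = I g1 g1 + q%:E * J w1 w1.
  by rewrite /I /J w1E; exact: (resolvent_pairing _ _ l).
have I22 : I w2 w2 = I g2 g2 + q%:E * J w2 w2.
  by rewrite /I /J w2E; exact: (resolvent_pairing _ _ l).
have I12 : I w1 w2 = I g1 g2 + q%:E * J w1 w2.
  by rewrite /I /J w1E w2E; exact: (resolvent_pairing _ _ l).
have fI11 : I w1 w1 \is a fin_num by exact: (fin_pairing _ _ _ nw1 nw1 lS).
have fI22 : I w2 w2 \is a fin_num by exact: (fin_pairing _ _ _ nw2 nw2 lS).
have fI12 : I w1 w2 \is a fin_num by exact: (fin_pairing _ _ _ nw1 nw2 lS).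
have JE i j : J i j = I j (Hop i) by apply: eq_integral => x _; rewrite muleC.
have fJ11 : J w1 w1 \is a fin_num by rewrite JE; exact: (fin_pairing _ _ _ nw1 nH1 lS).
have fJ22 : J w2 w2 \is a fin_num by rewrite JE; exact: (fin_pairing _ _ _ nw2 nH2 lS).
have fJ12 : J w1 w2 \is a fin_num by rewrite JE; exact: (fin_pairing _ _ _ nw2 nH1 lS).
have G11 : I g1 g1 <= (l * G1)%:E.
  apply: (@le_trans _ _ (\int[mu]_x (l%:E * g1 x))).
    apply: (le_integral_nnm _ _ (nnmM _ _ n1 n1) (nnmZ _ _ l_ge0 n1)) => x.
    by rewrite lee_wpmul2r ?n1.2.
  by rewrite (integralZ_nnm _ _ n1 l_ge0) EFinM lee_wpmul2l.
have G22 : I g2 g2 <= (l * G2)%:E.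
  apply: (@le_trans _ _ (\int[mu]_x (l%:E * g2 x))).
    apply: (le_integral_nnm _ _ (nnmM _ _ n2 n2) (nnmZ _ _ l_ge0 n2)) => x.
    by rewrite lee_wpmul2r ?n2.2.
  by rewrite (integralZ_nnm _ _ n2 l_ge0) EFinM lee_wpmul2l.
have Ige i j : nnm i -> nnm j -> 0 <= I i j.
  by move=> ni nj; apply: integral_ge0 => x _; exact: (nnmM _ _ ni nj).2.
pose Gam x := \int[mu]_y (h x y * ((v1 y - v2 y) - (v1 x - v2 x)) ^+ 2)%:E.
have n11 := nnmM _ _ nw1 nw1. have n22 := nnmM _ _ nw2 nw2. have n12 := nnmM _ _ nw1 nw2.
(* Expansion of the square under the kernel, each negative term moved to the other side so that both
   sides are nonnegative. *)
have GamE x : Gam x + (Hop (fun y => w1 y * w2 y) x + Hop (fun y => w1 y * w2 y) x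
   + ((v1 x)%:E * Hop w1 x + (v1 x)%:E * Hop w1 x)
   + ((v2 x)%:E * Hop w2 x + (v2 x)%:E * Hop w2 x) + (2 * v1 x * v2 x)%:E) =
   Hop (fun y => w1 y * w1 y) x + Hop (fun y => w2 y * w2 y) x
   + ((v2 x)%:E * Hop w1 x + (v2 x)%:E * Hop w1 x)
   + ((v1 x)%:E * Hop w2 x + (v1 x)%:E * Hop w2 x) + (v1 x * v1 x + v2 x * v2 x)%:E.
  have c12 : (0 <= 2 * v1 x * v2 x)%R by rewrite !mulr_ge0.
  have cq : (0 <= v1 x * v1 x + v2 x * v2 x)%R by rewrite addr_ge0 ?mulr_ge0.
  have nD : nnm (fun y => (((v1 y - v2 y) - (v1 x - v2 x)) ^+ 2)%:E).
    split=> [|y]; last by rewrite lee_fin sqr_ge0.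
    apply/measurable_EFinP; apply: measurable_funX; apply: measurable_funB => //.
    exact: measurable_funB.
  have -> : Gam x = Hop (fun y => (((v1 y - v2 y) - (v1 x - v2 x)) ^+ 2)%:E) x.
    by apply: eq_integral => y _; rewrite EFinM.
  have z11 := nnmZ _ _ (v10 x) nw1. have z12 := nnmZ _ _ (v10 x) nw2.
  have z21 := nnmZ _ _ (v20 x) nw1. have z22 := nnmZ _ _ (v20 x) nw2.
  rewrite -(HopZ _ _ x (v10 x) nw1) -(HopZ _ _ x (v10 x) nw2).
  rewrite -(HopZ _ _ x (v20 x) nw1) -(HopZ _ _ x (v20 x) nw2).
  rewrite -(Hop_cst _ x c12) -(Hop_cst _ x cq).
  have d1 := nnmD _ _ n12 n12. have d2 := nnmD _ _ z11 z11. have d3 := nnmD _ _ z22 z22.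
  have d4 := nnmD _ _ n11 n22. have d5 := nnmD _ _ z21 z21. have d6 := nnmD _ _ z12 z12.
  have e1 := nnm_cst _ c12. have e2 := nnm_cst _ cq.
  rewrite -(HopD _ _ x n12 n12) -(HopD _ _ x z11 z11) -(HopD _ _ x z22 z22).
  rewrite -(HopD _ _ x n11 n22) -(HopD _ _ x z21 z21) -(HopD _ _ x z12 z12).
  have f1 := nnmD _ _ d1 d2. have f2 := nnmD _ _ f1 d3. have f3 := nnmD _ _ f2 e1.
  have f4 := nnmD _ _ d4 d5. have f5 := nnmD _ _ f4 d6.
  rewrite -(HopD _ _ x d1 d2) -(HopD _ _ x f1 d3) -(HopD _ _ x f2 e1) -(HopD _ _ x nD f3).
  rewrite -(HopD _ _ x d4 d5) -(HopD _ _ x f4 d6) -(HopD _ _ x f5 e2).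
  congr (Hop _ x); apply/funext => y /=.
  rewrite -!EFinM -!EFinD; congr EFin; ring.
have nGam : nnm Gam.
  split; last first.
    by move=> x; apply: integral_ge0 => y _; rewrite lee_fin mulr_ge0// sqr_ge0.
  apply: (@measurable_fun_fubini_tonelli_F _ _ _ _ _ mu
    (fun z : T * T => (h z.1 z.2 * ((v1 z.2 - v2 z.2) - (v1 z.1 - v2 z.1)) ^+ 2)%:E)).
    apply/measurable_EFinP; apply: measurable_funM => //; apply: measurable_funX.
    by apply: measurable_funB; apply: measurable_funB; exact: measurableT_comp.
  by move=> z; rewrite lee_fin mulr_ge0// sqr_ge0.
have GI : \int[mu]_x Gam x + (I w1 w2 + I w1 w2 + (J w1 w1 + J w1 w1)
     + (J w2 w2 + J w2 w2) + (I w1 w2 + I w1 w2)) =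
   I w1 w1 + I w2 w2 + (J w1 w2 + J w1 w2) + (J w2 w1 + J w2 w1) + (I w1 w1 + I w2 w2).
  have eI i j : nnm i -> nnm j -> I i j = \int[mu]_x Hop (fun y => i y * j y) x.
    by move=> ni nj; rewrite (integral_Hop _ (nnmM _ _ ni nj)).
  rewrite {1 2}(eI w1 w2)// {1}(eI w1 w1)// {1}(eI w2 w2)//.
  have H12 := nnm_Hop _ n12. have H11 := nnm_Hop _ n11. have H22 := nnm_Hop _ n22.
  have j11 := nnmM _ _ nH1 nw1. have j22 := nnmM _ _ nH2 nw2. have j12 := nnmM _ _ nH1 nw2.
  have j21 := nnmM _ _ nH2 nw1.
  have d1 := nnmD _ _ H12 H12. have d2 := nnmD _ _ j11 j11. have d3 := nnmD _ _ j22 j22.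
  have d4 := nnmD _ _ n12 n12. have d5 := nnmD _ _ H11 H22. have d6 := nnmD _ _ j12 j12.
  have d7 := nnmD _ _ n11 n22. have d8 := nnmD _ _ j21 j21.
  have f1 := nnmD _ _ d1 d2. have f2 := nnmD _ _ f1 d3. have f3 := nnmD _ _ f2 d4.
  have f4 := nnmD _ _ d5 d6. have f5 := nnmD _ _ f4 d8.
  transitivity (\int[mu]_x (Gam x + (Hop (fun y => w1 y * w2 y) x + Hop (fun y => w1 y * w2 y) x +
       (Hop w1 x * w1 x + Hop w1 x * w1 x) +
       (Hop w2 x * w2 x + Hop w2 x * w2 x) + (w1 x * w2 x + w1 x * w2 x)))).
    rewrite (integralD_nnm _ _ nGam f3) (integralD_nnm _ _ f2 d4) (integralD_nnm _ _ f1 d3).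
    rewrite (integralD_nnm _ _ d1 d2) (integralD_nnm _ _ H12 H12) (integralD_nnm _ _ j11 j11).
    by rewrite (integralD_nnm _ _ j22 j22) (integralD_nnm _ _ n12 n12).
  transitivity (\int[mu]_x (Hop (fun y => w1 y * w1 y) x + Hop (fun y => w2 y * w2 y) x +
       (Hop w1 x * w2 x + Hop w1 x * w2 x) +
       (Hop w2 x * w1 x + Hop w2 x * w1 x) + (w1 x * w1 x + w2 x * w2 x))); last first.
    rewrite (integralD_nnm _ _ f5 d7) (integralD_nnm _ _ f4 d8) (integralD_nnm _ _ d5 d6).
    rewrite (integralD_nnm _ _ H11 H22) (integralD_nnm _ _ j12 j12) (integralD_nnm _ _ j21 j21).
    by rewrite (integralD_nnm _ _ n11 n22).
  apply: eq_integral => x _; have := GamE x.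
  rewrite ![(v1 x)%:E * _]muleC ![(v2 x)%:E * _]muleC => E.
  transitivity (Gam x + (Hop (fun y => w1 y * w2 y) x + Hop (fun y => w1 y * w2 y) x
   + (Hop w1 x * (v1 x)%:E + Hop w1 x * (v1 x)%:E)
   + (Hop w2 x * (v2 x)%:E + Hop w2 x * (v2 x)%:E) + (2 * v1 x * v2 x)%:E)).
    by congr (_ + (_ + _)); rewrite /= -!EFinM -EFinD; congr EFin; ring.
  by rewrite E; congr (_ + _); rewrite /= -!EFinM -EFinD.
rewrite (JC w2 w1)// in GI.
have G12 := Ige _ _ n1 n2. have G110 := Ige _ _ n1 n1. have G220 := Ige _ _ n2 n2.
have I12le : I w1 w2 + I w1 w2 <= I w1 w1 + I w2 w2.
  rewrite /I -(integralD_nnm _ _ n12 n12) -(integralD_nnm _ _ n11 n22).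
  apply: (le_integral_nnm _ _ (nnmD _ _ n12 n12) (nnmD _ _ n11 n22)) => x /=.
  rewrite -!EFinM -!EFinD lee_fin.
  by have := sqr_ge0 (v1 x - v2 x); rewrite sqrrB !expr2; lra.
move: GI I12le; rewrite -/(\int[mu]_x Gam x).
have : 0 <= \int[mu]_x Gam x by apply: integral_ge0 => x _; exact: nGam.2.
have -> : \int[mu]_x \int[mu]_y (h x y * ((v1 y - v2 y) - (v1 x - v2 x)) ^+ 2)%:E = \int[mu]_x Gam x by [].
move: I11 I22 I12 fI11 fI22 fI12 fJ11 fJ22 fJ12 G11 G22 G12 G110 G220.
case: (I g1 g1) => [a11| |]//; case: (I g2 g2) => [a22| |]//.
case: (I w1 w1) => [b11| |]//; case: (I w2 w2) => [b22| |]//; case: (I w1 w2) => [b12| |]//.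
case: (J w1 w1) => [j11| |]//; case: (J w2 w2) => [j22| |]//; case: (J w1 w2) => [j12| |]//.
case: (I g1 g2) => [a12| |]//; case: (\int[mu]_x Gam x) => [gam| |]//.
rewrite -?EFinM -?EFinD -?EFinM !lee_fin => -[E1] [E2] [E3] _ _ _ _ _ _ le1 le2 a120 a110 a220 gam0 [E4] le12.
have : (0 <= (1 - q) * (b11 + b22 - (b12 + b12)))%R by rewrite mulr_ge0 ?subr_ge0.
have : (gam = 2 * (b11 + b22) + 4 * j12 - 4 * b12 - 2 * j11 - 2 * j22)%R by lra.
move=> -> pos.
have -> : (q * (2 * (b11 + b22) + 4 * j12 - 4 * b12 - 2 * j11 - 2 * j22) =
  2 * (a11 + a22) - 4 * a12 - 2 * ((1 - q) * (b11 + b22 - (b12 + b12))))%R.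
  have -> : (a11 = b11 - q * j11)%R by lra.
  have -> : (a22 = b22 - q * j22)%R by lra.
  have -> : (a12 = b12 - q * j12)%R by lra.
  ring.
have -> : (2 * l * (G1 + G2) = 2 * (l * G1 + l * G2))%R by ring.
lra.
Qed.

End dirichlet_form.

(** * Sandpile decomposition of the smoothed data *)

Section decomposition.
Context (x0 : T) (q : R) (q0 : (0 < q)%R) (q1 : (q < 1)%R).

Let be k : R := (cb R k * q ^+ k)%R.
Let al k : R := (ca R k * q ^+ k)%R.

Let qk0 k : (0 <= q ^+ k)%R. Proof. by rewrite exprn_ge0// ltW. Qed.

Let be0 k : (0 <= be k)%R.
Proof. by rewrite mulr_ge0// ltW// cb_gt0. Qed.

Let al0 k : (0 <= al k)%R.
Proof. by rewrite mulr_ge0// ca_ge0. Qed.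

Lemma Sop_delta (c : R) m f x : (0 <= c)%R -> nnm f ->
  Sop (fun k => if k == m then c else 0%R) f x = c%:E * iter m Hop f x.
Proof.
move=> c0 nf; rewrite -(nneseries_delta m (c%:E * iter m Hop f x)); last first.
  by rewrite mule_ge0// (nnm_iter_Hop _ _ nf).2.
by apply: eq_eseriesr => k _; case: eqP => [->//|_]; rewrite mul0e.
Qed.

Lemma eq_Sop (al1 al2 : nat -> R) f x : (forall k, al1 k = al2 k) -> Sop al1 f x = Sop al2 f x.
Proof. by move=> e; apply: eq_eseriesr => k _; rewrite e. Qed.

(** Operator form of [cb_ca]; the weights q^k turn the shift into q H. *)
Lemma Sop_cb_ca f x : nnm f -> Sop be f x + Sop al f x = f x + q%:E * Hop (Sop be f) x.
Proof.
move=> nf; rewrite -SopDl//.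
have d0 m (c : R) : (0 <= c)%R -> forall k, (0 <= (if k == m then c else 0))%R.
  by move=> c0 k; case: ifP.
transitivity (Sop (fun k => (if k == 0 then 1 else 0) +
    sconv (fun k => if k == 1%N then q else 0) be k)%R f x).
  apply: eq_Sop => k; rewrite -mulrDl cb_ca mulrDl; congr (_ + _)%R.
    by case: k => [|k]; rewrite ?mulr1// mul0r.
  case: k => [|k] /=; first by rewrite mul0r /sconv big_ord1 mul0r.
  rewrite /sconv big_ord_recl/= mul0r add0r big_ord_recl/= big1 => [|i _]; last by rewrite mul0r.
  by rewrite addr0 subSS subn0 exprS /be mulrCA.
rewrite SopDl//; [|exact: d0|]; last first.
  by move=> k; apply: sconv_ge0 => //; apply: d0; exact: ltW.
rewrite Sop_delta// mul1e; congr (_ + _); rewrite Sop_conv//; last by apply: d0; exact: ltW.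
by rewrite Sop_delta ?(ltW q0)//; exact: nnm_Sop.
Qed.

Lemma Sop_cbE f x : nnm f -> Sop be f x = f x + Sop al (Sop be f) x.
Proof.
move=> nf; rewrite -Sop_conv//.
rewrite -[f x]mul1e -[1 * f x]/(1%:E * iter 0 Hop f x) -(Sop_delta 1 0%N)//.
rewrite -SopDl//; [|by move=> k; case: ifP|by move=> k; exact: sconv_ge0].
apply: eq_Sop => k; rewrite sconv_geom /be {1}cb_sconv_ca mulrDl; congr (_ + _)%R.
by case: k => [|k]; rewrite ?mulr1// mul0r.
Qed.

Lemma Sop_cbE' f x : nnm f -> Sop be f x = f x + Sop be (Sop al f) x.
Proof.
move=> nf; rewrite -Sop_conv// {1}Sop_cbE// -Sop_conv//; congr (_ + _).
by apply: eq_Sop => k; rewrite sconvC.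
Qed.

Lemma sum_cb_fin : exists2 S : R, (1 <= S)%R & \sum_(k <oo) (be k)%:E = S%:E.
Proof.
have le : \sum_(k <oo) (be k)%:E <= ((1 - q)^-1)%:E.
  apply: (@le_trans _ _ (\sum_(k <oo) (geometric 1 q k)%:E)).
    apply: lee_nneseries => [k _ _|k _]; rewrite lee_fin//= mul1r.
    by rewrite ler_piMl// cb_le1.
  have cv : (series (geometric 1 q)) n @[n --> \oo] --> (1 / (1 - q))%R.
    by apply: cvg_geometric_series; rewrite ger0_norm ?ltW.
  rewrite (_ : \sum_(k <oo) _ = (1 / (1 - q))%:E) ?div1r//.
  apply/cvg_lim => //; under eq_fun do rewrite sumEFin.
  apply: cvg_EFin; first by apply: nearW => n; rewrite fin_numE.
  by rewrite -[X in _ --> X]div1r; exact: cv.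
have ge : 1 <= \sum_(k <oo) (be k)%:E.
  rewrite (@nneseriesD1 _ _ 0%N)//; last by move=> k _; rewrite lee_fin.
  rewrite /be expr0 mulr1 leeDl//; apply: nneseries_ge0 => k _ _.
  by rewrite lee_fin; exact: be0.
exists (fine (\sum_(k <oo) (be k)%:E)).
  rewrite -lee_fin fineK//; apply: (le_bounded_fin _ _ _ le); exact: le_trans ge.
by rewrite fineK//; apply: (le_bounded_fin _ _ _ le); exact: le_trans ge.
Qed.

(** Evaluated on constants, B = 1 + P B reads S = 1 + rho S with S finite and at least 1. *)
Lemma sum_ca_lt1 : exists2 rho : R, (rho < 1)%R & \sum_(k <oo) (al k)%:E = rho%:E.
Proof.
have [S S1 SE] := sum_cb_fin.
have := Sop_cbE (cst 1%:E) x0 (nnm_cst 1 ler01).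
have -> : Sop be (cst 1%:E) = cst S%:E by apply/funext => y; rewrite Sop_cst// SE mul1e.
have S0 : (0 <= S)%R by lra.
rewrite Sop_cst//=.
have : 0 <= \sum_(k <oo) (al k)%:E by apply: nneseries_ge0 => k _ _; rewrite lee_fin.
case: (\sum_(k <oo) (al k)%:E) => [r| |]// r0.
  rewrite -EFinM -EFinD => -[SrE]; exists r => //.
  by rewrite -(ltr_pM2l (_ : (0 < S)%R)); lra.
by rewrite gt0_muley ?addey// lte_fin; lra.
Qed.

Context (K : nat) (K0 : (0 < K)%N) (f : T -> \bar R) (nf : nnm f) (G : R)
  (fG : \int[mu]_x f x <= G%:E) (M : R) (M0 : (0 <= M)%R)
  (fM : forall k x, (K <= k)%N -> iter k Hop f x <= M%:E).

Let mk k : R := (cmu R K k * q ^+ k)%R.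
Let bt k : R := (cb_tail R K k * q ^+ k)%R.
Let mk0 k : (0 <= mk k)%R. Proof. by rewrite mulr_ge0// cmu_ge0. Qed.
Let bt0 k : (0 <= bt k)%R. Proof. by rewrite mulr_ge0// cb_tail_ge0. Qed.
Let F := Sop mk f.
Let nF : nnm F. Proof. exact: nnm_Sop. Qed.

Let G0 : (0 <= G)%R.
Proof. by rewrite -lee_fin (le_trans _ fG)// integral_ge0// => x _; exact: nf.2. Qed.

Lemma Sop_cb_cmu g x : nnm g -> Sop be (Sop mk g) x = Sop bt g x.
Proof.
move=> ng; rewrite -Sop_conv//; apply: eq_Sop => k.
by rewrite sconv_geom sconv_cb_cmu.
Qed.

(** On constants, B composed with the smoothing is a tail of B, so S times the total weight is at
    most S. An infinite total weight is excluded separately, since B of +oo is +oo. *)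
Lemma sum_cmu_le1 : \sum_(k <oo) (mk k)%:E <= 1.
Proof.
have [S S1 SE] := sum_cb_fin.
have s0 : 0 <= \sum_(k <oo) (mk k)%:E by apply: nneseries_ge0 => k _ _; rewrite lee_fin.
have : Sop be (Sop mk (cst 1%:E)) x0 <= Sop be (cst 1%:E) x0.
  rewrite Sop_cb_cmu//; apply: Sop_lel => // k; apply: ler_wpM2r => //.
  by rewrite /cb_tail; case: ifP => // _; rewrite ltW// cb_gt0.
rewrite Sop_cst// SE mul1e.
have -> : Sop mk (cst 1%:E) = cst (\sum_(k <oo) (mk k)%:E).
  by apply/funext => y; rewrite Sop_cst// mul1e.
move: s0; case: (\sum_(k <oo) (mk k)%:E) => [r| |]// r0.
  by rewrite Sop_cst// SE -EFinM !lee_fin ger_pMl//; lra.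
have -> : Sop be (cst +oo) x0 = +oo; last by [].
apply/eqP; rewrite eq_le leey/= /Sop (@nneseriesD1 _ _ 0%N)//.
  rewrite /= /be expr0 mulr1 mul1e addye// gt_eqF// (lt_le_trans (ltNyr 0))//.
  apply: nneseries_ge0 => k _ _; rewrite mule_ge0 ?lee_fin ?be0//.
  by apply: (nnm_iter_Hop k (cst +oo) _).2; split=> // y; exact: leey.
move=> k _; rewrite mule_ge0 ?lee_fin ?be0//.
by apply: (nnm_iter_Hop k (cst +oo) _).2; split=> // y; exact: leey.
Qed.

(** Only powers k >= K carry weight, where [f] has already been flattened below [M], and the total
    weight is at most 1. *)
Lemma smoothed_le x : F x <= M%:E.
Proof.
apply: (@le_trans _ _ (\sum_(k <oo) (M%:E * (mk k)%:E))).
  apply: lee_nneseries => [k _ _|k _]; first exact: (nnm_SopT k _ _ mk0 nf).2.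
  rewrite [leRHS]muleC; case: (ltnP k K) => kK.
    by rewrite /mk /cmu kK mul0r !mul0e.
  by rewrite lee_wpmul2l ?lee_fin// fM.
rewrite nneseriesMl; [|by rewrite lee_fin|by move=> k; rewrite lee_fin].
by rewrite -[leRHS]mule1; apply: lee_wpmul2l; [rewrite lee_fin|exact: sum_cmu_le1].
Qed.

Lemma integral_smoothed_le : \int[mu]_x F x <= G%:E.
Proof.
rewrite (integral_Sop _ _ mk0 nf).
under eq_eseriesr do rewrite muleC.
rewrite nneseriesMl; [|by apply: integral_ge0 => x _; exact: nf.2|by move=> k; rewrite lee_fin].
apply: le_trans fG; rewrite -[leRHS]mule1; apply: lee_wpmul2l; last exact: sum_cmu_le1.
by apply: integral_ge0 => x _; exact: nf.2.
Qed.

Lemma smoothed_supersolution x : F x <= Sop al F x + (cb R K)%:E * iter K Hop f x.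
Proof.
have b0 : (0 <= cb R K * q ^+ K)%R by rewrite mulr_ge0// ltW// cb_gt0.
apply: (@le_trans _ _ (Sop (fun k => sconv al mk k + (if k == K then cb R K * q ^+ K else 0))%R f x)).
  apply: Sop_lel => // k; rewrite sconv_geom.
  apply: le_trans (_ : (sconv (ca R) (cmu R K) k + (if k == K then cb R K else 0)) * q ^+ k <= _)%R.
    by apply: ler_wpM2r => //; exact: cmu_le.
  by rewrite mulrDl lerD2l; case: eqP => [->|_]; rewrite ?mul0r.
rewrite SopDl//; [|by move=> k; exact: sconv_ge0|by move=> k; case: ifP].
rewrite Sop_conv// leeD2l// Sop_delta// lee_wpmul2r ?(nnm_iter_Hop _ _ nf).2//.
by rewrite lee_fin ler_piMr ?exprn_ile1 ?ltW ?cb_gt0.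
Qed.

(** The last two clauses prepare the gradient estimate: [u] grows slowly away from its zero set, and
    little of it leaks into that set in one step. The modulus of continuity [r k] of [iter k Hop] on
    data with values in [0, c] is the only regularity of the kernel that enters. *)
Theorem sandpile_decomposition (l : R) (r : nat -> T -> T -> R) : (0 < l)%R ->
  (forall k x y, 0 <= r k x y)%R -> (forall k x y, r k x y = r k y x) ->
  (forall k g (c : R) x y, nnm g -> (0 <= c)%R -> (forall z, g z <= c%:E) ->
    iter k Hop g y <= iter k Hop g x + (c * r k x y)%:E) ->
  exists g u : T -> R,
  [/\ [/\ measurable_fun setT g, (forall x, 0 <= g x <= l)%R &
           \int[mu]_x (g x)%:E <= G%:E],
      [/\ measurable_fun setT u, (forall x, 0 <= u x)%R & (exists C : R, forall x, u x <= C)%R],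
      l%:E * mu [set x | u x != 0%R] <= G%:E,
      (forall x, Sop bt f x = Sop be (EFin \o g) x + (u x)%:E) &
      (forall x y, u x = 0%R ->
         (u y)%:E <= (M + l)%:E * \sum_(k <oo) (be k * r k x y)%:E) /\
      (forall e : R, (0 < e)%R ->
        q%:E * \int[mu]_x ((\1_[set x | u x = 0%R] x)%:E *
                     Hop (fun y => (u y * Num.min (u y) e)%:E) x) <= (e * (cb R K * G))%:E)].
Proof.
move=> l0 r0 rC Hr.
have [S S1 SE] := sum_cb_fin; have [rho rho1 rhoE] := sum_ca_lt1.
have iF : \int[mu]_x F x < +oo by exact: (le_lt_trans integral_smoothed_le (ltry _)).
pose ue := odometer al F l. pose ge := settled al F l.
have nue : nnm ue := nnm_odometer al al0 F l nF l0.
have nge : nnm ge := nnm_settled al al0 F l nF l0.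
have uleC x : ue x <= (M / (1 - rho))%:E.
  by apply: (odometer_le al rho) => //; exact: smoothed_le.
have gle x : ge x <= l%:E by exact: settled_le.
pose u x := fine (ue x). pose g x := fine (ge x).
have uE x : (u x)%:E = ue x by rewrite fineK//; exact: (le_bounded_fin _ _ (nue.2 x) (uleC x)).
have gE x : (g x)%:E = ge x by rewrite fineK//; exact: (le_bounded_fin _ _ (nge.2 x) (gle x)).
have ufE : EFin \o u = ue by apply/funext => x /=; rewrite uE.
have gfE : EFin \o g = ge by apply/funext => x /=; rewrite gE.
have u0 x : (0 <= u x)%R by rewrite -lee_fin uE nue.2.
have g0 x : (0 <= g x)%R by rewrite -lee_fin gE nge.2.
have mue : measurable_fun setT u by apply/measurable_EFinP; rewrite ufE; exact: nue.1.
have mge : measurable_fun setT g by apply/measurable_EFinP; rewrite gfE; exact: nge.1.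
have gG : \int[mu]_x ge x <= G%:E.
  apply: le_trans integral_smoothed_le.
  exact: (integral_settled_le al rho al0 rhoE rho1 F l nF l0 iF).
have BE x : Sop be F x = Sop be ge x + ue x.
  exact: (resolvent_obstacle al be rho S al0 be0 rhoE rho1 SE Sop_cbE' F M l nF M0 smoothed_le l0).
have gt0E x : (0 < u x)%R -> ge x = l%:E.
  by move=> ux; apply: (odometer_gt0 al al0 F l nF l0); rewrite -/ue -uE lte_fin.
exists g, u; split.
- split=> //; first by move=> x; rewrite g0 -lee_fin gE gle.
  by under eq_integral do rewrite gE.
- by split=> //; exists (M / (1 - rho))%R => x; rewrite -lee_fin uE.
- have mO : measurable [set x | u x != 0%R].
    rewrite (_ : [set x | _] = ~` (u @^-1` [set 0%R])); last by apply/seteqP; split=> x /= /eqP.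
    by apply: measurableC; rewrite -[X in measurable X]setTI; exact: (mue measurableT _ (measurable_set1 _)).
  apply: le_trans gG.
  rewrite -integral_cst//.
  apply: (@le_trans _ _ (\int[mu]_(x in [set x | u x != 0%R]) ge x)).
    apply: ge0_le_integral => //.
    - by move=> x _; rewrite lee_fin ltW.
    - exact: (measurable_funS _ _ nge.1).
    - by move=> x /= ux; rewrite gt0E// lt_neqAle eq_sym ux u0.
  by apply: ge0_subset_integral => //; [exact: nge.1|move=> x _; exact: nge.2].
- by move=> x; rewrite uE gfE -BE Sop_cb_cmu.
split=> [x y ux|e e0].
  (* B F and B g agree at x. Comparing each with its value at y, by its own modulus, bounds their
     difference u(y) by M + l times the summed modulus. *)
  have ex : Sop be F x = Sop be ge x by rewrite BE -uE ux adde0.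
  have lip g' (c : R) a b : nnm g' -> (0 <= c)%R -> (forall z, g' z <= c%:E) ->
      Sop be g' b <= Sop be g' a + c%:E * \sum_(k <oo) (be k * r k a b)%:E.
    move=> ng' c0 g'c; have H k := Hr k g' c a b ng' c0 g'c.
    rewrite -nneseriesMl ?lee_fin//; last by move=> k; rewrite lee_fin mulr_ge0.
    rewrite -nneseriesD; last 2 first.
    - by move=> k _ _; exact: (nnm_SopT k _ _ be0 ng').2.
    - by move=> k _ _; rewrite mule_ge0 ?lee_fin// mulr_ge0.
    apply: lee_nneseries => [k _ _|k _]; first exact: (nnm_SopT k _ _ be0 ng').2.
    apply: (@le_trans _ _ ((be k)%:E * (iter k Hop g' a + (c * r k a b)%:E))).
      by rewrite lee_wpmul2l// lee_fin.
    rewrite ge0_muleDr ?(nnm_iter_Hop _ _ ng').2 ?lee_fin ?mulr_ge0//.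
    by rewrite -!EFinM mulrCA.
  have l1 := lip F _ x y nF M0 smoothed_le.
  have := lip ge l y x nge (ltW l0) gle.
  have -> : \sum_(k <oo) (be k * r k y x)%:E = \sum_(k <oo) (be k * r k x y)%:E.
    by apply: eq_eseriesr => k _; rewrite rC.
  set s := \sum_(k <oo) _ in l1 *.
  move=> l2; move: l1; rewrite BE ex uE => l1.
  have fy : Sop be ge y \is a fin_num.
    apply: (le_bounded_fin _ (l * S)%R ((nnm_Sop _ _ be0 nge).2 y)).
    exact: (Sop_le_cst _ _ _ _ _ be0 nge (ltW l0) SE gle).
  rewrite -(leeD2lE _ _ fy); apply: (le_trans l1).
  rewrite EFinD ge0_muleDl ?lee_fin ?(ltW l0)// [M%:E * s + _]addeC addeA.
  by rewrite leeD2r.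
have nk0 : nnm (fun x => (cb R K)%:E * iter K Hop f x).
  by apply: nnmZ; [exact: (ltW (cb_gt0 R K))|exact: nnm_iter_Hop].
apply: (supersolution_energy q e _ u (fun x => (cb R K)%:E * iter K Hop f x)) => //.
- exact: ltW.
- by rewrite mulr_ge0// ltW// cb_gt0.
- under eq_integral do rewrite uE.
  exact: (integral_odometer_lty al rho al0 rhoE rho1 F l nF l0 iF).
- rewrite (integralZ_nnm _ _ (nnm_iter_Hop K _ nf) (ltW (cb_gt0 R K))).
  by rewrite (integral_iter_Hop _ _ nf) EFinM lee_wpmul2l// lee_fin ltW// cb_gt0.
move=> x ux; rewrite ufE uE.
exact: (odometer_le_Hop al be rho S q al0 be0 rhoE rho1 SE q0 Sop_cbE' Sop_cb_ca F M l nF M0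
  smoothed_le l0 _ nk0 smoothed_supersolution x (eq_ind _ (fun z => 0 < z) (ux : 0 < (u x)%:E) _ (uE x))).
Qed.

End decomposition.

End markov_operator.

Arguments nnm {d T R} f.
Arguments nnmD {d T R f g}.
Arguments nnmM {d T R f g}.
Arguments nnmZ {d T R c f}.
Arguments nnm_cst {d T R c}.
Arguments integralD_nnm {d T R} mu {f g}.
Arguments integralZ_nnm {d T R} mu {c f}.
Arguments le_integral_nnm {d T R} mu {f g}.
Arguments fin_num_integral_nnm {d T R} mu {f}.
Arguments Hop {d T R} mu h f x.
Arguments Sop {d T R} mu h al f x.

(** * The Gaussian kernel *)

Section exponential_inequalities.
Context {R : realType}.
Implicit Types x : R.

(** Odd powers cancel and even ones are nonnegative, so every partial sum with at least three terms
    dominates 2 + x^2. *)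
Lemma expR_sum_ge x : 2 + x ^+ 2 <= expR x + expR (- x).
Proof.
have cv y := @is_cvg_series_exp_coeff R y.
have cv2 : (series (exp_coeff x) + series (exp_coeff (- x))) @ \oo --> expR x + expR (- x).
  exact: cvgD (cv x) (cv (- x)).
rewrite -[leRHS](cvg_lim _ cv2)//; apply: limr_ge; first by apply/cvg_ex; eexists; exact: cv2.
exists 3 => // n /= n3.
have -> : (series (exp_coeff x) + series (exp_coeff (- x))) n =
    \sum_(0 <= i < n) (x ^+ i + (- x) ^+ i) / i`!%:R.
  rewrite -[LHS]/(series (exp_coeff x) n + series (exp_coeff (- x)) n) /series/=.
  by rewrite -big_split/=; apply: eq_bigr => i _; rewrite /exp_coeff/= mulrDl.
rewrite (@big_cat_nat _ _ _ 3)//= !big_nat_recr//= big_geq// add0r.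
rewrite !expr0 !expr1 subrr mul0r addr0 sqrrN fact0 divr1 (_ : 2`! = 2)%N// -mulr2n.
rewrite -[leLHS]addr0; apply: lerD; first by rewrite -mulr_natr; lra.
apply: sumr_ge0 => i _; rewrite divr_ge0 ?ler0n//.
rewrite exprNn; case: (boolP (odd i)) => oi.
  by rewrite -signr_odd oi expr1 mulN1r subrr.
by rewrite -signr_odd (negbTE oi) expr0 mul1r addr_ge0// exprn_even_ge0.
Qed.

(** From 1 - x <= exp (- x) one gets (1 - x) exp x <= 1, while (1 - x) (1 + x + 2 x^2) = 1 + x^2 (1
    - 2 x) >= 1. *)
Lemma expR_le_quad x : 0 <= x -> x <= 1/2 -> expR x <= 1 + x + 2 * x ^+ 2.
Proof.
move=> x0 x1; have := expR_ge1Dx (- x); rewrite expRN => h.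
have e0 := expR_gt0 x.
have : (1 - x) * expR x <= 1 by rewrite -[leRHS](@mulVf _ (expR x)) ?gt_eqF// ler_pM2r.
have : (1 - x) * (1 + x + 2 * x ^+ 2) >= 1.
  have -> : (1 - x) * (1 + x + 2 * x ^+ 2) = 1 + x ^+ 2 * (1 - 2 * x) by ring.
  by rewrite lerDl mulr_ge0 ?sqr_ge0//; lra.
move=> h1 h2; rewrite -(ler_pM2l (_ : 0 < 1 - x)); lra.
Qed.

Lemma sqr_le_expR x : 0 <= x -> x ^+ 2 <= 4 * expR x.
Proof.
move=> x0; have : x / 2 <= expR (x / 2) by apply: le_trans (expR_ge1Dx _); lra.
move=> h; have -> : expR x = expR (x / 2) ^+ 2 by rewrite -expRM_natl; congr expR; field.
have : (x / 2) ^+ 2 <= expR (x / 2) ^+ 2 by rewrite lerXn2r ?nnegrE ?expR_ge0//; lra.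
rewrite expr_div_n; lra.
Qed.

(** The gap is an explicit sum of two squares. It will be applied to the square roots of two
    Gaussian values, [A] being a free weight. *)
Lemma amgm_diff_squares (A a b : R) : 0 < A ->
  b ^+ 2 - a ^+ 2 + A * (a * b) <= (A / 2 + A^-1) * (a ^+ 2 + b ^+ 2).
Proof.
move=> A0; rewrite -subr_ge0.
have -> : (A / 2 + A^-1) * (a ^+ 2 + b ^+ 2) - (b ^+ 2 - a ^+ 2 + A * (a * b)) =
  A^-1 / 2 * ((A * (b - a) - (b + a)) ^+ 2 + (b - a) ^+ 2) by field; rewrite gt_eqF.
by rewrite mulr_ge0 ?addr_ge0 ?sqr_ge0// divr_ge0// invr_ge0 ltW.
Qed.

Lemma amgm_weighted_ge0 (A a b : R) : 0 < A ->
  0 <= (A / 2 + A^-1) * (a ^+ 2 + b ^+ 2) - A * (a * b).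
Proof.
move=> A0; have -> : (A / 2 + A^-1) * (a ^+ 2 + b ^+ 2) - A * (a * b) =
  A / 2 * (a - b) ^+ 2 + A^-1 * (a ^+ 2 + b ^+ 2) by field; rewrite gt_eqF.
have A2 : 0 <= A / 2 by rewrite divr_ge0// ltW.
have Ai : 0 <= A^-1 by rewrite invr_ge0 ltW.
exact: addr_ge0 (mulr_ge0 A2 (sqr_ge0 _)) (mulr_ge0 Ai (addr_ge0 (sqr_ge0 _) (sqr_ge0 _))).
Qed.

End exponential_inequalities.

Lemma nnm_integrable d (T : measurableType d) (R : realType)
    (mu : {measure set T -> \bar R}) (f : T -> \bar R) :
  nnm f -> (\int[mu]_x f x < +oo)%E -> mu.-integrable setT f.
Proof.
move=> nf fi; apply/integrableP; split; first exact: nf.1.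
by rewrite (eq_integral f)// => x _; rewrite gee0_abs// nf.2.
Qed.

Section lebesgue_tuple.
Context {R : realType}.
Local Open Scope ereal_scope.

Lemma ge0_integral_tcons n (F : euclid R n.+1 -> \bar R) :
  measurable_fun setT F -> (forall x, 0 <= F x) ->
  \int[@leb R n.+1]_x F x =
  \int[@lebesgue_measure R]_a \int[@leb R n]_t F (tcons (a, t)).
Proof.
move=> mF F0.
have F0' : {in setT, forall y, 0 <= F y} by move=> y _; exact: F0.
have := ge0_integral_pushforward (@measurable_tcons R n)
  ((@lebesgue_measure R) \x (@leb R n)) measurableT mF F0'.
move=> /= ->; rewrite preimage_setT; apply: fubini_tonelli1 => [|z]; last exact: F0.
exact: (measurableT_comp mF (@measurable_tcons R n)).
Qed.

Lemma integral_leb0 (F : euclid R 0 -> \bar R) : (forall x, 0 <= F x) ->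
  \int[@leb R 0]_x F x = F [tuple].
Proof.
move=> F0; rewrite [LHS](_ : _ = \int[\d_ ([tuple] : euclid R 0)]_x F x)//.
rewrite integral_dirac ?diracT ?mul1e//.
by apply: (eq_measurable_fun (cst (F [tuple]))) => // x _; rewrite (tuple0 x).
Qed.

End lebesgue_tuple.

Section gauss_kernel.
Context {R : realType} (n : nat).
Notation E := (euclid R n).
Implicit Types (x y z w : E) (s t : R).

Definition dsq x y : R := \sum_(i < n) (tnth y i - tnth x i) ^+ 2.

Definition gauss_cst s : R := (Num.sqrt (4 * pi * s))^-1.

Definition hk s x y : R := gauss_cst s ^+ n * expR (- (dsq x y / (4 * s))).

Lemma dsq_ge0 x y : 0 <= dsq x y.
Proof. by apply: sumr_ge0 => i _; exact: sqr_ge0. Qed.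

Lemma dsqC x y : dsq x y = dsq y x.
Proof. by apply: eq_bigr => i _; rewrite -sqrrN opprB. Qed.

Lemma gauss_cst_gt0 s : 0 < s -> 0 < gauss_cst s.
Proof. by move=> s0; rewrite invr_gt0 sqrtr_gt0 !mulr_gt0// pi_gt0. Qed.

Lemma hk_gt0 s x y : 0 < s -> 0 < hk s x y.
Proof. by move=> s0; rewrite mulr_gt0 ?expR_gt0// exprn_gt0// gauss_cst_gt0. Qed.

Lemma hkC s x y : hk s x y = hk s y x.
Proof. by rewrite /hk dsqC. Qed.

Lemma hk_le s x y : 0 < s -> hk s x y <= gauss_cst s ^+ n.
Proof.
move=> s0; rewrite ler_piMr ?exprn_ge0 ?(ltW (gauss_cst_gt0 _ s0))//.
by rewrite expR_le1 oppr_le0 divr_ge0 ?dsq_ge0// ltW// mulr_gt0.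
Qed.

Lemma measurable_dsq : measurable_fun setT (fun z : E * E => dsq z.1 z.2).
Proof.
apply: measurable_sum => i; apply: measurable_funX; apply: measurable_funB.
  by apply: (measurableT_comp (@measurable_tnth _ (measurableTypeR R) n i)).
by apply: (measurableT_comp (@measurable_tnth _ (measurableTypeR R) n i)).
Qed.

Lemma measurable_hk s : measurable_fun setT (fun z : E * E => hk s z.1 z.2).
Proof.
apply: measurable_funM => //; apply: measurableT_comp => //.
apply: measurableT_comp => //; apply: measurable_funM => //; exact: measurable_dsq.
Qed.

Lemma measurable_hkr s x : measurable_fun setT (hk s x).
Proof. exact: (measurableT_comp (measurable_hk s) (pair1_measurable x)). Qed.

End gauss_kernel.

Section gauss_kernel_mass.
Context {R : realType}.
Local Open Scope ereal_scope.

Lemma dsq_tcons n (x : euclid R n.+1) a (t : euclid R n) :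
  dsq n.+1 x (tcons (a, t)) =
  ((a - thead x) ^+ 2 + dsq n [tuple of behead x] t)%R.
Proof.
rewrite /dsq big_ord_recl tnth0; congr (_ + _)%R.
apply: eq_bigr => i _; rewrite tnthS; congr ((_ - _) ^+ 2)%R.
by rewrite !(tnth_nth 0%R) /= nth_behead.
Qed.

(** Peeling off one coordinate at a time leaves a normal density of variance 2 s. *)
Lemma integral_hk n (s : R) (x : euclid R n) : (0 < s)%R ->
  \int[@leb R n]_y (hk n s x y)%:E = 1.
Proof.
move=> s0; elim: n x => [|n IH] x.
  rewrite integral_leb0; last by move=> y; rewrite lee_fin ltW// hk_gt0.
  by rewrite /hk expr0 mul1r /dsq big_ord0 mul0r oppr0 expR0.
rewrite ge0_integral_tcons; last 2 first.
- by apply/measurable_EFinP; exact: measurable_hkr.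
- by move=> y; rewrite lee_fin ltW// hk_gt0.
pose sg := Num.sqrt (2 * s).
have sg0 : sg != 0%R by rewrite gt_eqF// sqrtr_gt0 mulr_gt0.
have sg2 : (sg ^+ 2 = 2 * s)%R by rewrite sqr_sqrtr// ltW// mulr_gt0.
rewrite -(integral_normal_pdf (thead x) sg).
apply: eq_integral => a _.
have -> : (normal_pdf (thead x) sg a = gauss_cst s * expR (- ((a - thead x) ^+ 2 / (4 * s))))%R.
  rewrite normal_pdfE// /normal_peak /normal_fun /gauss_cst; congr (_ * _)%R.
    by rewrite sg2; congr ((Num.sqrt _)^-1)%R; ring.
  by rewrite sg2 mulNr; congr (expR (- (_ / _)))%R; ring.
rewrite -[RHS]mule1 -(IH [tuple of behead x]) -ge0_integralZl//; last 3 first.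
- by apply/measurable_EFinP; exact: measurable_hkr.
- by move=> y _; rewrite lee_fin ltW// hk_gt0.
- by rewrite lee_fin mulr_ge0 ?expR_ge0// ltW// gauss_cst_gt0.
apply: eq_integral => t _; rewrite -EFinM; congr EFin.
rewrite /hk dsq_tcons exprS mulrACA -expRD; congr (_ * expR _)%R.
by rewrite mulrDl opprD.
Qed.

End gauss_kernel_mass.

Section gauss_kernel_algebra.
Context {R : realType} (n : nat).
Notation E := (euclid R n).
Implicit Types (x y z : E) (s t : R) (w : 'I_n -> R).

Definition sdot w x y : R := \sum_(i < n) w i * (tnth y i - tnth x i).

Definition gshift s w x : E := [tuple tnth x i + 2 * s * w i | i < n].

(** Completing the square: an exponential tilt by [w] translates the center by 2 s w. *)
Lemma hk_shift s w x y : 0 < s ->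
  hk n s x y * expR (sdot w x y) =
  hk n s (gshift s w x) y * expR (s * \sum_(i < n) w i ^+ 2).
Proof.
move=> s0; rewrite /hk -!mulrA -!expRD; congr (_ * expR _).
rewrite /dsq /sdot mulr_suml mulr_sumr mulr_suml -!sumrN -!big_split/=.
apply: eq_bigr => i _; rewrite tnth_mktuple; field; lra.
Qed.

Definition gmid s t x y : E := [tuple (t * tnth x i + s * tnth y i) / (s + t) | i < n].

(** In z the product is again Gaussian, centered at the barycenter [gmid], with s t / (s + t) as the
    harmonic combination of times. Both the semigroup law and its gradient version come from this
    factorization. *)
Lemma hk_mul s t x y z : 0 < s -> 0 < t ->
  hk n s x z * hk n t z y = hk n (s + t) x y * hk n (s * t / (s + t)) (gmid s t x y) z.
Proof.
move=> s0 t0; have st0 : 0 < s + t by exact: addr_gt0.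
rewrite /hk mulrACA -expRD [RHS]mulrACA -expRD -exprMn -[in RHS]exprMn; congr (_ ^+ _ * expR _).
  rewrite /gauss_cst -!invfM -!sqrtrM ?mulr_ge0 ?pi_ge0 ?ltW//; congr ((Num.sqrt _)^-1).
  by field; lra.
rewrite /dsq !mulr_suml -!sumrN -!big_split/=; apply: eq_bigr => i _.
by rewrite tnth_mktuple; field; lra.
Qed.

Definition midpoint x y : E := [tuple (tnth x i + tnth y i) / 2 | i < n].

(** Parallelogram law |x - z|^2 + |y - z|^2 = 2 |m - z|^2 + |x - y|^2 / 2 at the midpoint m. *)
Lemma hk_geometric_mean s x y z : 0 < s ->
  (hk n s (midpoint x y) z * expR (- (dsq n x y / (16 * s)))) ^+ 2 = hk n s x z * hk n s y z.
Proof.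
move=> s0; rewrite /hk; set G := gauss_cst s ^+ n.
have E2 : (expR (- (dsq n (midpoint x y) z / (4 * s))) * expR (- (dsq n x y / (16 * s)))) ^+ 2 =
    expR (- (dsq n x z / (4 * s))) * expR (- (dsq n y z / (4 * s))).
  rewrite -!expRD -expRM_natl; congr expR.
  rewrite /dsq !mulr_suml -!sumrN -!big_split/= mulr_sumr.
  by apply: eq_bigr => i _; rewrite tnth_mktuple; field; lra.
by rewrite -mulrA exprMn E2 expr2 mulrACA.
Qed.

(** Doubling the time leaves a spare factor exp (- a) with a = |x - y|^2 / (8 s), which absorbs a^2
    up to 4; hence 256 = 64 * 4. *)
Lemma hk_doubling s x y : 0 < s ->
  dsq n x y ^+ 2 * hk n s x y <= 256 * s ^+ 2 * Num.sqrt 2 ^+ n * hk n (2 * s) x y.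
Proof.
move=> s0; pose a := dsq n x y / (8 * s).
have a0 : 0 <= a by rewrite divr_ge0 ?dsq_ge0//; lra.
have h2 : hk n s x y = Num.sqrt 2 ^+ n * hk n (2 * s) x y * expR (- a).
  rewrite /hk -mulrA -[in RHS]mulrA -expRD [RHS]mulrA -exprMn; congr (_ ^+ _ * expR _); last by rewrite /a; field; lra.
  rewrite /gauss_cst (_ : 4 * pi * (2 * s) = 2 * (4 * pi * s)); last by ring.
  have s2 : Num.sqrt 2 != 0 :> R by rewrite gt_eqF// sqrtr_gt0.
  have sp : Num.sqrt (4 * pi * s) != 0.
    by rewrite gt_eqF// sqrtr_gt0 !mulr_gt0// pi_gt0.
  by rewrite (sqrtrM (4 * pi * s) (ler0n R 2)); field; rewrite s2 sp.
have d2 : dsq n x y ^+ 2 = 64 * s ^+ 2 * a ^+ 2 by rewrite /a; field; lra.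
have ae : a ^+ 2 * expR (- a) <= 4.
  by rewrite expRN ler_pdivrMr ?expR_gt0//; exact: sqr_le_expR.
rewrite h2 d2.
have -> : 64 * s ^+ 2 * a ^+ 2 * (Num.sqrt 2 ^+ n * hk n (2 * s) x y * expR (- a)) =
   64 * s ^+ 2 * Num.sqrt 2 ^+ n * hk n (2 * s) x y * (a ^+ 2 * expR (- a)) by ring.
have -> : 256 * s ^+ 2 * Num.sqrt 2 ^+ n * hk n (2 * s) x y =
   64 * s ^+ 2 * Num.sqrt 2 ^+ n * hk n (2 * s) x y * 4 by ring.
apply: ler_wpM2l => //; have h0 : 0 <= hk n (2 * s) x y by rewrite ltW// hk_gt0//; lra.
by rewrite mulr_ge0// !mulr_ge0 ?sqr_ge0 ?exprn_ge0 ?sqrtr_ge0 ?ler0n// ltW.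
Qed.

End gauss_kernel_algebra.

(** * Gaussian moments *)

Section gauss_moments.
Context {R : realType} (n : nat).
Notation E := (euclid R n).
Notation mu := (@leb R n).
Implicit Types (x y z : E) (s t : R) (w : 'I_n -> R) (v : E -> R).
Local Open Scope ereal_scope.

Lemma measurable_coord (i : 'I_n) : measurable_fun setT (fun y : E => tnth y i : R).
Proof. exact: (@measurable_tnth _ (measurableTypeR R) n i). Qed.

Lemma measurable_sdot w x : measurable_fun setT (sdot n w x).
Proof.
apply: measurable_sum => i; apply: measurable_funM => //.
by apply: measurable_funB => //; exact: measurable_coord.
Qed.

Lemma hk_exp_moment s w x : (0 < s)%R ->
  \int[mu]_y (hk n s x y * expR (sdot n w x y))%:E = (expR (s * \sum_(i < n) w i ^+ 2))%:E.
Proof.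
move=> s0; under eq_integral do rewrite hk_shift// EFinM.
rewrite ge0_integralZr//; last 2 first.
- by apply/measurable_EFinP; exact: measurable_hkr.
- by move=> y _; rewrite lee_fin ltW// hk_gt0.
by rewrite integral_hk// mul1e.
Qed.

Lemma sdotZ (c : R) w x y : sdot n (fun i => c * w i)%R x y = (c * sdot n w x y)%R.
Proof. by rewrite /sdot mulr_sumr; apply: eq_bigr => i _; rewrite mulrA. Qed.

(** Adding the exponential moments in the directions [e w] and [- e w], and using exp z + exp (- z)
    >= 2 + z^2, gives e^2 I + 2 <= 2 exp (s e^2 W); letting e -> 0 extracts the second-order
    term. *)
Lemma hk_second_moment s w x : (0 < s)%R ->
  \int[mu]_y (hk n s x y * sdot n w x y ^+ 2)%:E <= (2 * s * \sum_(i < n) w i ^+ 2)%:E.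
Proof.
move=> s0; set W := (\sum_(i < n) w i ^+ 2)%R.
have W0 : (0 <= W)%R by apply: sumr_ge0 => i _; exact: sqr_ge0.
have hge y : (0 <= hk n s x y)%R by rewrite ltW// hk_gt0.
have mh := measurable_hkr n s x. have msd := measurable_sdot.
set I := \int[mu]_y _.
have I0 : 0 <= I by apply: integral_ge0 => y _; rewrite lee_fin mulr_ge0// sqr_ge0.
have key (e : R) : (0 < e)%R -> (e ^+ 2)%:E * I + 2%:E <= (2 * expR (s * (e ^+ 2 * W)))%:E.
  move=> e0.
  have We (c : R) : (\sum_(i < n) (c * w i) ^+ 2 = c ^+ 2 * W)%R.
    by rewrite /W mulr_sumr; apply: eq_bigr => i _; rewrite exprMn.
  have E1 := hk_exp_moment s (fun i => e * w i)%R x s0.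
  have E2 := hk_exp_moment s (fun i => - e * w i)%R x s0.
  rewrite We in E1; rewrite We sqrrN in E2.
  have -> : (2 * expR (s * (e ^+ 2 * W)))%:E = \int[mu]_y (hk n s x y *
       expR (sdot n (fun i => e * w i)%R x y) + hk n s x y * expR (sdot n (fun i => - e * w i)%R x y))%:E.
    rewrite mulr_natl mulr2n EFinD -{1}E1 -E2 -ge0_integralD//.
    - by move=> y _; rewrite lee_fin mulr_ge0 ?expR_ge0.
    - by apply/measurable_EFinP; apply: measurable_funM => //; exact: measurableT_comp.
    - by move=> y _; rewrite lee_fin mulr_ge0 ?expR_ge0.
    - by apply/measurable_EFinP; apply: measurable_funM => //; exact: measurableT_comp.
  have -> : 2%:E = \int[mu]_y (2%:E * (hk n s x y)%:E).
    rewrite ge0_integralZl ?integral_hk ?mule1//; first exact/measurable_EFinP.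
    by move=> y _; rewrite lee_fin.
  have n1 : nnm (fun y => (hk n s x y * sdot n w x y ^+ 2)%:E).
    split=> [|y]; last by rewrite lee_fin mulr_ge0// sqr_ge0.
    apply/measurable_EFinP; apply: measurable_funM => //; exact: measurable_funX.
  have n2 : nnm (fun y => (hk n s x y)%:E).
    by split=> [|y]; [exact/measurable_EFinP|rewrite lee_fin].
  have n3 : nnm (fun y => (hk n s x y * expR (sdot n (fun i => e * w i)%R x y) +
      hk n s x y * expR (sdot n (fun i => - e * w i)%R x y))%:E).
    split=> [|y]; last by rewrite lee_fin addr_ge0// mulr_ge0// expR_ge0.
    by apply/measurable_EFinP; apply: measurable_funD; apply: measurable_funM => //;
      exact: measurableT_comp.
  have n4 := nnmZ (ltW (exprn_gt0 2 e0)) n1. have n5 := nnmZ (ler0n _ 2) n2.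
  rewrite /I -(integralZ_nnm _ n1 (ltW (exprn_gt0 2 e0))) -(integralD_nnm _ n4 n5).
  apply: (le_integral_nnm _ (nnmD n4 n5) n3) => y.
  rewrite -!EFinM -EFinD lee_fin !sdotZ mulNr.
  have := expR_sum_ge (e * sdot n w x y); rewrite exprMn => hh.
  have := ler_wpM2l (hge y) hh; rewrite !mulrDr; lra.
have Ifin : I \is a fin_num.
  rewrite ge0_fin_numE//; have := key 1%R ltr01; rewrite expr1n mul1e.
  case: (I) => [r| |]//; first by rewrite ltry.
have -> : I = (fine I)%:E by rewrite fineK.
move: (fine I) (fineK Ifin) => r Ir; rewrite lee_fin.
apply/ler_addgt0Pr => d d0.
pose a := (s * W + 1)%R.
have a1 : (1 <= a)%R by rewrite lerDr mulr_ge0// ltW.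
(* [e2] stands for e^2. The first bound keeps the exponent below 1/2, where [expR_le_quad] applies;
   the second makes its quadratic remainder at most [d] after division by [e2]. *)
pose e2 := Num.min (2 * a)^-1%R (d / (4 * a ^+ 2))%R.
have e20 : (0 < e2)%R.
  by rewrite lt_min invr_gt0 divr_gt0// ?mulr_gt0// ?exprn_gt0//; lra.
have := key (Num.sqrt e2) _; rewrite sqrtr_gt0 => /(_ e20).
rewrite (sqr_sqrtr (ltW e20)) -Ir -EFinM -EFinD lee_fin => k1.
have b0 : (0 <= s * (e2 * W))%R by rewrite !mulr_ge0// ltW.
have ble : (s * (e2 * W) <= e2 * a)%R by rewrite /a mulrCA ler_wpM2l//; [exact: ltW|lra].
have b1 : (s * (e2 * W) <= 1 / 2)%R.
  apply: (le_trans ble); rewrite -ler_pdivlMr; last lra.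
  by rewrite ge_min; apply/orP; left; rewrite invfM; lra.
have k2 := expR_le_quad _ b0 b1.
have ee : (e2 * (4 * a ^+ 2) <= d)%R.
  by rewrite -ler_pdivlMr ?ge_min ?lexx ?orbT// mulr_gt0// exprn_gt0//; lra.
have sq : ((s * (e2 * W)) ^+ 2 <= (e2 * a) ^+ 2)%R.
  by rewrite lerXn2r ?nnegrE// mulr_ge0//; [exact: ltW|lra].
rewrite -(ler_pM2l e20).
have : (4 * (e2 * a) ^+ 2 <= e2 * d)%R.
  have -> : (4 * (e2 * a) ^+ 2 = e2 * (e2 * (4 * a ^+ 2)))%R by ring.
  by rewrite ler_pM2l.
move: k1 k2 sq; have -> : (s * (e2 * W) = e2 * (s * W))%R by ring.
have -> : (e2 * (2 * s * W + d) = 2 * (e2 * (s * W)) + e2 * d)%R by ring.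
lra.
Qed.

End gauss_moments.

(** * Gradient of the heat flow *)

Section gauss_gradient.
Context {R : realType} (n : nat).
Notation E := (euclid R n).
Notation mu := (@leb R n).
Implicit Types (x y z : E) (s t : R) (v : E -> R).

Definition bounded_measurable v := measurable_fun setT v /\ exists C : R, forall y, `|v y| <= C.

Lemma measurable_coord_diff (j : 'I_n) x :
  measurable_fun setT (fun y : E => tnth y j - tnth x j).
Proof. by apply: measurable_funB => //; exact: measurable_coord. Qed.

Lemma sdot_delta (j : 'I_n) (c : R) x y :
  sdot n (fun i => c * (i == j)%:R) x y = c * (tnth y j - tnth x j).
Proof.
rewrite sdotZ; congr (_ * _); rewrite /sdot (bigD1 j)//= eqxx mul1r big1 ?addr0// => i ij.
by rewrite (negbTE ij) mul0r.
Qed.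

Lemma sum_sqr_delta (j : 'I_n) (c : R) : \sum_(i < n) (c * (i == j)%:R) ^+ 2 = c ^+ 2.
Proof.
rewrite (bigD1 j)//= eqxx mulr1 big1 ?addr0// => i ij.
by rewrite (negbTE ij) mulr0 expr0n.
Qed.

Lemma integrable_hk s x : 0 < s -> mu.-integrable setT (fun y => (hk n s x y)%:E).
Proof.
move=> s0; apply/integrableP; split; first by apply/measurable_EFinP; exact: measurable_hkr.
under eq_integral do rewrite gee0_abs ?lee_fin ?(ltW (hk_gt0 _ _ _ _ s0))//.
by rewrite integral_hk// ltry.
Qed.

Lemma integrable_hk_coord s x (j : 'I_n) v : 0 < s -> bounded_measurable v ->
  mu.-integrable setT (fun y => (hk n s x y * (tnth y j - tnth x j) * v y)%:E).
Proof.
move=> s0 [mv [C vC]].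
have hge y : 0 <= hk n s x y by rewrite ltW// hk_gt0.
have C0 : 0 <= C by apply: le_trans (vC x).
have mhs : measurable_fun setT (fun y => hk n s x y * (tnth y j - tnth x j) ^+ 2).
  apply: measurable_funM; first exact: measurable_hkr.
  by apply: measurable_funX; exact: measurable_coord_diff.
have i2 : mu.-integrable setT (fun y => (hk n s x y * (tnth y j - tnth x j) ^+ 2)%:E).
  apply: nnm_integrable.
    by split=> [|y]; [exact/measurable_EFinP|rewrite lee_fin mulr_ge0// sqr_ge0].
  have := hk_second_moment n s (fun i => 1 * (i == j)%:R) x s0.
  move=> /le_lt_trans; rewrite sum_sqr_delta => /(_ _ (ltry _)).
  by congr (_ < _)%E; apply: eq_integral => y _; rewrite sdot_delta mul1r.
have i3 := integrableD measurableT (integrable_hk _ x s0) i2.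
have i4 := integrableZl measurableT C i3.
apply: le_integrable i4 => //.
  apply/measurable_EFinP; apply: measurable_funM => //; apply: measurable_funM.
    exact: measurable_hkr.
  exact: measurable_coord_diff.
move=> y _; rewrite -EFinD -EFinM !abse_EFin lee_fin.
have e1 : `|hk n s x y * (tnth y j - tnth x j) * v y| = hk n s x y * `|tnth y j - tnth x j| * `|v y|.
  by rewrite normrM normrM (ger0_norm (hge y)).
have e2 : `|C * (hk n s x y + hk n s x y * (tnth y j - tnth x j) ^+ 2)| =
    (hk n s x y + hk n s x y * (tnth y j - tnth x j) ^+ 2) * C.
  by rewrite mulrC ger0_norm// mulr_ge0// addr_ge0// mulr_ge0// sqr_ge0.
rewrite e1 e2.
apply: ler_pM => //; first by rewrite mulr_ge0.
rewrite -[X in X + _ * _]mulr1 -mulrDr; apply: ler_wpM2l => //.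
set a := tnth y j - tnth x j; rewrite -real_normK ?num_real//.
have := sqr_ge0 (`|a| - 1 / 2); rewrite sqrrB; lra.
Qed.

(** The inequality 1 + z <= exp z under the exponential moment gives e J <= exp (s e^2) - 1, which
    is O(e^2), for every real [e]; small [e] of both signs force J = 0. *)
Lemma hk_first_moment s x (j : 'I_n) : 0 < s ->
  \int[mu]_y (hk n s x y * (tnth y j - tnth x j)) = 0.
Proof.
move=> s0; set J := Rintegral _ _ _.
have b1 : bounded_measurable (cst 1) by split=> //; exists 1 => y; rewrite normr1.
have i1 : mu.-integrable setT (fun y => (hk n s x y * (tnth y j - tnth x j))%:E).
  by have := integrable_hk_coord _ x j _ s0 b1; apply: eq_integrable => // y _; rewrite mulr1.
have key (e : R) : e * J <= expR (s * e ^+ 2) - 1.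
  have h1 := hk_exp_moment n s (fun i => e * (i == j)%:R) x s0.
  rewrite sum_sqr_delta in h1.
  have ie : mu.-integrable setT (fun y => (hk n s x y *
      expR (sdot n (fun i => e * (i == j)%:R) x y))%:E).
    apply: nnm_integrable; last by rewrite h1 ltry.
    split=> [|y]; last by rewrite lee_fin mulr_ge0 ?expR_ge0// ltW// hk_gt0.
    apply/measurable_EFinP; apply: measurable_funM; first exact: measurable_hkr.
    by apply: measurableT_comp => //; exact: measurable_sdot.
  have iZ := integrableZl measurableT e i1.
  have iD := integrableD measurableT (integrable_hk _ x s0) iZ.
  have le : (\int[mu]_y (hk n s x y)%:E + \int[mu]_y (e%:E * (hk n s x y * (tnth y j - tnth x j))%:E)
      <= (expR (s * e ^+ 2))%:E)%E.
    rewrite -h1 -(integralD measurableT (integrable_hk _ x s0) iZ).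
    apply: le_integral => // y _; rewrite sdot_delta -EFinM -EFinD lee_fin.
    rewrite [e * (hk n s x y * _)]mulrCA -{1}[hk n s x y]mulr1 -mulrDr.
    by apply: ler_wpM2l; [rewrite ltW// hk_gt0|exact: expR_ge1Dx].
  move: le; rewrite integral_hk// (integralZl measurableT i1).
  rewrite -(fineK (integrable_fin_num measurableT i1)) -/(Rintegral _ _ _) -/J.
  by rewrite -EFinM -EFinD lee_fin; lra.
apply/eqP; rewrite -normr_eq0 eq_le normr_ge0 andbT.
apply/ler_addgt0Pr => d d0; rewrite add0r.
(* The first two bounds give s e^2 <= 1/2, hence exp (s e^2) - 1 <= 3 s e^2; the third makes 3 s e
   at most [d]. *)
pose e := Num.min (1 : R) (Num.min (1 / (2 * s)) (d / (3 * s))).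
have e0 : 0 < e by rewrite !lt_min ltr01 !divr_gt0//; lra.
have e1 : e <= 1 by rewrite ge_min lexx.
have es1 : e * (2 * s) <= 1 by rewrite -ler_pdivlMr ?mulr_gt0// !ge_min lexx !orbT.
have es2 : e * (3 * s) <= d by rewrite -ler_pdivlMr ?mulr_gt0// !ge_min lexx !orbT.
have se0 : 0 <= s * e ^+ 2 by rewrite mulr_ge0 ?sqr_ge0// ltW.
have see : s * e ^+ 2 <= s * e by rewrite ler_pM2l// expr2 ler_piMr// ltW.
have se1 : s * e ^+ 2 <= 1 / 2 by apply: le_trans see _; lra.
have q := expR_le_quad _ se0 se1.
have q2 : (s * e ^+ 2) ^+ 2 <= s * e ^+ 2 by rewrite expr2 ler_piMr//; lra.
have k1 := key e; have k2 := key (- e); rewrite sqrrN mulNr in k2.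
have : e * `|J| <= e * (3 * (s * e)).
  have -> : e * (3 * (s * e)) = 3 * (s * e ^+ 2) by ring.
  case: (ger0P J) => _; lra.
by rewrite ler_pM2l// => /le_trans; apply; lra.
Qed.

(** The [j]-th partial derivative of the heat flow of [v] at time [s], the derivative having been
    carried out on the Gaussian. *)
Definition heat_grad s (j : 'I_n) v x : R :=
  \int[mu]_y (hk n s x y * (tnth y j - tnth x j) * v y) / (2 * s).

Lemma bounded_measurable_cst (c : R) : bounded_measurable (cst c).
Proof. by split=> //; exists `|c|. Qed.

Lemma bounded_measurableB v1 v2 : bounded_measurable v1 -> bounded_measurable v2 ->
  bounded_measurable (fun y => v1 y - v2 y).
Proof.
move=> [m1 [C1 H1]] [m2 [C2 H2]]; split; first exact: measurable_funB.
by exists (C1 + C2) => y; rewrite (le_trans (ler_normB _ _))// lerD.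
Qed.

Lemma bounded_measurableD v1 v2 : bounded_measurable v1 -> bounded_measurable v2 ->
  bounded_measurable (fun y => v1 y + v2 y).
Proof.
move=> [m1 [C1 H1]] [m2 [C2 H2]]; split; first exact: measurable_funD.
by exists (C1 + C2) => y; rewrite (le_trans (ler_normD _ _))// lerD.
Qed.

Lemma heat_gradD s j v1 v2 x : 0 < s -> bounded_measurable v1 -> bounded_measurable v2 ->
  heat_grad s j (fun y => v1 y + v2 y) x = heat_grad s j v1 x + heat_grad s j v2 x.
Proof.
move=> s0 b1 b2; rewrite /heat_grad -mulrDl; congr (_ / _).
rewrite -RintegralD//; [|exact: integrable_hk_coord|exact: integrable_hk_coord].
by apply: eq_Rintegral => y _; rewrite mulrDr.
Qed.

Lemma heat_gradB s j v1 v2 x : 0 < s -> bounded_measurable v1 -> bounded_measurable v2 ->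
  heat_grad s j (fun y => v1 y - v2 y) x = heat_grad s j v1 x - heat_grad s j v2 x.
Proof.
move=> s0 b1 b2; rewrite /heat_grad -mulrBl; congr (_ / _).
rewrite -RintegralB//; [|exact: integrable_hk_coord|exact: integrable_hk_coord].
by apply: eq_Rintegral => y _; rewrite mulrBr.
Qed.

Lemma heat_grad_cst s j (c : R) x : 0 < s -> heat_grad s j (cst c) x = 0.
Proof.
move=> s0; rewrite /heat_grad RintegralZr//; first by rewrite hk_first_moment// !mul0r.
have := integrable_hk_coord _ x j _ s0 (bounded_measurable_cst 1).
by apply: eq_integrable => // y _; rewrite mulr1.
Qed.

(* Cauchy-Schwarz for the centered function, the Gaussian weight having covariance [2 s]. *)
Lemma heat_grad_sqr_le s v x (c : R) : 0 < s -> bounded_measurable v ->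
  ((2 * s * \sum_(j < n) heat_grad s j v x ^+ 2)%:E <=
   \int[mu]_y (hk n s x y * (v y - c) ^+ 2)%:E)%E.
Proof.
move=> s0 bv.
have bvc := bounded_measurableB _ _ bv (bounded_measurable_cst c).
have [mvc [C vC]] := bvc.
pose w j := heat_grad s j v x.
have wE j : w j = heat_grad s j (fun y => v y - c) x.
  by rewrite (heat_gradB s j v (cst c))//; [rewrite heat_grad_cst// subr0|exact: bounded_measurable_cst].
set W := \sum_(j < n) heat_grad s j v x ^+ 2.
have hge y : 0 <= hk n s x y by rewrite ltW// hk_gt0.
set Q := (\int[mu]_y _)%E.
have nQ : nnm (fun y => (hk n s x y * (v y - c) ^+ 2)%:E).
  split=> [|y]; last by rewrite lee_fin mulr_ge0// sqr_ge0.
  apply/measurable_EFinP; apply: measurable_funM; first exact: measurable_hkr.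
  exact: measurable_funX.
have C0 : 0 <= C by apply: le_trans (vC x).
have Qfin : (Q < +oo)%E.
  have nh : nnm (fun y => (hk n s x y)%:E).
    split=> [|y]; last by rewrite lee_fin.
    by apply/measurable_EFinP; exact: measurable_hkr.
  have := le_integral_nnm mu nQ (nnmZ (sqr_ge0 C) nh) => /(_ _)/le_lt_trans; apply.
    move=> y; rewrite -EFinM lee_fin mulrC; apply: ler_wpM2r => //.
    by rewrite -real_normK ?num_real// lerXn2r ?nnegrE.
  by rewrite (integralZ_nnm _ nh (sqr_ge0 C)) integral_hk// mule1 ltry.
have iQ : mu.-integrable setT (fun y => (hk n s x y * (v y - c) ^+ 2)%:E).
  apply/integrableP; split; first exact: nQ.1.
  by under eq_integral do rewrite gee0_abs ?nQ.2//.
have iwd : mu.-integrable setT (fun y => (hk n s x y * sdot n w x y * (v y - c))%:E).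
  have -> : (fun y => (hk n s x y * sdot n w x y * (v y - c))%:E) =
      (fun y => \sum_(j < n) (w j)%:E * (hk n s x y * (tnth y j - tnth x j) * (v y - c))%:E)%E.
    apply/funext => y; rewrite /sdot mulr_sumr mulr_suml -sumEFin.
    by apply: eq_bigr => j _; rewrite -EFinM; congr EFin; ring.
  apply: integrable_sum => // j _; apply: integrableZl => //.
  exact: integrable_hk_coord.
have WE : 2 * s * W = \int[mu]_y (hk n s x y * sdot n w x y * (v y - c)).
  have E1 : (\int[mu]_y (hk n s x y * sdot n w x y * (v y - c))%:E = (2 * s * W)%:E)%E.
    transitivity (\int[mu]_y \sum_(j < n) (w j)%:E * (hk n s x y * (tnth y j - tnth x j) * (v y - c))%:E)%E.
      apply: eq_integral => y _; rewrite /sdot mulr_sumr mulr_suml -sumEFin.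
      by apply: eq_bigr => j _; rewrite -EFinM; congr EFin; ring.
    rewrite integral_sum//; last first.
      by move=> j; apply: integrableZl => //; exact: integrable_hk_coord.
    rewrite /W mulr_sumr -sumEFin; apply: eq_bigr => j _.
    rewrite integralZl//; last exact: integrable_hk_coord.
    rewrite -(fineK (integrable_fin_num measurableT (integrable_hk_coord _ x j _ s0 bvc))).
    rewrite -EFinM; congr EFin; rewrite -/(w j) {2}wE /heat_grad /Rintegral expr2.
    by rewrite wE /heat_grad /Rintegral; field; lra.
  by rewrite /Rintegral E1.
have := hk_second_moment n s w x s0; rewrite -/W => m2.
have n2 : nnm (fun y => (hk n s x y * sdot n w x y ^+ 2)%:E).
  split=> [|y]; last by rewrite lee_fin mulr_ge0// sqr_ge0.
  apply/measurable_EFinP; apply: measurable_funM; first exact: measurable_hkr.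
  by apply: measurable_funX; exact: measurable_sdot.
have i2 : mu.-integrable setT (fun y => (hk n s x y * sdot n w x y ^+ 2)%:E).
  apply/integrableP; split; first exact: n2.1.
  under eq_integral do rewrite gee0_abs ?n2.2//.
  by apply: (le_lt_trans m2); exact: ltry.
have iQZ := integrableZl measurableT (1/2) iQ. have i2Z := integrableZl measurableT (1/2) i2.
(* Young's inequality a b <= (a^2 + b^2) / 2 for the gradient direction itself. As the second moment
   is at most 2 s W, it reads 2 s W <= Q / 2 + s W, and s W is absorbed. *)
have le : ((2 * s * W)%:E <= (1/2)%:E * Q + (1/2)%:E * \int[mu]_y (hk n s x y * sdot n w x y ^+ 2)%:E)%E.
  rewrite WE /Rintegral fineK; last exact: (integrable_fin_num measurableT iwd).
  rewrite /Q -(integralZl measurableT iQ) -(integralZl measurableT i2).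
  rewrite -(integralD measurableT iQZ i2Z).
  apply: le_integral => //; first exact: (integrableD measurableT iQZ i2Z).
  move=> y _; rewrite -!EFinM -EFinD lee_fin.
  have := mulr_ge0 (hge y) (sqr_ge0 (sdot n w x y - (v y - c))).
  set a := sdot n w x y; set b := v y - c.
  have -> : hk n s x y * (a - b) ^+ 2 = hk n s x y * a ^+ 2 + hk n s x y * b ^+ 2 - 2 * (hk n s x y * a * b) by ring.
  lra.
have := le_trans le (leeD (lexx _) (lee_wpmul2l (_ : (0 <= (1/2)%:E)%E) m2)).
rewrite lee_fin => /(_ (ltac:(lra))).
have Q0 : (0 <= Q)%E by apply: integral_ge0 => y _; exact: nQ.2.
move: Q0 Qfin; case: (Q) => [r| |]// _ _.
by rewrite -!EFinM -EFinD !lee_fin; lra.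
Qed.

End gauss_gradient.

(** * Semigroup law and Lipschitz smoothing *)

Section gauss_semigroup.
Context {R : realType} (n : nat).
Notation E := (euclid R n).
Notation mu := (@leb R n).
Implicit Types (x y z : E) (s t : R).
Local Open Scope ereal_scope.

Lemma hk_chapman_kolmogorov s t x y : (0 < s)%R -> (0 < t)%R ->
  \int[mu]_z (hk n s x z * hk n t z y)%:E = (hk n (s + t) x y)%:E.
Proof.
move=> s0 t0; have r0 : (0 < s * t / (s + t))%R by rewrite divr_gt0 ?mulr_gt0 ?addr_gt0.
under eq_integral do rewrite hk_mul// EFinM.
rewrite ge0_integralZl//; last 3 first.
- by apply/measurable_EFinP; exact: measurable_hkr.
- by move=> z _; rewrite lee_fin ltW// hk_gt0.
- by rewrite lee_fin ltW// hk_gt0// addr_gt0.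
by rewrite integral_hk// mule1.
Qed.

(** Write z - x as (z - m) + (m - x) with m the barycenter of the product Gaussian: the first part
    has mean zero, and m - x is s / (s + t) times y - x. *)
Lemma hk_grad_semigroup s t x y (j : 'I_n) : (0 < s)%R -> (0 < t)%R ->
  \int[mu]_z (hk n s x z * (tnth z j - tnth x j) * hk n t z y)%:E =
  (s / (s + t) * (tnth y j - tnth x j) * hk n (s + t) x y)%:E.
Proof.
move=> s0 t0; have r0 : (0 < s * t / (s + t))%R by rewrite divr_gt0 ?mulr_gt0 ?addr_gt0.
set r := (s * t / (s + t))%R in r0; set m := gmid n s t x y.
have mj : (tnth m j - tnth x j = s / (s + t) * (tnth y j - tnth x j))%R.
  by rewrite tnth_mktuple; field; rewrite gt_eqF// addr_gt0.
have i1 : mu.-integrable setT (fun z => (hk n r m z * (tnth z j - tnth m j))%:E).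
  have := integrable_hk_coord n r m j _ r0 (bounded_measurable_cst n 1).
  by apply: eq_integrable => // z _; rewrite mulr1.
have i2 := integrable_hk n r m r0.
have := hk_first_moment n r m j r0; rewrite /Rintegral => J0.
have {}J0 : \int[mu]_z (hk n r m z * (tnth z j - tnth m j))%:E = 0.
  by rewrite -(fineK (integrable_fin_num measurableT i1)) J0.
pose a := hk n (s + t) x y.
transitivity (\int[mu]_z (a%:E * (hk n r m z * (tnth z j - tnth m j))%:E +
    (a * (s / (s + t) * (tnth y j - tnth x j)))%:E * (hk n r m z)%:E)).
  apply: eq_integral => z _; rewrite mulrAC hk_mul// -/r -/m -/a -mj -!EFinM -EFinD.
  by congr EFin; ring.
rewrite integralD//; [|exact: integrableZl|exact: integrableZl].
rewrite !integralZl// J0 integral_hk// mule0 add0e mule1; congr EFin.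
by rewrite /a; ring.
Qed.

Lemma nnm_hkl s y : (0 < s)%R -> nnm (fun z : E => (hk n s z y)%:E).
Proof.
move=> s0; split=> [|z]; last by rewrite lee_fin ltW// hk_gt0.
by under eq_fun do rewrite hkC; apply/measurable_EFinP; exact: measurable_hkr.
Qed.

Lemma iter_Hop_hk tau k (f : E -> \bar R) x : (0 < tau)%R -> nnm f ->
  iter k.+1 (Hop mu (hk n tau)) f x = \int[mu]_y ((hk n (k.+1%:R * tau) x y)%:E * f y).
Proof.
move=> tau0 nf; elim: k x => [|k IH] x.
  by rewrite /= /Hop; apply: eq_integral => y _; rewrite mul1r.
rewrite iterS /Hop; set kt := (k.+1%:R * tau)%R.
have kt0 : (0 < kt)%R by rewrite mulr_gt0.
transitivity (\int[mu]_z \int[mu]_y ((hk n tau x z)%:E * ((hk n kt z y)%:E * f y))).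
  apply: eq_integral => z _; rewrite IH ge0_integralZl ?lee_fin ?(ltW (hk_gt0 _ _ _ _ tau0))//.
  - apply: emeasurable_funM; last exact: nf.1.
    by apply/measurable_EFinP; exact: measurable_hkr.
  - by move=> y _; rewrite mule_ge0 ?nf.2// lee_fin ltW// hk_gt0.
rewrite (fubini_tonelli (fun zy : E * E => (hk n tau x zy.1)%:E * ((hk n kt zy.1 zy.2)%:E * f zy.2)))/=; last 2 first.
- apply: emeasurable_funM.
    apply/measurable_EFinP; apply: (measurableT_comp (measurable_hkr n tau x)).
    exact: measurable_fst.
  apply: emeasurable_funM; first by apply/measurable_EFinP; exact: measurable_hk.
  exact: (measurableT_comp nf.1).
- by move=> zy; rewrite !mule_ge0 ?nf.2// lee_fin ltW// hk_gt0.
apply: eq_integral => y _.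
under eq_integral do rewrite muleA -EFinM.
rewrite ge0_integralZr ?nf.2//; last 2 first.
- apply/measurable_EFinP; apply: measurable_funM; first exact: measurable_hkr.
  by apply/measurable_EFinP; exact: (nnm_hkl _ _ kt0).1.
- by move=> z _; rewrite lee_fin mulr_ge0// ltW// hk_gt0.
rewrite hk_chapman_kolmogorov//; congr ((hk n _ x y)%:E * _).
by rewrite /kt -[k.+2%:R]natr1; ring.
Qed.

(* The overlap of two Gaussians is controlled by their geometric mean, itself a
   multiple of the Gaussian centered at the midpoint. *)
Lemma hk_lipschitz s x y (c : R) (g : E -> \bar R) : (0 < s)%R -> nnm g -> (0 <= c)%R ->
  (forall z, g z <= c%:E) ->
  \int[mu]_z ((hk n s y z)%:E * g z) <=
  \int[mu]_z ((hk n s x z)%:E * g z) + (c * (Num.sqrt (dsq n x y) / Num.sqrt s))%:E.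
Proof.
move=> s0 ng c0 gc.
have nh a : nnm (fun z => (hk n s a z)%:E).
  split=> [|z]; last by rewrite lee_fin ltW// hk_gt0.
  by apply/measurable_EFinP; exact: measurable_hkr.
have ni a : nnm (fun z => (hk n s a z)%:E * g z) by exact: nnmM.
set rho := (Num.sqrt (dsq n x y) / Num.sqrt s)%R.
have rho2 : (rho ^+ 2 = dsq n x y / s)%R.
  by rewrite /rho expr_div_n !sqr_sqrtr ?dsq_ge0// ltW.
have rho0 : (0 <= rho)%R by rewrite divr_ge0 ?sqrtr_ge0.
have [rz|rn0] := eqVneq rho 0%R.
  have xy : x = y.
    have d0 : dsq n x y = 0%R.
      apply/eqP; rewrite -(mulIr_eq0 _ (mulIf (invr_neq0 (lt0r_neq0 s0)))) -rho2 rz.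
      by rewrite expr0n.
    apply: eq_from_tnth => i; apply/eqP; rewrite eq_sym -subr_eq0 -sqrf_eq0.
    move/eqP: d0; rewrite psumr_eq0 => [/allP/(_ i)|j _]; last exact: sqr_ge0.
    by rewrite mem_index_enum => /(_ isT).
  by rewrite xy rz mulr0 adde0.
have rp : (0 < rho)%R by rewrite lt_neqAle eq_sym rn0.
(* This weight makes the final error A (1 - b) + 2 / A at most rho / 4 + rho / 2. *)
pose A := (4 / rho)%R.
have A0 : (0 < A)%R by rewrite divr_gt0.
pose b := expR (- (dsq n x y / (16 * s))).
have b1 : (1 - rho ^+ 2 / 16 <= b)%R.
  apply: le_trans (expR_ge1Dx _); rewrite rho2 -[X in (_ <= X)%R]/(_ - _)%R.
  by rewrite le_eqVlt; apply/orP; left; apply/eqP; field; lra.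
have pw z : (hk n s y z * fine (g z) + c * (A * b) * hk n s (midpoint n x y) z <=
    hk n s x z * fine (g z) + c * (A / 2 + A^-1) * (hk n s x z + hk n s y z))%R.
  have g0 : (0 <= fine (g z) <= c)%R.
    have fg : g z \is a fin_num by rewrite ge0_fin_numE ?ng.2// (le_lt_trans (gc z))// ltry.
    by rewrite -!lee_fin fineK// ng.2 gc.
  have hx := hk_gt0 n s x z s0; have hy := hk_gt0 n s y z s0.
  set p := hk n s x z in hx *; set q := hk n s y z in hy *.
  have m2 := hk_geometric_mean n s x y z s0; rewrite -/p -/q in m2.
  pose sp := Num.sqrt p; pose sq := Num.sqrt q.
  have sp2 : (sp ^+ 2 = p)%R by rewrite sqr_sqrtr// ltW.
  have sq2 : (sq ^+ 2 = q)%R by rewrite sqr_sqrtr// ltW.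
  have mE : (hk n s (midpoint n x y) z * b = sp * sq)%R.
    apply/eqP; rewrite -(@eqrXn2 _ 2)//.
    - by rewrite m2 exprMn sp2 sq2.
    - by rewrite mulr_ge0 ?expR_ge0// ltW// hk_gt0.
    - by rewrite mulr_ge0// sqrtr_ge0.
  have -> : (c * (A * b) * hk n s (midpoint n x y) z = c * A * (hk n s (midpoint n x y) z * b))%R by ring.
  rewrite mE.
  have amgm : (q - p + A * (sp * sq) <= (A / 2 + A^-1) * (p + q))%R.
    by rewrite -sp2 -sq2; exact: amgm_diff_squares.
  (* The upper bound for q - p is nonnegative, so the factor g(z) may be replaced by [c] whatever
     the sign of q - p. *)
  have pos : (0 <= (A / 2 + A^-1) * (p + q) - A * (sp * sq))%R.
    by rewrite -sp2 -sq2; exact: amgm_weighted_ge0.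
  case/andP: g0; set v := fine (g z) => v0 vc.
  have : ((q - p) * v <= c * ((A / 2 + A^-1) * (p + q) - A * (sp * sq)))%R.
    apply: (@le_trans _ _ (((A / 2 + A^-1) * (p + q) - A * (sp * sq)) * v)%R).
      by apply: ler_wpM2r => //; lra.
    by rewrite mulrC; apply: ler_wpM2r.
  rewrite mulrBl mulrBr; lra.
have n1 := nh (midpoint n x y). have nx := nh x. have ny := nh y.
have k1 : (0 <= c * (A * b))%R by rewrite mulr_ge0// mulr_ge0 ?expR_ge0 ?(ltW A0).
have k2 : (0 <= c * (A / 2 + A^-1))%R by rewrite mulr_ge0// addr_ge0 ?divr_ge0 ?invr_ge0 ?(ltW A0).
have fg z : g z = (fine (g z))%:E.
  by rewrite fineK// ge0_fin_numE ?ng.2// (le_lt_trans (gc z))// ltry.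
have pwE z : (hk n s y z)%:E * g z + (c * (A * b))%:E * (hk n s (midpoint n x y) z)%:E <=
    (hk n s x z)%:E * g z + (c * (A / 2 + A^-1))%:E * ((hk n s x z)%:E + (hk n s y z)%:E).
  by rewrite (fg z) -?EFinM -?EFinD -?EFinM -?EFinD lee_fin; exact: pw.
have := le_integral_nnm mu (nnmD (ni y) (nnmZ k1 n1)) (nnmD (ni x) (nnmZ k2 (nnmD nx ny))) pwE.
rewrite (integralD_nnm mu (ni y) (nnmZ k1 n1)) (integralD_nnm mu (ni x) (nnmZ k2 (nnmD nx ny))).
rewrite (integralZ_nnm mu n1 k1) (integralZ_nnm mu (nnmD nx ny) k2) (integralD_nnm mu nx ny).
rewrite !integral_hk// mule1.
have Ix a : \int[mu]_z ((hk n s a z)%:E * g z) <= c%:E.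
  have le z : (hk n s a z)%:E * g z <= c%:E * (hk n s a z)%:E.
    by rewrite muleC; apply: lee_wpmul2r; rewrite ?gc// lee_fin ltW// hk_gt0.
  have := le_integral_nnm mu (ni a) (nnmZ c0 (nh a)) le.
  by rewrite (integralZ_nnm mu (nh a) c0) integral_hk// mule1.
have I0 a : 0 <= \int[mu]_z ((hk n s a z)%:E * g z).
  by apply: integral_ge0 => z _; exact: (ni a).2.
have := Ix x; have := Ix y; have := I0 x; have := I0 y.
case: (\int[mu]_z ((hk n s y z)%:E * g z)) => [iy| |]// _.
case: (\int[mu]_z ((hk n s x z)%:E * g z)) => [ix| |]// _ _ _.
rewrite -?EFinD -?EFinM -?EFinD !lee_fin => H.
have : (c * (A - A * b + 2 * A^-1) <= c * rho)%R.
  apply: ler_wpM2l => //.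
  have : (A * (1 - b) <= A * (rho ^+ 2 / 16))%R by apply: ler_wpM2l; [exact: ltW|lra].
  have -> : (A * (rho ^+ 2 / 16) = rho / 4)%R by rewrite /A; field.
  have -> : (A^-1 = rho / 4)%R by rewrite /A invf_div.
  rewrite mulrBr; lra.
move: H; have -> : (c * (A / 2 + A^-1) * (1 + 1) = c * (A + 2 * A^-1))%R by field; rewrite gt_eqF.
rewrite !mulrDr mulrN; lra.
Qed.

End gauss_semigroup.

(** * The weak bound for the gradient at fixed time *)

Lemma markov_nnm d (T : measurableType d) (R : realType)
    (mu : {measure set T -> \bar R}) (F : T -> \bar R) (a : R) : nnm F -> (0 < a)%R ->
  measurable [set x | (a%:E <= F x)%E] /\
  (a%:E * mu [set x | a%:E <= F x] <= \int[mu]_x F x)%E.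
Proof.
move=> nF a0; split.
  by rewrite -[X in measurable X]setTI; apply: emeasurable_fun_c_infty => //; exact: nF.1.
have := @le_integral_comp_abse _ _ _ mu _ measurableT F a id.
have absF x : (`|F x| = F x)%E by rewrite gee0_abs//; exact: nF.2.
rewrite setTI (eq_integral _ _ (fun x _ => absF x)).
rewrite (_ : [set x | (a%:E <= `|F x|)%E] = [set x | (a%:E <= F x)%E]).
  by apply=> //; exact: nF.1.
by apply/seteqP; split=> x /=; rewrite absF.
Qed.

Lemma sum_sqrD_le (R : realType) n (a b : 'I_n -> R) (A B : R) : 0 < A -> 0 < B ->
  \sum_(i < n) a i ^+ 2 <= A ^+ 2 -> \sum_(i < n) b i ^+ 2 <= B ^+ 2 ->
  \sum_(i < n) (a i + b i) ^+ 2 <= (A + B) ^+ 2.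
Proof.
move=> A0 B0 aA bB.
apply: (@le_trans _ _ (\sum_(i < n) ((1 + B / A) * a i ^+ 2 + (1 + A / B) * b i ^+ 2))).
  apply: ler_sum => i _; rewrite -subr_ge0.
  have -> : (1 + B / A) * a i ^+ 2 + (1 + A / B) * b i ^+ 2 - (a i + b i) ^+ 2 =
      (B * a i - A * b i) ^+ 2 / (A * B) by field; rewrite !gt_eqF.
  by rewrite divr_ge0 ?sqr_ge0// mulr_ge0// ltW.
rewrite big_split/= -!mulr_sumr.
apply: (@le_trans _ _ ((1 + B / A) * A ^+ 2 + (1 + A / B) * B ^+ 2)).
  by apply: lerD; apply: ler_wpM2l => //; rewrite addr_ge0// divr_ge0// ltW.
by rewrite le_eqVlt; apply/orP; left; apply/eqP; field; rewrite !gt_eqF.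
Qed.

Section weak_gradient_bound.
Context {R : realType} (n : nat).
Notation E := (euclid R n).
Notation mu := (@leb R n).
Context (tau : R) (tau0 : 0 < tau) (q : R) (q0 : 0 < q) (q1 : q < 1).
Notation h := (hk n tau).
Local Open Scope ereal_scope.

Let be k : R := (cb R k * q ^+ k)%R.

Let h0 x y : (0 <= h x y)%R. Proof. by rewrite ltW// hk_gt0. Qed.
Let mh : measurable_fun setT (fun z : E * E => h z.1 z.2). Proof. exact: measurable_hk. Qed.
Let hC x y : h x y = h y x. Proof. exact: hkC. Qed.
Let h1 x : \int[mu]_y (h x y)%:E = 1. Proof. exact: integral_hk. Qed.
Let be0 k : (0 <= be k)%R.
Proof. by rewrite mulr_ge0// ?exprn_ge0// ltW// cb_gt0. Qed.

(** At k = 0 nothing has been smoothed, and values in [0, c] oscillate by at most c. *)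
Definition lip k x y : R :=
  if k is k'.+1 then (Num.sqrt (dsq n x y) / Num.sqrt (k'.+1%:R * tau))%R else 1%R.

Lemma lip_ge0 k x y : (0 <= lip k x y)%R.
Proof. by case: k => [|k] //=; rewrite divr_ge0// sqrtr_ge0. Qed.

Lemma lipC k x y : lip k x y = lip k y x.
Proof. by case: k => [|k] //=; rewrite dsqC. Qed.

Lemma iter_Hop_lip k (g : E -> \bar R) (c : R) x y : nnm g -> (0 <= c)%R ->
  (forall z, g z <= c%:E) ->
  iter k (Hop mu h) g y <= iter k (Hop mu h) g x + (c * lip k x y)%:E.
Proof.
move=> ng c0 gc; case: k => [|k].
  by rewrite mulr1 (le_trans (gc y))// -[leLHS]add0e leeD2r// ng.2.
rewrite !iter_Hop_hk//; apply: hk_lipschitz => //.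
by rewrite mulr_gt0// ltr0n.
Qed.

Lemma sum_lip_le (Lam : R) x y :
  \sum_(k <oo) (be k.+1 / Num.sqrt k.+1%:R)%:E <= Lam%:E ->
  \sum_(k <oo) (be k * lip k x y)%:E <= (1 + Lam * (Num.sqrt (dsq n x y) / Num.sqrt tau))%:E.
Proof.
move=> sL.
have nn k : 0 <= (be k * lip k x y)%:E by rewrite lee_fin mulr_ge0// lip_ge0.
rewrite (nneseries_split 0 1)// big_nat1 mulr1 {1}/be expr0 mulr1.
rewrite EFinD leeD//.
rewrite mulrC EFinM.
apply: (@le_trans _ _ ((Num.sqrt (dsq n x y) / Num.sqrt tau)%:E *
    \sum_(k <oo) (be k.+1 / Num.sqrt k.+1%:R)%:E)); last by rewrite lee_wpmul2l// lee_fin.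
rewrite -nneseriesMl//; last by move=> k; rewrite lee_fin divr_ge0// sqrtr_ge0.
rewrite -(nneseries_addn 1%N nn).
apply: lee_nneseries => [k *|k *]; first by rewrite addn1 nn.
rewrite addn1.
rewrite -EFinM lee_fin [leRHS]mulrCA /=.
rewrite sqrtrM// invfM le_eqVlt; apply/orP; left; apply/eqP; ring.
Qed.

(** If u > e >= 2 C, the constant part C of the bound is at most u / 2, so u <= 2 C Lam D and u^2 <=
    u^4 / e^2. Values above [e] are thus paid for by the fourth power of the distance. *)
Lemma far_odometer_sqr_le (C Lam e D u : R) : (0 < C)%R -> (0 <= Lam)%R -> (2 * C <= e)%R ->
  (0 <= D)%R -> (0 <= u)%R -> (u <= C * (1 + Lam * D))%R ->
  (u ^+ 2 <= u * Num.min u e + 16 * (C * Lam) ^+ 4 / e ^+ 2 * D ^+ 4)%R.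
Proof.
move=> C0 L0 Ce D0 u0 uC.
have e0 : (0 < e)%R by rewrite (lt_le_trans _ Ce)// mulr_gt0.
set W := (C * Lam)%R; have W0 : (0 <= W)%R by rewrite mulr_ge0// ltW.
have t0 : (0 <= 16 * W ^+ 4 / e ^+ 2 * D ^+ 4)%R.
  by rewrite !(mulr_ge0, invr_ge0, exprn_ge0)// ltW.
case: (leP u e) => ue; first by rewrite expr2 lerDl.
have uW : (u <= 2 * (W * D))%R.
  have : (u <= C + W * D)%R by rewrite (le_trans uC)// /W; lra.
  lra.
have : (u ^+ 2 <= 16 * W ^+ 4 / e ^+ 2 * D ^+ 4)%R.
  have -> : (16 * W ^+ 4 / e ^+ 2 * D ^+ 4 = (2 * (W * D)) ^+ 4 / e ^+ 2)%R by ring.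
  rewrite ler_pdivlMr ?exprn_gt0//.
  apply: (@le_trans _ _ (u ^+ 4)%R); last by rewrite lerXn2r// nnegrE mulr_ge0// mulr_ge0.
  have -> : (u ^+ 4 = u ^+ 2 * u ^+ 2)%R by ring.
  by rewrite ler_wpM2l ?exprn_ge0// lerXn2r ?nnegrE// ltW.
have : (0 <= u * e)%R by rewrite mulr_ge0// ltW.
lra.
Qed.

Definition energy_density (u : E -> R) e x : \bar R :=
  (\1_[set x | u x = 0%R] x)%:E * Hop mu h (fun y => (u y * Num.min (u y) e)%:E) x.

Section decomposition.
Context (K : nat) (K0 : (0 < K)%N) (M l eta e Lam : R).
Context (M0 : (0 <= M)%R) (l0 : (0 < l)%R) (eta0 : (0 < eta)%R)
  (eC : (2 * (M + l) <= e)%R) (Lam0 : (0 <= Lam)%R)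
  (sL : \sum_(k <oo) (be k.+1 / Num.sqrt k.+1%:R)%:E <= Lam%:E)
  (eL : (16384 * Num.sqrt 2 ^+ n * ((M + l) * Lam) ^+ 4 <= (e * eta) ^+ 2)%R).

Let bt k : R := (cb_tail R K k * q ^+ k)%R.

Let C0 : (0 < M + l)%R. Proof. exact: ltr_wpDl. Qed.
Let e0 : (0 < e)%R. Proof. by rewrite (lt_le_trans _ eC)// mulr_gt0. Qed.

(** Cauchy-Schwarz with centering constant 0 leaves H (u^2) at x. The part u min(u, e) is small by
    hypothesis; the rest is a fourth moment of the Gaussian, absorbed by doubling the time. *)
Lemma heat_grad_far_odometer (u : E -> R) x :
  bounded_measurable n u -> (forall y, 0 <= u y)%R ->
  (forall y, (u y)%:E <= (M + l)%:E * \sum_(k <oo) (be k * lip k x y)%:E) ->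
  Hop mu h (fun y => (u y * Num.min (u y) e)%:E) x < (eta ^+ 2 / 4)%:E ->
  (tau * \sum_(j < n) heat_grad n tau j u x ^+ 2 <= (eta / 2) ^+ 2)%R.
Proof.
move=> bu u0 uy Hx.
set D := fun y => (Num.sqrt (dsq n x y) / Num.sqrt tau)%R.
have D0 y : (0 <= D y)%R by rewrite divr_ge0// sqrtr_ge0.
have ule y : (u y <= (M + l) * (1 + Lam * D y))%R.
  rewrite -lee_fin (le_trans (uy y))// EFinM lee_wpmul2l ?lee_fin ?(ltW C0)//.
  exact: sum_lip_le.
pose c := (16 * ((M + l) * Lam) ^+ 4 / e ^+ 2)%R.
have c0 : (0 <= c)%R by rewrite !(mulr_ge0, invr_ge0, exprn_ge0)// ltW.
have s0 : (0 <= c * 256 * Num.sqrt 2 ^+ n)%R.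
  apply: mulr_ge0; first by apply: mulr_ge0; [exact: c0|exact: ler0n].
  by apply: exprn_ge0; exact: sqrtr_ge0.
have cE : c = (16 * ((M + l) * Lam) ^+ 4 / e ^+ 2)%R by [].
clearbody c.
have D4 y : (D y ^+ 4 = dsq n x y ^+ 2 / tau ^+ 2)%R.
  rewrite /D expr_div_n -[4%N]/(2 * 2)%N !exprM !sqr_sqrtr// ?dsq_ge0// ltW//.
have t2 : (0 < 2 * tau)%R by rewrite mulr_gt0.
have := @heat_grad_sqr_le R n tau u x 0%R tau0 bu.
under eq_integral do rewrite subr0.
move=> H1.
have nm1 : nnm (fun y => (h x y * (u y * Num.min (u y) e))%:E).
  split=> [|y]; last by rewrite lee_fin (mulr_ge0 (h0 x y)) ?mulr_ge0// le_min u0 ltW.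
  apply/measurable_EFinP; apply: measurable_funM; first exact: measurable_hkr.
  apply: measurable_funM; first exact: bu.1.
  exact: measurable_minr bu.1 (measurable_cst _).
have nm2 : nnm (fun y => (c * 256 * Num.sqrt 2 ^+ n * hk n (2 * tau) x y)%:E).
  split=> [|y]; last first.
    by rewrite lee_fin mulr_ge0// ltW// hk_gt0.
  by apply/measurable_EFinP; apply: measurable_funM => //; exact: measurable_hkr.
have nm0 : nnm (fun y => (h x y * u y ^+ 2)%:E).
  split=> [|y]; last by rewrite lee_fin mulr_ge0// sqr_ge0.
  by apply/measurable_EFinP; apply: measurable_funM;
    [exact: measurable_hkr|apply: measurable_funX; exact: bu.1].
have H2 : \int[mu]_y (h x y * u y ^+ 2)%:E <=
    \int[mu]_y (h x y * (u y * Num.min (u y) e))%:E +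
    (c * 256 * Num.sqrt 2 ^+ n)%:E.
  rewrite -[X in _ + X]mule1 -(@integral_hk R n (2 * tau) x)//.
  rewrite -(integralZ_nnm mu _ s0); last first.
    by split=> [|y]; [apply/measurable_EFinP; exact: measurable_hkr|rewrite lee_fin ltW// hk_gt0].
  rewrite -(integralD_nnm mu nm1 nm2).
  apply: (le_integral_nnm mu nm0 (nnmD nm1 nm2)) => y.
  rewrite -EFinD lee_fin.
  have := far_odometer_sqr_le _ _ _ _ _ C0 Lam0 eC (D0 y) (u0 y) (ule y).
  rewrite -cE D4 => /(ler_wpM2l (h0 x y)) /le_trans; apply.
  rewrite mulrDr lerD2l.
  have -> : (h x y * (c * (dsq n x y ^+ 2 / tau ^+ 2)) =
             c / tau ^+ 2 * (dsq n x y ^+ 2 * h x y))%R by ring.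
  have -> : (c * 256 * Num.sqrt 2 ^+ n * hk n (2 * tau) x y =
      c / tau ^+ 2 * (256 * tau ^+ 2 * Num.sqrt 2 ^+ n * hk n (2 * tau) x y))%R.
    by field; rewrite gt_eqF.
  apply: ler_wpM2l; last exact: hk_doubling.
  by rewrite divr_ge0// exprn_ge0// ltW.
have : (2 * tau * \sum_(j < n) heat_grad n tau j u x ^+ 2 <=
    eta ^+ 2 / 4 + c * 256 * Num.sqrt 2 ^+ n)%R.
  rewrite -lee_fin (le_trans H1)// (le_trans H2)// EFinD leeD2r//.
  by move/ltW: Hx; rewrite /Hop; under eq_integral do rewrite -EFinM.
(* Here 16384 = 4 * 16 * 256, with 16 from [far_odometer_sqr_le], 256 from [hk_doubling] and 4 from
   the target eta^2 / 4. *)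
have : (c * 256 * Num.sqrt 2 ^+ n <= eta ^+ 2 / 4)%R.
  have -> : (c * 256 * Num.sqrt 2 ^+ n =
     (16384 * Num.sqrt 2 ^+ n * ((M + l) * Lam) ^+ 4) / (4 * e ^+ 2))%R.
    by rewrite cE; field; rewrite gt_eqF.
  rewrite ler_pdivrMr ?mulr_gt0 ?exprn_gt0//.
  by rewrite (le_trans eL)// le_eqVlt; apply/orP; left; apply/eqP; field.
rewrite expr_div_n; lra.
Qed.

(** The exceptional set consists of the toppled set and of the points whose leaked energy reaches
    eta^2 / 4; the second measure bound is Chebyshev's inequality. *)
Lemma heat_sandpile (f : E -> \bar R) (G : R) : nnm f -> \int[mu]_x f x <= G%:E ->
  (forall k x, (K <= k)%N -> iter k (Hop mu h) f x <= M%:E) ->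
  exists g u : E -> R, exists N : set E,
  [/\ [/\ measurable_fun setT g, (forall x, 0 <= g x <= l)%R & \int[mu]_x (g x)%:E <= G%:E],
      bounded_measurable n u,
      (forall x, Sop mu h bt f x = Sop mu h be (EFin \o g) x + (u x)%:E),
      measurable N /\ mu N <= (G / l + 4 * e * cb R K * G / (q * eta ^+ 2))%:E &
      (forall x, ~ N x -> tau * \sum_(j < n) heat_grad n tau j u x ^+ 2 <= (eta / 2) ^+ 2)%R].
Proof.
move=> nf fG fM.
have [g [u [gP [mu' u0 [C uC]] uG BE [ule uen]]]] :=
  sandpile_decomposition _ _ _ mu h h0 mh hC h1 [tuple of nseq n 0%R] q q0 q1 K K0 f nf G fG M M0 fM
   l lip l0 lip_ge0 lipC iter_Hop_lip.
have bu : bounded_measurable n u.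
  by split=> //; exists C => y; rewrite ger0_norm.
have mO : measurable [set x | u x = 0%R].
  rewrite (_ : [set x | _] = (u @^-1` [set 0%R])) //.
  by rewrite -[X in measurable X]setTI; exact: (mu' measurableT _ (measurable_set1 _)).
have mOc : measurable [set x | u x != 0%R].
  rewrite (_ : [set x | _] = ~` [set x | u x = 0%R]); first exact: measurableC.
  by apply/seteqP; split=> x /= /eqP.
have nH : nnm (Hop mu h (fun y => (u y * Num.min (u y) e)%:E)).
  apply: nnm_Hop => //; split=> [|y]; last by rewrite lee_fin mulr_ge0// le_min u0 ltW.
  apply/measurable_EFinP; apply: measurable_funM => //.
  exact: measurable_minr mu' (measurable_cst _).
have nen : nnm (energy_density u e).
  apply: nnmM => //; split=> [|y]; last by rewrite lee_fin.
  by apply/measurable_EFinP; exact: measurable_indic.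
have eta4 : (0 < eta ^+ 2 / 4)%R by rewrite divr_gt0// exprn_gt0.
have [mN Nle] := markov_nnm _ _ _ mu _ _ nen eta4.
exists g, u, ([set x | u x != 0%R] `|` [set x | (eta ^+ 2 / 4)%:E <= energy_density u e x]).
split=> //.
  split; first exact: measurableU.
  apply: le_trans (measureU2 _ _ _) _ => //.
  rewrite EFinD leeD//.
    by rewrite mulrC EFinM lee_pdivlMl.
  have qe : (0 < q * (eta ^+ 2 / 4))%R by rewrite mulr_gt0.
  have -> : (4 * e * cb R K * G / (q * eta ^+ 2) = (q * (eta ^+ 2 / 4))^-1 * (e * (cb R K * G)))%R.
    by field; rewrite !gt_eqF.
  rewrite [leRHS]EFinM lee_pdivlMl// EFinM -muleA (le_trans _ (uen e e0))// lee_wpmul2l// lee_fin ltW//.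
move=> x /not_orP[/negP]; rewrite negbK => /eqP ux0 /negP; rewrite -ltNge.
rewrite /energy_density indicE mem_set// mul1e => Hx.
apply: heat_grad_far_odometer => // y.
exact: ule.
Qed.

Lemma settled_potential (f g : E -> \bar R) (v u : E -> R) : nnm g ->
  (forall x, g x <= l%:E) -> bounded_measurable n u -> (forall x, (v x)%:E = Sop mu h bt f x) ->
  (forall x, Sop mu h bt f x = Sop mu h be g x + (u x)%:E) ->
  (forall x, (v x - u x)%:E = Sop mu h be g x)%R /\ bounded_measurable n (fun x => v x - u x)%R.
Proof.
move=> ng gl bu vE fE.
have wE x : (v x - u x)%:E = Sop mu h be g x.
  have := vE x; rewrite fE EFinB => ->; rewrite addeK//.
split=> //.
have nS := nnm_Sop _ _ _ mu _ h0 mh _ _ be0 ng.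
have [S S1 SE] := sum_cb_fin _ _ q0 q1.
split.
  apply/measurable_EFinP.
  by rewrite (_ : EFin \o _ = Sop mu h be g); [exact: nS.1|apply/funext => x /=; rewrite wE].
exists (l * S)%R => y.
rewrite ger0_norm -lee_fin wE ?nS.2//.
exact: (Sop_le_cst _ _ _ mu h h0 mh h1 _ _ _ _ _ be0 ng (ltW l0) SE gl).
Qed.

Theorem heat_gradient_weak_bound (f1 f2 : E -> \bar R) (G1 G2 : R) (v1 v2 : E -> R) :
  nnm f1 -> nnm f2 -> \int[mu]_x f1 x <= G1%:E -> \int[mu]_x f2 x <= G2%:E ->
  (forall k x, (K <= k)%N -> iter k (Hop mu h) f1 x <= M%:E) ->
  (forall k x, (K <= k)%N -> iter k (Hop mu h) f2 x <= M%:E) ->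
  (forall x, (v1 x)%:E = Sop mu h bt f1 x) -> (forall x, (v2 x)%:E = Sop mu h bt f2 x) ->
  exists N : set E, [/\ measurable N,
    mu N <= ((G1 + G2) / l + (G1 + G2) / (q * l) +
             4 * e * cb R K * (G1 + G2) / (q * eta ^+ 2))%:E &
    forall x, ~ N x ->
      (tau * \sum_(j < n) heat_grad n tau j (fun y => v1 y - v2 y) x ^+ 2 <= (l + eta) ^+ 2)%R].
Proof.
move=> n1 n2 i1 i2 M1 M2 v1E v2E.
have [g1 [u1 [N1 [[mg1 g1l ig1] bu1 E1 [mN1 N1l] hN1]]]] := heat_sandpile _ _ n1 i1 M1.
have [g2 [u2 [N2 [[mg2 g2l ig2] bu2 E2 [mN2 N2l] hN2]]]] := heat_sandpile _ _ n2 i2 M2.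
have nE (g : E -> R) : measurable_fun setT g -> (forall x, 0 <= g x <= l)%R -> nnm (EFin \o g).
  by move=> mg gl; split=> [|x]; [exact/measurable_EFinP|rewrite lee_fin; case/andP: (gl x)].
have ng1 := nE _ mg1 g1l; have ng2 := nE _ mg2 g2l.
have lE (g : E -> R) : (forall x, 0 <= g x <= l)%R -> forall x, (EFin \o g) x <= l%:E.
  by move=> gl x; rewrite lee_fin; case/andP: (gl x).
have [w1E bw1] := settled_potential _ _ _ _ ng1 (lE _ g1l) bu1 v1E E1.
have [w2E bw2] := settled_potential _ _ _ _ ng2 (lE _ g2l) bu2 v2E E2.
have [S S1 SE] := sum_cb_fin _ _ q0 q1.
have [rho rho1 rhoE] := sum_ca_lt1 _ _ _ mu _ h0 mh h1 [tuple of nseq n 0%R] _ q0 q1.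
pose w1 x := (v1 x - u1 x)%R. pose w2 x := (v2 x - u2 x)%R.
have bw := bounded_measurableB n _ _ bw1 bw2.
pose Gam x := \int[mu]_y (h x y * ((w1 y - w2 y) - (w1 x - w2 x)) ^+ 2)%:E.
have GamI : q%:E * \int[mu]_x Gam x <= (2 * l * (G1 + G2))%:E.
  have al0 k : (0 <= ca R k * q ^+ k)%R by rewrite mulr_ge0 ?ca_ge0// exprn_ge0// ltW.
  have bE := Sop_cbE _ _ _ mu h h0 mh q q0.
  have bE' := Sop_cb_ca _ _ _ mu h h0 mh q q0.
  exact: (resolvent_dirichlet_bound _ _ _ mu h h0 mh hC h1 (fun k => ca R k * q ^+ k)%R be rho S q
    al0 be0 rhoE SE q0 (ltW q1) bE bE' (EFin \o g1) (EFin \o g2) w1 w2 l G1 G2 ng1 ng2 (ltW l0)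
    (lE _ g1l) (lE _ g2l) ig1 ig2 w1E w2E).
have nGam : nnm Gam.
  split; last first.
    by move=> x; apply: integral_ge0 => y _; rewrite lee_fin mulr_ge0// sqr_ge0.
  apply: (@measurable_fun_fubini_tonelli_F _ _ _ _ _ mu
    (fun z : E * E => (h z.1 z.2 * ((w1 z.2 - w2 z.2) - (w1 z.1 - w2 z.1)) ^+ 2)%:E)).
    apply/measurable_EFinP; apply: measurable_funM => //; apply: measurable_funX.
    apply: measurable_funB.
      exact: (measurableT_comp bw.1 measurable_snd).
    exact: (measurableT_comp bw.1 measurable_fst).
  by move=> z; rewrite lee_fin mulr_ge0// sqr_ge0.
(* The level 2 l^2 matches the factor 2 tau in [heat_grad_sqr_le]: off this set tau |grad|^2 < l^2,
   and the factor 2 of the Dirichlet bound cancels. *)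
have l2 : (0 < 2 * l ^+ 2)%R by rewrite mulr_gt0// exprn_gt0.
have [mN3 N3l] := markov_nnm _ _ _ mu _ _ nGam l2.
set N3 := [set x | (2 * l ^+ 2)%:E <= Gam x] in mN3 N3l.
have N3le : mu N3 <= ((G1 + G2) / (q * l))%:E.
  have -> : ((G1 + G2) / (q * l) = (q * (2 * l ^+ 2))^-1 * (2 * l * (G1 + G2)))%R.
    by field; rewrite !gt_eqF.
  rewrite [leRHS]EFinM lee_pdivlMl ?mulr_gt0// [(q * _)%:E]EFinM -muleA (le_trans _ GamI)//.
  by rewrite lee_wpmul2l// lee_fin ltW.
exists (N1 `|` N2 `|` N3); split.
- by apply: measurableU => //; exact: measurableU.
- apply: (@le_trans _ _ (mu N1 + mu N2 + mu N3)).
    apply: le_trans (measureU2 _ _ _) _ => //; first exact: measurableU.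
    by rewrite leeD2r// measureU2.
  apply: (le_trans (leeD (leeD N1l N2l) N3le)).
  by rewrite -!EFinD lee_fin le_eqVlt; apply/orP; left; apply/eqP; ring.
move=> x /not_orP[/not_orP[xN1 xN2] /negP]; rewrite -ltNge => Gx.
have e2 : (0 < eta / 2)%R by rewrite divr_gt0.
have st : (Num.sqrt tau ^+ 2 = tau)%R by rewrite sqr_sqrtr// ltW.
rewrite -{1}st mulr_sumr; under eq_bigr do rewrite -exprMn.
have -> : (l + eta = l + eta / 2 + eta / 2)%R by field.
have vE : (fun y => v1 y - v2 y)%R = (fun y => (w1 y - w2 y + u1 y) - u2 y)%R.
  by apply/funext => y; rewrite /w1 /w2; ring.
have gE j : (Num.sqrt tau * heat_grad n tau j (fun y => v1 y - v2 y) x =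
    Num.sqrt tau * heat_grad n tau j (fun y => w1 y - w2 y) x +
    Num.sqrt tau * heat_grad n tau j u1 x + - (Num.sqrt tau * heat_grad n tau j u2 x))%R.
  rewrite vE (heat_gradB n tau j _ _ x tau0 (bounded_measurableD n _ _ bw bu1) bu2).
  by rewrite (heat_gradD n tau j _ _ x tau0 bw bu1) mulrBr mulrDr.
under eq_bigr do rewrite gE.
apply: sum_sqrD_le => //; first exact: addr_gt0.
  apply: sum_sqrD_le => //.
    under eq_bigr do rewrite exprMn st; rewrite -mulr_sumr.
    have := @heat_grad_sqr_le R n tau _ x (w1 x - w2 x)%R tau0 bw.
    move=> /le_lt_trans => /(_ _ Gx); rewrite lte_fin; lra.
  by under eq_bigr do rewrite exprMn st; rewrite -mulr_sumr; exact: hN1.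
by under eq_bigr do rewrite sqrrN exprMn st; rewrite -mulr_sumr; exact: hN2.
Qed.

End decomposition.

End weak_gradient_bound.

(** * Asymptotics of the coefficients *)

Section central_binomial_asymptotics.
Context {R : realType}.
Notation leb1 := (@lebesgue_measure R).

(* [scb k] decreases to [1 / sqrt pi]; only the lower bound on its limit matters. *)
Definition scb k : R := Num.sqrt k.+1%:R * cb R k.

Lemma scb_ge0 k : 0 <= scb k.
Proof. by rewrite mulr_ge0 ?sqrtr_ge0// ltW// cb_gt0. Qed.

Lemma scb_le1 k : scb k <= 1.
Proof.
rewrite /scb mulrC -ler_pdivlMr ?sqrtr_gt0 ?ltr0n// div1r.
exact: cb_le_sqrt.
Qed.

Lemma scbS_le k : scb k.+1 <= scb k.
Proof.
have cE : cb R k.+1 = cb R k * ((2 * k + 1)%N%:R / (2 * k + 2)%N%:R) by [].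
have := cb_gt0 R k; rewrite -(ler_pXn2r (ltn0Sn 1)) ?nnegrE ?scb_ge0// /scb cE.
move: (cb R k) => b b0; rewrite !exprMn !sqr_sqrtr ?ler0n// exprVn.
rewrite mulrCA [leRHS]mulrC ler_wpM2l ?sqr_ge0// mulrA.
rewrite ler_pdivrMr ?exprn_gt0 ?ltr0n ?addn2//.
rewrite -!natrX -!natrM ler_nat; nia.
Qed.

(** [F m] vanishes at -1 and 1, and its derivative combines the integrands of orders m and m + 1;
    this yields the Wallis recursion. *)
Let F m (x : R) : R := x * (1 - x ^+ 2) ^+ m.+1.
Let g m (x : R) : R := (1 - x ^+ 2) ^+ m.

Let g_poly m : g m = horner ((1 - 'X^2) ^+ m).
Proof. by apply/funext => x; rewrite /g !hornerE. Qed.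

Let F_poly m : F m = horner ('X * (1 - 'X^2) ^+ m.+1).
Proof. by apply/funext => x; rewrite /F !hornerE. Qed.

Let dF m x : (F m)^`()%classic x = (2 * m)%N.+3%:R * g m.+1 x - (2 * m)%N.+2%:R * g m x.
Proof.
rewrite F_poly -derivE derivM derivX mul1r deriv_exp derivB derivXn -polyC1 derivC /g !hornerE.
rewrite expr1 !(hornerMn, hornerE).
have e3 : (2 * m).+3%:R = 2 * m%:R + 3 :> R by rewrite -addn3 natrD natrM.
have e2 : (2 * m).+2%:R = 2 * m%:R + 2 :> R by rewrite -addn2 natrD natrM.
have e1 : m.+1%:R = m%:R + 1 :> R by rewrite -addn1 natrD.
rewrite -[_ *+ m.+1]mulr_natl -[x *+ 2]mulr_natl exprS e1 e2 e3 [m.+1.-1]/=.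
move: ((1 - x ^+ 2) ^+ m) => y; ring.
Qed.

Lemma wallis_integral m :
  (\int[leb1]_(x in `[(-1)%R, 1%R]) (g m x)%:E = (2 / ((2 * m)%N.+1%:R * cb R m))%:E)%E.
Proof.
have gi k : leb1.-integrable `[-1, 1] (EFin \o g k).
  apply: continuous_compact_integrable; first exact: segment_compact.
  by apply: continuous_subspaceT => x; rewrite g_poly; exact: continuous_horner.
elim: m => [|m IH].
  rewrite muln0 /= mul1r divr1.
  under eq_integral do rewrite /g expr0.
  rewrite integral_cst//= lebesgue_measure_itv/= lte_fin.
  rewrite (_ : (-1 < 1)%R); last by rewrite (lt_trans (ltrN10 _)).
  by rewrite mul1e opprK.
have N11 : (-1 < 1 :> R)%R by rewrite (lt_trans (ltrN10 _)).
have : (\int[leb1]_(x in `[(-1)%R, 1%R]) ((2 * m)%N.+3%:R * g m.+1 x - (2 * m)%N.+2%:R * g m x)%:E = 0)%E.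
  rewrite (@continuous_FTC2 _ _ (F m))//.
  - by rewrite /F expr1n subrr expr0n mulr0 sqrrN expr1n subrr expr0n mulr0 subee.
  - apply: continuous_subspaceT => x; rewrite g_poly g_poly.
    by apply: cvgB; apply: cvgM; try exact: cvg_cst; exact: continuous_horner.
  - rewrite F_poly; split.
    + by move=> x _; exact: derivable_horner.
    + exact/cvg_at_right_filter/continuous_horner.
    + exact/cvg_at_left_filter/continuous_horner.
under eq_integral do rewrite EFinB !EFinM.
have gZ k (c : R) : leb1.-integrable `[(-1)%R, 1%R] (fun x => c%:E * (g k x)%:E)%E.
  by have := integrableZl _ c (gi k); exact.
rewrite (integralB _ (gZ _ _) (gZ _ _))//.
rewrite (integralZl _ (gi m.+1))// (integralZl _ (gi m))// IH.
have : (\int[leb1]_(x in `[(-1)%R, 1%R]) (g m.+1 x)%:E)%E \is a fin_num.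
  exact: (integrable_fin_num _ (gi m.+1)).
rewrite -[(\int[_]_(_ in _) (EFin \o g m.+1) _)%E]/(\int[leb1]_(x in `[(-1)%R, 1%R]) (g m.+1 x)%:E)%E.
move: (\int[leb1]_(x in `[(-1)%R, 1%R]) (g m.+1 x)%:E)%E => -[r||]// _.
rewrite -!EFinM -EFinB => -[] /eqP; rewrite subr_eq0 => /eqP rE.
congr EFin.
have -> : r = (2 * m).+2%:R * (2 / ((2 * m).+1%:R * cb R m)) / (2 * m).+3%:R.
  by rewrite -rE mulrC mulKf// pnatr_eq0.
have -> : cb R m.+1 = cb R m * ((2 * m + 1)%N%:R / (2 * m + 2)%N%:R) by [].
rewrite addn1 addn2 mulnS addnC addn2.
have := lt0r_neq0 (cb_gt0 R m); have nz k : k.+1%:R != 0 :> R by rewrite pnatr_eq0.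
have := nz (2 * m)%N; have := nz (2 * m).+1; have := nz (2 * m).+2.
move: (cb R m) (2 * m).+1%:R (2 * m).+2%:R (2 * m).+3%:R => b x y z z0 y0 x0 b0.
by field; rewrite b0 x0 y0 z0.
Qed.

Lemma gauss_integral_line (s : R) : (0 < s)%R ->
  (\int[leb1]_x (expR (- (s * x ^+ 2)))%:E = (Num.sqrt (pi / s))%:E)%E.
Proof.
move=> s0; pose sg := Num.sqrt (2 * s)^-1.
have sg0 : sg != 0%R by rewrite gt_eqF// sqrtr_gt0 invr_gt0 mulr_gt0.
have sg2 : (sg ^+ 2 = (2 * s)^-1)%R by rewrite sqr_sqrtr// invr_ge0 mulr_ge0// ltW.
have p0 : (0 < pi / s :> R)%R by rewrite divr_gt0// pi_gt0.
have -> : (fun x => (expR (- (s * x ^+ 2)))%:E) =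
   (fun x => (Num.sqrt (pi / s))%:E * (normal_pdf 0 sg x)%:E)%E :> (R -> \bar R).
  apply/funext => x; rewrite -EFinM; congr EFin.
  rewrite normal_pdfE// /normal_peak /normal_fun sg2 subr0.
  have -> : ((2 * s)^-1 * pi *+ 2 = pi / s)%R by rewrite -mulr_natr; field; rewrite gt_eqF.
  rewrite mulVKf; last by rewrite gt_eqF// sqrtr_gt0.
  by congr expR; rewrite -mulr_natr; field; rewrite gt_eqF.
rewrite ge0_integralZl ?integral_normal_pdf ?mule1//.
- by apply/measurable_EFinP; exact: measurable_normal_pdf.
- by move=> x _; rewrite lee_fin normal_pdf_ge0.
Qed.

(** Integrating (1 - x^2)^k <= exp (- k x^2) compares the Wallis integral with sqrt (pi / k). *)
Lemma scb_lower m : 1 - m.+1%:R^-1 <= scb m * Num.sqrt pi.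
Proof.
case: m => [|m]; first by rewrite invr1 subrr mulr_ge0 ?sqrtr_ge0 ?scb_ge0.
set k := m.+1.
have k0 : (0 < k%:R :> R) by rewrite ltr0n.
have mE : measurable_fun setT (fun x : R => (expR (- (k%:R * x ^+ 2)))%:E).
  apply/measurable_EFinP; apply: measurableT_comp => //; apply: measurable_funN.
  by apply: measurable_funM => //; exact: measurable_funX.
have H : ((2 / ((2 * k)%N.+1%:R * cb R k))%:E <= (Num.sqrt (pi / k%:R))%:E :> \bar R)%E.
  rewrite -wallis_integral -gauss_integral_line//.
  apply: (@le_trans _ _ (\int[leb1]_(x in `[(-1)%R, 1%R]) (expR (- (k%:R * x ^+ 2)))%:E)%E).
    have x1 (x : R) : `[(-1)%R, 1%R]%classic x -> 0 <= 1 - x ^+ 2.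
      rewrite /= in_itv/= => /andP[a b]; rewrite subr_ge0 -(expr1n R 2).
      by rewrite -ler_sqrt ?sqr_ge0// !sqrtr_sqr normr1 ler_norml a b.
    apply: ge0_le_integral => //.
    - by move=> x xI; rewrite lee_fin exprn_ge0// x1.
    - apply/measurable_EFinP; apply: measurable_funTS; rewrite g_poly.
      by apply: continuous_measurable_fun; exact: continuous_horner.
    - exact: measurable_funTS.
    - move=> x xI; rewrite lee_fin /g (_ : expR (- _) = expR (- x ^+ 2) ^+ k); last by rewrite -expRM_natl mulrN.
      by apply: lerXn2r; rewrite ?nnegrE ?expR_ge0 ?x1// expR_ge1Dx.
  by apply: ge0_subset_integral => // x _; rewrite lee_fin expR_ge0.
move: H; rewrite lee_fin sqrtrM ?pi_ge0// sqrtrV ?ler0n//.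
have sk : 0 < Num.sqrt k%:R :> R by rewrite sqrtr_gt0.
have skk : Num.sqrt k%:R * Num.sqrt k%:R = k%:R :> R by rewrite -expr2 sqr_sqrtr// ltW.
have ss : Num.sqrt k%:R <= Num.sqrt k.+1%:R :> R by rewrite ler_wsqrtr// ler_nat.
have cb0 := cb_gt0 R k.
rewrite /scb; move: (cb R k) cb0 => b b0.
have N0 : 0 < (2 * k).+1%:R :> R by rewrite ltr0n.
rewrite ler_pdivrMr ?mulr_gt0// mulrAC ler_pdivlMr// => H.
have sp : 0 <= Num.sqrt pi :> R by exact: sqrtr_ge0.
have H2 : 2 * k%:R <= (2 * k).+1%:R * (Num.sqrt k.+1%:R * b * Num.sqrt pi).
  rewrite -skk mulrA (le_trans (ler_wpM2r (ltW sk) H))//.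
  have -> : Num.sqrt pi * ((2 * k).+1%:R * b) * Num.sqrt k%:R = (2 * k).+1%:R * b * Num.sqrt pi * Num.sqrt k%:R by ring.
  have -> : (2 * k).+1%:R * (Num.sqrt k.+1%:R * b * Num.sqrt pi) = (2 * k).+1%:R * b * Num.sqrt pi * Num.sqrt k.+1%:R by ring.
  by rewrite ler_wpM2l// mulr_ge0// mulr_ge0// ltW.
apply: (@le_trans _ _ (2 * k%:R / (2 * k).+1%:R)); last by rewrite ler_pdivrMr// [leRHS]mulrC.
rewrite ler_pdivlMr// -[(2 * k).+1]addn1 natrD natrM -[k.+1]addn1 natrD.
have k1 : 0 < k%:R + 1 :> R by rewrite addr_gt0.
rewrite -(ler_pM2r k1) mulrAC mulrBl mulVf ?gt_eqF//; nra.
Qed.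

Lemma scb_cvg : exists2 c : R, scb k @[k --> \oo] --> c & 1 <= c * Num.sqrt pi.
Proof.
have dn : nonincreasing_seq scb by apply/nonincreasing_seqP; exact: scbS_le.
have /cvg_ex[c cc] : cvgn scb.
  by apply: nonincreasing_is_cvgn => //; exists 0 => _ [k _ <-]; exact: scb_ge0.
exists c => //.
have h1 : (1 - m.+1%:R^-1 : R) @[m --> \oo] --> 1 - (0 : R).
  by apply: cvgB; [exact: cvg_cst|exact: cvg_harmonic].
rewrite subr0 in h1.
have h2 : (scb m * Num.sqrt pi) @[m --> \oo] --> c * Num.sqrt pi.
  by apply: cvgM => //; exact: cvg_cst.
by apply: ler_cvg_to h1 h2 _; near=> m; exact: scb_lower.
Unshelve. all: by end_near.
Qed.

(** The relaxation scale K^2 lies far beyond the indices of order K that carry the kernel, so the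
    damping disappears in the limit; yet its logarithm is only 2 ln K, which keeps the Lipschitz
    constant of B logarithmic. *)
Definition damping K : R := 1 - (K%:R ^+ 2)^-1.

Lemma damping_gt0 K : (1 < K)%N -> 0 < damping K.
Proof.
move=> K1; have K2 : (1 < K ^ 2)%N by rewrite -{1}(exp1n 2) ltn_exp2r.
by rewrite subr_gt0 -natrX invf_lt1 ?ltr1n// ltr0n ltnW.
Qed.

Lemma damping_lt1 K : (0 < K)%N -> damping K < 1.
Proof. by move=> K1; rewrite gtrBl invr_gt0 exprn_gt0// ltr0n. Qed.

Lemma damping_exp_ge K k : (0 < K)%N -> 1 - k%:R / K%:R ^+ 2 <= damping K ^+ k.
Proof.
move=> K0; elim: k => [|k IH]; first by rewrite mul0r subr0.
have [K1|K1] := leqP K 1.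
  have -> : K = 1%N by lia.
  by rewrite /damping expr1n invr1 subrr expr0n/= mulr1 subr_le0 ler1n.
rewrite [leRHS]exprSr (le_trans _ (ler_wpM2r (ltW (damping_gt0 _ K1)) IH))//.
rewrite /damping -natr1.
have : 0 <= k%:R / K%:R ^+ 2 * (K%:R ^+ 2)^-1 :> R by rewrite mulr_ge0 ?divr_ge0 ?invr_ge0 ?exprn_ge0.
move: (K%:R ^+ 2)^-1 => z; lra.
Qed.

(** Increment by increment, from ln (1 + x) <= x at x = -1 / (m + 2). *)
Lemma harmonic_le_ln m : \sum_(0 <= k < m.+1) (k.+1%:R^-1 : R) <= 1 + ln m.+1%:R.
Proof.
elim: m => [|m IH]; first by rewrite big_nat1 invr1 ln1 addr0.
rewrite big_nat_recr//= (le_trans (lerD IH (lexx _)))// -addrA lerD2l.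
have p0 k : 0 < k.+1%:R :> R by rewrite ltr0n.
rewrite -lerBrDl -opprB -lerNr.
rewrite -ln_div ?posrE//.
have -> : m.+1%:R / m.+2%:R = 1 + - m.+2%:R^-1 :> R.
  have := lt0r_neq0 (p0 m.+1); rewrite -[m.+2]addn1 natrD => nz; by field.
by apply: le_ln1Dx; rewrite ltrN2 invf_lt1// ltr1n.
Qed.

(** Cut at K^2: the head is a harmonic sum, and in the tail 1 / (k + 1) <= K^(-2) against a
    geometric series of sum at most K^2. *)
Lemma geometric_harmonic_le (K : nat) : (1 < K)%N ->
  (\sum_(k <oo) (damping K ^+ k.+1 / k.+1%:R)%:E <= (2 + 2 * ln K%:R)%:E)%E.
Proof.
move=> K1; have k0 : 0 < K%:R :> R by rewrite ltr0n ltnW.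
have K2 : (0 < K ^ 2)%N by rewrite expn_gt0 ltnW.
have q1 := ltW (damping_lt1 _ (ltnW K1)); have q0 := ltW (damping_gt0 _ K1).
have t0 k : 0 <= damping K ^+ k.+1 / k.+1%:R :> R by rewrite divr_ge0// exprn_ge0.
apply: lime_le; first by apply: is_cvg_nneseries => k _ _; rewrite lee_fin.
apply: nearW => N; rewrite sumEFin lee_fin.
apply: (@le_trans _ _ (\sum_(0 <= k < K ^ 2 + N) (damping K ^+ k.+1 / k.+1%:R))).
  rewrite addnC (@big_cat_nat _ _ _ N _ (N + K ^ 2))//= ?leq_addr// lerDl.
  by apply: sumr_ge0.
rewrite (@big_cat_nat _ _ _ (K ^ 2)%N _ (K ^ 2 + N))//= ?leq_addr//.
have -> : 2 + 2 * ln K%:R = (1 + ln (K ^ 2)%:R) + 1 :> R.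
  rewrite natrX lnXn//; ring.
apply: lerD.
  rewrite -(prednK K2); apply: le_trans (harmonic_le_ln _).
  by apply: ler_sum => k _; rewrite ler_piMl ?invr_ge0// exprn_ile1.
apply: (@le_trans _ _ ((K ^ 2)%:R^-1 * \sum_(0 <= k < N) damping K ^+ k)).
  rewrite -{1}[(K ^ 2)%N]add0n big_addn addnC addnK mulr_sumr.
  rewrite ler_sum// => k _; rewrite mulrC ler_pM ?invr_ge0// ?exprn_ge0//.
    by rewrite lef_pV2 ?posrE ?ltr0n// ler_nat leqW// leq_addl.
  by rewrite ler_wiXn2l// ltnW// ltnS leq_addr.
rewrite big_mkord ler_pdivrMl ?ltr0n// mulr1.
have q' : 0 < (K ^ 2)%:R^-1 :> R by rewrite invr_gt0 ltr0n.
rewrite -(ler_pM2l q') mulVf ?pnatr_eq0 -?lt0n//.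
have -> : (K ^ 2)%:R^-1 = 1 - damping K by rewrite /damping natrX opprB addrC subrK.
rewrite -opprB mulNr -subrX1 opprB gerBl exprn_ge0//.
Qed.

(** The eighth root is taken so that the fourth power of the logarithm, which enters the smallness
    condition, is O(sqrt K), while K is available. *)
Lemma ln_le_root (K : nat) : (0 < K)%N -> ln K%:R <= 8 * Num.sqrt (Num.sqrt (Num.sqrt K%:R)) :> R.
Proof.
move=> K0; have k0 : 0 < K%:R :> R by rewrite ltr0n.
set s := Num.sqrt _; have s0 : 0 < s by rewrite !sqrtr_gt0.
have -> : K%:R = s ^+ 8.
  by rewrite /s -[8%N]/(2 * 4)%N exprM sqr_sqrtr ?sqrtr_ge0// -[4%N]/(2 * 2)%N exprM !sqr_sqrtr// ?sqrtr_ge0// ltW.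
rewrite lnXn// -[ln s *+ 8]mulr_natl ler_pM2l ?ltr0n//.
exact/ltW/ln_sublinear.
Qed.

End central_binomial_asymptotics.

(** * Kernel of the discrete Riesz transform *)

Section step_functions.
Context {R : realType}.
Notation leb1 := (@lebesgue_measure R).
Notation trunc := Num.Def.trunc.
Local Open Scope ereal_scope.

Lemma step_function_series (c : nat -> R) (tau s : R) : (0 < tau)%R -> (0 <= s)%R ->
  (forall k, 0 <= c k)%R ->
  (c (trunc (s / tau)))%:E =
  \sum_(k <oo) (c k * \1_[set s : R | k%:R * tau <= s < k.+1%:R * tau]%R s)%:E.
Proof.
move=> tau0 s0 c0; have st0 : (0 <= s / tau)%R by rewrite divr_ge0// ltW.
rewrite -(nneseries_delta R (trunc (s / tau)) (c (trunc (s / tau)))%:E) ?lee_fin//.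
apply: eq_eseriesr => k _; rewrite indicE.
have -> : (s \in [set s : R | k%:R * tau <= s < k.+1%:R * tau]%R) = (k == trunc (s / tau)).
  apply/idP/idP; rewrite eq_sym truncn_eq// ler_pdivlMr// ltr_pdivrMr//.
    by rewrite inE.
  by move=> H; rewrite inE.
by have [->|/negPf ne] := eqVneq k (trunc (s / tau)); rewrite ?eqxx ?mulr1// ?ne mulr0.
Qed.

Lemma measurable_step_itv (a b : R) :
  measurable ([set s | a <= s < b]%R : set (measurableTypeR R)).
Proof.
rewrite (_ : [set s | _] = [set` `[a, b[]); first exact: measurable_itv.
by apply/seteqP; split=> x /=; rewrite in_itv.
Qed.

Lemma measurable_step_function (c : nat -> R) (tau t : R) : (0 < tau)%R -> (0 <= t)%R ->
  (forall k, 0 <= c k)%R ->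
  measurable_fun (`[t, +oo[ : set (measurableTypeR R)) (fun s : R => (c (trunc (s / tau)))%:E).
Proof.
move=> tau0 t0 c0.
apply: (eq_measurable_fun (fun s => \sum_(k <oo)
  (c k * \1_[set s : R | k%:R * tau <= s < k.+1%:R * tau]%R s)%:E)).
  move=> s; rewrite inE/= in_itv/= andbT => ts.
  by rewrite step_function_series// (le_trans t0).
apply: ge0_emeasurable_sum => [k s _ _|k _]; first by rewrite lee_fin mulr_ge0.
apply/measurable_EFinP; apply: measurable_funM => //.
by apply: measurable_indic; exact: measurable_step_itv.
Qed.

(** Turns the series defining the kernel into an integral over a fixed half-line, where dominated
    convergence can be used as the mesh shrinks. *)
Lemma integral_step_function (c : nat -> R) (tau : R) (K : nat) : (0 < tau)%R ->
  (forall k, 0 <= c k)%R -> (forall k, (k < K)%N -> c k = 0%R) ->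
  \int[leb1]_(s in `[(K%:R * tau)%R, +oo[) (c (trunc (s / tau)))%:E =
  \sum_(k <oo) (tau * c k)%:E.
Proof.
move=> tau0 c0 cK; have t0 : (0 <= K%:R * tau)%R by rewrite mulr_ge0// ltW.
transitivity (\int[leb1]_(s in `[(K%:R * tau)%R, +oo[)
    \sum_(k <oo) (c k * \1_[set s : R | k%:R * tau <= s < k.+1%:R * tau]%R s)%:E).
  apply: eq_integral => s; rewrite inE/= in_itv/= andbT => ts.
  by rewrite step_function_series// (le_trans t0).
rewrite integral_nneseries//=; last 2 first.
- move=> k; apply/measurable_EFinP; apply: measurable_funM => //.
  by apply: measurable_indic; exact: measurable_step_itv.
- by move=> k s _; rewrite lee_fin mulr_ge0.
apply: eq_eseriesr => k _.
have mS := measurable_step_itv (k%:R * tau) (k.+1%:R * tau).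
under eq_integral do rewrite EFinM.
rewrite ge0_integralZl ?lee_fin//=; last exact/measurable_EFinP/measurable_indic.
case: (ltnP k K) => [kK|Kk]; first by rewrite cK// mul0e mulr0.
rewrite integral_indic//= [in RHS]mulrC EFinM; congr (_ * _).
rewrite setIidl.
  rewrite (_ : [set s | _]%R = [set` `[(k%:R * tau)%R, (k.+1%:R * tau)%R[]); last first.
    by apply/seteqP; split=> x /=; rewrite in_itv.
  rewrite lebesgue_measure_itv/= lte_fin ltr_pM2r// ltr_nat ltnSn -EFinD; congr EFin.
  by rewrite -mulrBl -natr1 addrAC subrr add0r mul1r.
move=> s /=; rewrite in_itv/= andbT => /andP[ks _].
by rewrite (le_trans _ ks)// ler_pM2r// ler_nat.
Qed.

Lemma inv_pow_3_2_continuous (t : R) : (0 < t)%R ->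
  {within `[t, +oo[, continuous (fun s : R => (s * Num.sqrt s)^-1)%R}.
Proof.
move=> t0; apply: continuous_in_subspaceT => x; rewrite inE/= in_itv/= andbT => tx.
have x0 := lt_le_trans t0 tx.
apply: cvgV; first by rewrite mulf_neq0// gt_eqF// sqrtr_gt0.
by apply: cvgM; [exact: cvg_id|exact: sqrt_continuous].
Qed.

Lemma integral_inv_pow_3_2 (t : R) : (0 < t)%R ->
  \int[leb1]_(s in `[t, +oo[) ((s * Num.sqrt s)^-1)%:E = (2 / Num.sqrt t)%:E.
Proof.
move=> t0.
have dF (x : R) : (0 < x)%R -> is_derive x 1%R (fun x => - 2 * (Num.sqrt x)^-1)%R (x * Num.sqrt x)^-1%R.
  move=> x0; have sx : (Num.sqrt x != 0)%R by rewrite gt_eqF// sqrtr_gt0.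
  have := is_derive1_sqrt x0 => /(is_deriveV sx) H.
  apply: (is_derive_eq (is_deriveZ (-2)%R H)).
  have xb : (x = Num.sqrt x ^+ 2)%R by rewrite sqr_sqrtr// ltW.
  by rewrite /GRing.scale/=; move: (Num.sqrt x) sx xb => b b0 ->; field.
have cF (x : R) : (0 < x)%R -> {for x, continuous (fun x => - 2 * (Num.sqrt x)^-1)%R}.
  move=> x0; have [dv _] := dF x x0.
  exact/differentiable_continuous/derivable1_diffP.
rewrite (@ge0_continuous_FTC2y _ _ (fun x => - 2 * (Num.sqrt x)^-1)%R t 0%R).
- by rewrite sub0e -EFinN; congr EFin; rewrite mulNr opprK.
- by move=> x tx; rewrite invr_ge0 mulr_ge0 ?sqrtr_ge0// (le_trans (ltW t0)).
- exact: inv_pow_3_2_continuous.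
- rewrite -(mulr0 (-2)%R); apply: cvgM; first exact: cvg_cst.
  apply/(gtr0_cvgV0 _).2; first by near=> x; rewrite sqrtr_gt0; near: x; exact: nbhs_pinfty_gt.
  apply/cvgryPge => A; near=> x.
  rewrite (le_trans (ler_norm A))// -sqrtr_sqr; apply: ler_wsqrtr.
  by near: x; apply: nbhs_pinfty_ge; rewrite num_real.
- by move=> x tx; have [] := dF x (lt_trans t0 tx).
- by apply: cvg_at_right_filter; exact: cF.
- move=> x; rewrite in_itv/= andbT => tx.
  rewrite derive1E; exact: (@derive_val _ _ _ _ _ _ _ (dF x (lt_trans t0 tx))).
Unshelve. all: by end_near.
Qed.

End step_functions.

(** * Radial profile of the kernel and its limit *)

Section heat_profile.
Context {R : realType} (n : nat).
Notation leb1 := (@lebesgue_measure R).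
Notation trunc := Num.Def.trunc.

(* [hprof D r] is the factor of [y - x] in the gradient of the heat kernel at time
   [r] and squared distance [D]; [hphi] is the resulting factor in the kernel of
   [sqrt tau * grad B] with [tau = t / K], the first [K] terms of [B] being dropped. *)
Definition hprof (D r : R) : R := gauss_cst r ^+ n * expR (- (D / (4 * r))) / (2 * r).

Lemma hprof_ge0 D r : 0 < r -> 0 <= hprof D r.
Proof.
by move=> r0; rewrite divr_ge0 ?mulr_ge0 ?exprn_ge0 ?expR_ge0// ltW// gauss_cst_gt0.
Qed.

Lemma gauss_cst_le (t r : R) : 0 < t -> t <= r -> gauss_cst r <= gauss_cst t.
Proof.
move=> t0 tr; have r0 := lt_le_trans t0 tr.
rewrite /gauss_cst lef_pV2 ?posrE ?sqrtr_gt0 ?mulr_gt0 ?pi_gt0//.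
by rewrite ler_wsqrtr// ler_wpM2l// mulr_ge0// pi_ge0.
Qed.

Lemma gauss_cst_le_sqrtV (r : R) : 0 < r -> gauss_cst r <= (Num.sqrt r)^-1.
Proof.
move=> r0; rewrite /gauss_cst lef_pV2 ?posrE ?sqrtr_gt0 ?mulr_gt0 ?pi_gt0//.
by rewrite ler_wsqrtr// ler_peMl ?(ltW r0)//; have := pi_ge2 R; lra.
Qed.

(** With z = sqrt (D / r) this is z <= exp (z^2 / 4), and already 1 + z^2 / 4 >= z. *)
Lemma sqrt_expR_le (D r : R) : 0 <= D -> 0 < r -> Num.sqrt D * expR (- (D / (4 * r))) <= Num.sqrt r.
Proof.
move=> D0 r0; rewrite expRN -ler_pdivlMr ?invr_gt0 ?expR_gt0// invrK.
have sr : 0 < Num.sqrt r by rewrite sqrtr_gt0.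
apply: (@le_trans _ _ (Num.sqrt r * (1 + D / (4 * r)))); last first.
  by rewrite ler_pM2l// expR_ge1Dx.
rewrite -{2}(sqr_sqrtr D0) -{2}(sqr_sqrtr (ltW r0)).
set a := Num.sqrt D; set b := Num.sqrt r in sr *.
have -> : b * (1 + a ^+ 2 / (4 * b ^+ 2)) = a + (a - 2 * b) ^+ 2 / (4 * b).
  by field; rewrite gt_eqF.
by rewrite lerDl divr_ge0 ?sqr_ge0// mulr_ge0// ltW.
Qed.

(** One of the [n] Gaussian factors, at most 1 / sqrt r, pays for sqrt D exp (- D / (4 r)) <= sqrt
    r; the others are frozen at time [t]. *)
Lemma hprof_bound D r t : (0 < n)%N -> 0 <= D -> 0 < t -> t <= r ->
  Num.sqrt D * hprof D r <= gauss_cst t ^+ n.-1 / (2 * r).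
Proof.
move=> n0 D0 t0 tr; have r0 := lt_le_trans t0 tr.
have sr : 0 < Num.sqrt r by rewrite sqrtr_gt0.
have g0 := ltW (gauss_cst_gt0 r r0).
rewrite /hprof mulrA ler_wpM2r ?invr_ge0 ?mulr_ge0 ?(ltW r0)//.
rewrite mulrCA -(prednK n0) exprS [n.-1.+1.-1]/=.
apply: (@le_trans _ _ ((Num.sqrt r)^-1 * gauss_cst t ^+ n.-1 * Num.sqrt r)); last first.
  by rewrite mulrAC mulVf ?mul1r// gt_eqF.
apply: ler_pM; rewrite ?mulr_ge0 ?exprn_ge0 ?sqrtr_ge0 ?expR_ge0//; last exact: sqrt_expR_le.
apply: ler_pM; rewrite ?exprn_ge0//; first exact: gauss_cst_le_sqrtV.
by apply: lerXn2r; rewrite ?nnegrE//; [exact/ltW/gauss_cst_gt0|exact: gauss_cst_le].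
Qed.

Lemma hprof_continuous D s : 0 < s -> {for s, continuous (hprof D)}.
Proof.
move=> s0; have p0 : 0 < pi :> R := pi_gt0 R.
apply: cvgM; last first.
  by apply: cvgV; [rewrite gt_eqF// mulr_gt0|apply: cvgM => //; exact: cvg_cst].
apply: cvgM.
  apply: (@cvg_comp _ _ _ (@gauss_cst R) (fun x => x ^+ n) _ (nbhs (gauss_cst s))); last exact: exprn_continuous.
  apply: cvgV; first by rewrite gt_eqF// sqrtr_gt0 !mulr_gt0.
  apply: (@cvg_comp _ _ _ (fun x => 4 * pi * x) Num.sqrt _ (nbhs (4 * pi * s))); last exact: sqrt_continuous.
  by apply: cvgM => //; exact: cvg_cst.
apply: (@cvg_comp _ _ _ (fun x => - (D / (4 * x))) expR _ (nbhs (- (D / (4 * s))))); last exact: continuous_expR.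
apply: cvgN; apply: cvgM; first exact: cvg_cst.
by apply: cvgV; [rewrite gt_eqF// mulr_gt0|apply: cvgM => //; exact: cvg_cst].
Qed.

(** As [cb k] is [scb k] / sqrt (k + 1), these are samples of c s^(-1/2) hprof D s at mesh [tau], up
    to factors tending to constants. The index k + 1 accounts for the heat step contained in
    [heat_grad]. *)
Definition hcoef K (tau D : R) k : R :=
  cb_tail R K k * damping K ^+ k / Num.sqrt tau * hprof D (k.+1%:R * tau).

Lemma hcoef_ge0 K (tau D : R) k : (1 < K)%N -> 0 < tau -> 0 <= hcoef K tau D k.
Proof.
move=> K1 tau0; rewrite mulr_ge0 ?hprof_ge0 ?mulr_gt0 ?ltr0n//.
by rewrite divr_ge0 ?sqrtr_ge0// mulr_ge0 ?cb_tail_ge0// exprn_ge0// ltW// damping_gt0.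
Qed.

Lemma hcoefE K (tau D : R) k : (K <= k)%N -> 0 < tau ->
  hcoef K tau D k = scb k / Num.sqrt (k.+1%:R * tau) * damping K ^+ k * hprof D (k.+1%:R * tau).
Proof.
move=> Kk tau0; rewrite /hcoef /cb_tail ltnNge Kk/= /scb sqrtrM// ; congr (_ * _).
have s0 : Num.sqrt k.+1%:R != 0 :> R by rewrite gt_eqF// sqrtr_gt0.
have t0 : Num.sqrt tau != 0 :> R by rewrite gt_eqF// sqrtr_gt0.
by field; rewrite s0 t0.
Qed.

Lemma hcoef_bound K (t D s : R) : (0 < n)%N -> (1 < K)%N -> 0 < t -> 0 <= D -> t <= s ->
  Num.sqrt D * hcoef K (t / K%:R) D (trunc (s / (t / K%:R))) <=
  gauss_cst t ^+ n.-1 * (s * Num.sqrt s)^-1.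
Proof.
move=> n0 K1 t0 D0 ts; have s0 := lt_le_trans t0 ts.
have k0 : 0 < K%:R :> R by rewrite ltr0n ltnW.
set tau := t / K%:R; have tau0 : 0 < tau by rewrite divr_gt0.
set k := trunc _.
have g0 : 0 <= gauss_cst t ^+ n.-1 by rewrite exprn_ge0// ltW// gauss_cst_gt0.
have Kk : (K <= k)%N.
  have st0 : 0 <= s / tau by rewrite divr_ge0// ltW.
  rewrite truncn_ge_nat// ler_pdivlMr//.
  by rewrite /tau mulrCA divff ?mulr1// gt_eqF.
set r := k.+1%:R * tau.
have sr : s <= r by rewrite -ler_pdivrMr// ltW// truncnS_gt.
have r0 := lt_le_trans s0 sr.
rewrite hcoefE// mulrCA -/r; clearbody r.
have q1 : damping K <= 1 :> R := ltW (damping_lt1 _ (ltnW K1)).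
have q0 : 0 <= damping K :> R := ltW (damping_gt0 _ K1).
apply: (@le_trans _ _ ((Num.sqrt r)^-1 * (gauss_cst t ^+ n.-1 / (2 * r)))).
  apply: ler_pM.
  - by rewrite mulr_ge0 ?exprn_ge0// divr_ge0 ?scb_ge0 ?sqrtr_ge0.
  - by rewrite mulr_ge0 ?sqrtr_ge0// hprof_ge0.
  - rewrite mulrAC ler_piMl ?invr_ge0 ?sqrtr_ge0//.
    by rewrite mulr_ile1 ?scb_ge0 ?scb_le1 ?exprn_ge0 ?exprn_ile1.
  - by apply: hprof_bound => //; exact: le_trans ts sr.
rewrite mulrCA ler_wpM2l// -invfM lef_pV2 ?posrE ?mulr_gt0 ?sqrtr_gt0//.
rewrite mulrC; apply: ler_pM; rewrite ?sqrtr_ge0 ?(ltW s0) ?ler_wsqrtr//.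
by rewrite (le_trans sr)// ler_peMl ?(ltW r0)//; lra.
Qed.

Lemma cvg_over_SS (a : R) : a / K.+2%:R @[K --> \oo] --> (0 : R).
Proof.
rewrite -(mulr0 a); apply: cvgM; first exact: cvg_cst.
by have := @cvg_harmonic R; rewrite -cvg_shiftS.
Qed.

(** The index containing s is of order K s / t, so the damping is at least 1 - (s / t) / K, and the
    sampling time lies between s and s + tau. *)
Lemma hcoef_cvg (t D s c : R) : 0 < t -> t <= s -> scb k @[k --> \oo] --> c ->
  hcoef K.+2 (t / K.+2%:R) D (trunc (s / (t / K.+2%:R))) @[K --> \oo] -->
  c / Num.sqrt s * hprof D s.
Proof.
move=> t0 ts cc; have s0 := lt_le_trans t0 ts.
pose tau K : R := t / K.+2%:R; have tau0 K : 0 < tau K by rewrite divr_gt0.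
pose k K := trunc (s / tau K).
have st0 K : 0 <= s / tau K by rewrite divr_ge0// ltW.
have kK K : (K.+2 <= k K)%N.
  by rewrite truncn_ge_nat// ler_pdivlMr// /tau mulrC divfK.
pose r K := (k K).+1%:R * tau K.
have sr K : s <= r K by rewrite -ler_pdivrMr// ltW// truncnS_gt.
have rs K : r K <= s + tau K.
  rewrite /r -natr1 mulrDl mul1r lerD2r -ler_pdivlMr//.
  by have /andP[] := truncn_itv (st0 K).
have r_s : r K @[K --> \oo] --> s.
  apply: (@squeeze_cvgr _ _ _ _ (fun=> s) (fun K => s + tau K)).
  - by near=> K; rewrite sr rs.
  - exact: cvg_cst.
  - by rewrite -[X in _ --> X]addr0; apply: cvgD; [exact: cvg_cst|exact: cvg_over_SS].
have q_1 : damping K.+2 ^+ k K @[K --> \oo] --> (1 : R).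
  apply: (@squeeze_cvgr _ _ _ _ (fun K => 1 - (s / t) / K.+2%:R) (fun=> 1)).
  - near=> K; apply/andP; split; last first.
      by rewrite exprn_ile1// ltW// ?damping_lt1 ?damping_gt0.
    apply: le_trans (damping_exp_ge _ _ _) => //.
    rewrite lerD2l lerN2 ler_pdivrMr ?exprn_gt0//.
    have -> : s / t / K.+2%:R * K.+2%:R ^+ 2 = s / tau K.
      by rewrite /tau; field; rewrite ?pnatr_eq0 ?lt0r_neq0.
    by have /andP[] := truncn_itv (st0 K).
  - by rewrite -[X in _ --> X](subr0 1); apply: cvgB; [exact: cvg_cst|exact: cvg_over_SS].
  - exact: cvg_cst.
have k_y : k K @[K --> \oo] --> \oo.
  apply/cvgnyPge => A; near=> K; apply: leq_trans (kK K).
  by rewrite !leqW//; near: K; exact: nbhs_infty_ge.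
have scb_c : scb (k K) @[K --> \oo] --> c by apply: cvg_comp k_y cc.
have -> : (fun K => hcoef K.+2 (t / K.+2%:R) D (trunc (s / (t / K.+2%:R)))) =
   (fun K => scb (k K) / Num.sqrt (r K) * damping K.+2 ^+ k K * hprof D (r K)).
  by apply/funext => K; rewrite (hcoefE _ _ _ _ (kK K) (tau0 K)).
rewrite -[c / _]mulr1; apply: cvgM; last first.
  by apply: cvg_comp r_s _; exact: hprof_continuous.
apply: cvgM => //; apply: cvgM => //; apply: cvgV; first by rewrite gt_eqF// sqrtr_gt0.
by apply: cvg_comp r_s _; exact: sqrt_continuous.
Unshelve. all: by end_near.
Qed.

Definition hphi K (t D : R) : \bar R :=
  \sum_(k <oo) (t / K%:R * hcoef K (t / K%:R) D k)%:E.

Local Open Scope ereal_scope.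

Lemma hphiE K (t D : R) : (1 < K)%N -> (0 < t)%R ->
  hphi K t D =
  \int[leb1]_(s in `[t, +oo[) (hcoef K (t / K%:R) D (trunc (s / (t / K%:R))))%:E.
Proof.
move=> K1 t0; have k0 : (0 < K%:R :> R)%R by rewrite ltr0n ltnW.
have tau0 : (0 < t / K%:R)%R by rewrite divr_gt0.
have tE : (K%:R * (t / K%:R) = t)%R by rewrite mulrC divfK// gt_eqF.
have := integral_step_function (hcoef K (t / K%:R) D) _ K tau0.
rewrite tE => -> // k; first exact: hcoef_ge0.
by move=> kK; rewrite /hcoef /cb_tail kK !mul0r.
Qed.

Lemma hphi_bound K (t D : R) : (0 < n)%N -> (1 < K)%N -> (0 < t)%R -> (0 <= D)%R ->
  (Num.sqrt D)%:E * hphi K t D <= (gauss_cst t ^+ n.-1 * (2 / Num.sqrt t))%:E.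
Proof.
move=> n0 K1 t0 D0; have k0 : (0 < K%:R :> R)%R by rewrite ltr0n ltnW.
have tau0 : (0 < t / K%:R)%R by rewrite divr_gt0.
have c0 k : (0 <= hcoef K (t / K%:R) D k)%R by exact: hcoef_ge0.
have g0 : (0 <= gauss_cst t ^+ n.-1)%R by rewrite exprn_ge0// ltW// gauss_cst_gt0.
have mst := measurable_step_function _ _ t tau0 (ltW t0) c0.
have mG : measurable_fun (`[t, +oo[ : set (measurableTypeR R)) (fun s : R => ((s * Num.sqrt s)^-1)%:E).
  apply/measurable_EFinP; apply: subspace_continuous_measurable_fun => //.
  exact: inv_pow_3_2_continuous.
rewrite hphiE// -ge0_integralZl//=.
rewrite EFinM -integral_inv_pow_3_2// -ge0_integralZl//=; last first.
  move=> s; rewrite in_itv/= andbT => ts; have s0 := lt_le_trans t0 ts.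
  by rewrite lee_fin invr_ge0 mulr_ge0 ?sqrtr_ge0// ltW.
apply: ge0_le_integral => //.
- by move=> s _; rewrite -EFinM lee_fin mulr_ge0 ?sqrtr_ge0.
- exact: emeasurable_funM.
- exact: emeasurable_funM.
- move=> s; rewrite /= in_itv/= andbT => ts.
  by rewrite -!EFinM lee_fin hcoef_bound.
by move=> s _; rewrite lee_fin.
Qed.

(** Dominated by a multiple of s^(-3/2) / sqrt D, whence D > 0; at D = 0 the coordinate difference
    will annihilate the kernel. *)
Lemma hphi_cvg (t D c : R) : (0 < n)%N -> (0 < t)%R -> (0 < D)%R ->
  scb k @[k --> \oo] --> c ->
  hphi K.+2 t D @[K --> \oo] -->
  \int[leb1]_(s in `[t, +oo[) (c / Num.sqrt s * hprof D s)%:E.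
Proof.
move=> n0 t0 D0 cc.
under eq_fun do rewrite hphiE//.
have sD : (0 < Num.sqrt D)%R by rewrite sqrtr_gt0.
apply: (@dominated_cvg _ _ _ leb1 `[t, +oo[%classic _ _ _
  (fun s => (gauss_cst t ^+ n.-1 * (s * Num.sqrt s)^-1 / Num.sqrt D)%:E)) => //.
- move=> K; apply: measurable_step_function; rewrite ?divr_gt0 ?(ltW t0)// => k.
  by apply: hcoef_ge0 => //; rewrite divr_gt0.
- move=> s; rewrite /= in_itv/= andbT => ts.
  by apply: cvg_EFin; [exact: nearW|exact: hcoef_cvg].
- apply/integrableP; split.
    apply/measurable_EFinP; apply: measurable_funM => //; apply: measurable_funM => //.
    apply: subspace_continuous_measurable_fun => //.
    exact: inv_pow_3_2_continuous.
  have g0 : (0 <= gauss_cst t ^+ n.-1 / Num.sqrt D)%R.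
    by rewrite divr_ge0 ?sqrtr_ge0// exprn_ge0// ltW// gauss_cst_gt0.
  apply: (@le_lt_trans _ _ ((gauss_cst t ^+ n.-1 / Num.sqrt D)%:E *
      \int[leb1]_(s in `[t, +oo[) ((s * Num.sqrt s)^-1)%:E)); last first.
    by rewrite integral_inv_pow_3_2// -EFinM ltry.
  rewrite -ge0_integralZl ?lee_fin//=; last 2 first.
  - apply/measurable_EFinP; apply: subspace_continuous_measurable_fun => //.
    exact: inv_pow_3_2_continuous.
  - move=> s; rewrite in_itv/= andbT => ts; have s0 := lt_le_trans t0 ts.
    by rewrite lee_fin invr_ge0 mulr_ge0 ?sqrtr_ge0// ltW.
  rewrite le_eqVlt; apply/orP; left; apply/eqP; apply: eq_integral => s.
  rewrite inE/= in_itv/= andbT => ts; have s0 := lt_le_trans t0 ts.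
  rewrite mulrAC -EFinM ger0_norm// mulr_ge0// invr_ge0 mulr_ge0 ?sqrtr_ge0//; exact: ltW.
- move=> K s; rewrite /= in_itv/= andbT => ts.
  rewrite lee_fin ger0_norm ?hcoef_ge0 ?divr_gt0// ler_pdivlMr// mulrC.
  by apply: hcoef_bound => //; exact: ltW.
Qed.

(** Unnormalized Gamma density of shape (n + 1) / 2, written with a square root to keep integer
    exponents. *)
Definition gamma_dens (u : R) : R := Num.sqrt u ^+ n.-1 * expR (- u).

Let F D (s : R) := (D / (4 * s))%R.

Let dF D (s : R) : (0 < s)%R -> is_derive s 1%R (F D) (- (D / (4 * s ^+ 2)))%R.
Proof.
move=> s0.
have H : is_derive s 1%R (fun s : R => (4 * s))%R 4%R.
  apply: (is_derive_eq (is_deriveZ 4%R (is_derive_id s 1%R))).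
  by rewrite /GRing.scale/= mulr1.
have f0 : (4 * s != 0)%R by rewrite gt_eqF// mulr_gt0.
apply: (is_derive_eq (is_deriveZ D (is_deriveV f0 H))).
by rewrite /GRing.scale/=; field; rewrite gt_eqF.
Qed.

Let F_continuous D (s : R) : (0 < s)%R -> {for s, continuous (F D)}.
Proof.
move=> s0; have [dv _] := dF D s s0.
exact/differentiable_continuous/derivable1_diffP.
Qed.

Let slope_continuous D (s : R) : (0 < s)%R -> {for s, continuous (fun s : R => D / (4 * s ^+ 2))%R}.
Proof.
move=> s0; apply: cvgM; first exact: cvg_cst.
apply: cvgV; first by rewrite gt_eqF// mulr_gt0// exprn_gt0.
by apply: cvgM; [exact: cvg_cst|exact: exprn_continuous].
Qed.

Let F'_continuous D (s : R) : (0 < s)%R -> {for s, continuous (fun s : R => - (D / (4 * s ^+ 2)))%R}.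
Proof. by move=> s0; apply: cvgN; exact: slope_continuous. Qed.

Lemma gamma_dens_continuous : continuous gamma_dens.
Proof.
move=> x; apply: cvgM.
  apply: (@cvg_comp _ _ _ Num.sqrt (fun x : R => x ^+ n.-1)%R _ (nbhs (Num.sqrt x))); last exact: exprn_continuous.
  exact: sqrt_continuous.
apply: (@cvg_comp _ _ _ (fun u : R => - u)%R expR _ (nbhs (- x)%R)); last exact: continuous_expR.
by apply: cvgN.
Qed.

Lemma gamma_dens_ge0 u : (0 <= gamma_dens u)%R.
Proof. by rewrite mulr_ge0 ?expR_ge0// exprn_ge0// sqrtr_ge0. Qed.

Lemma gamma_dens_hprof D s : (0 < n)%N -> (0 < D)%R -> (0 < s)%R ->
  (hprof D s / Num.sqrt s =
   (Num.sqrt pi ^+ n * Num.sqrt D ^+ n.+1)^-1 * (gamma_dens (F D s) * (D / (4 * s ^+ 2))))%R.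
Proof.
move=> n0 D0 s0; rewrite /hprof /gauss_cst /gamma_dens /F.
have p0 : (0 < pi :> R)%R := pi_gt0 R.
rewrite sqrtrM ?mulr_ge0 ?(ltW p0)// sqrtrM// (_ : 4 = 2 ^+ 2)%R ?sqrtr_sqr; last by ring.
rewrite sqrtrM ?(ltW D0)// sqrtrV ?mulr_ge0 ?exprn_ge0 ?(ltW s0)// sqrtrM ?exprn_ge0// sqrtr_sqr.
rewrite ger0_norm//.
have D2 : (D = Num.sqrt D ^+ 2)%R by rewrite sqr_sqrtr// ltW.
have s2 : (s = Num.sqrt s ^+ 2)%R by rewrite sqr_sqrtr// ltW.
have ne (x : R) : (0 < x)%R -> (Num.sqrt x != 0)%R by move=> x0; rewrite gt_eqF// sqrtr_gt0.
have nD := ne _ D0; have ns := ne _ s0; have np := ne _ p0.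
move: (expR _) => e.
rewrite -(prednK n0) [n.-1.+1.-1]/=; move: n.-1 => m.
have -> : (D / (2 ^+ 2 * s ^+ 2) = Num.sqrt D ^+ 2 / (2 ^+ 2 * Num.sqrt s ^+ 4))%R.
  by rewrite {1}D2 {1}s2 -exprM.
have -> : (2 * s = 2 * Num.sqrt s ^+ 2)%R by rewrite {1}s2.
move: (Num.sqrt D) (Num.sqrt s) (Num.sqrt pi) nD ns np => x y z x0 y0 z0.
rewrite !expr_div_n !exprVn !exprMn !exprS.
have nm (u : R) : (u != 0)%R -> (u ^+ m != 0)%R by move=> u0; rewrite expf_neq0.
have := nm _ x0; have := nm _ y0; have := nm _ z0; have := nm 2%R (lt0r_neq0 (ltr0n R 2)).
move: (x ^+ m)%R (y ^+ m)%R (z ^+ m)%R (2 ^+ m)%R => a b c d d0 c0 b0 a0.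
field; do !(apply/andP; split) => //.
Qed.

Let integral_hprof_segment D (t T : R) : (0 < n)%N -> (0 < D)%R -> (0 < t)%R -> (t < T)%R ->
  \int[leb1]_(s in `[t, T]) (hprof D s / Num.sqrt s)%:E =
  ((Num.sqrt pi ^+ n * Num.sqrt D ^+ n.+1)^-1)%:E *
    \int[leb1]_(u in `[(D / (4 * T))%R, (D / (4 * t))%R]) (gamma_dens u)%:E.
Proof.
move=> n0 D0 t0 tT; have T0 := lt_trans t0 tT.
have s0 s : (t <= s)%R -> (0 < s)%R by exact: lt_le_trans.
have F' (s : R) : (0 < s)%R -> (F D)^`()%classic s = (- (D / (4 * s ^+ 2)))%R.
  by move=> sp; rewrite derive1E; exact: (@derive_val _ _ _ _ _ _ _ (dF D s sp)).
have cF' (s : R) : (0 < s)%R -> (F D)^`()%classic x @[x --> s] --> (- (D / (4 * s ^+ 2)))%R.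
  move=> sp; apply: cvg_trans (F'_continuous D s sp).
  apply: near_eq_cvg; near=> x; rewrite F'//; near: x.
  exact: (lt_nbhsr sp).
rewrite -[(D / (4 * T))%R]/(F D T) -[(D / (4 * t))%R]/(F D t).
have gE (s : R) : (0 < s)%R -> (((gamma_dens \o F D) * - (F D)^`()%classic) s =
    gamma_dens (F D s) * (D / (4 * s ^+ 2)))%R.
  move=> sp; transitivity (gamma_dens (F D s) * - ((F D)^`()%classic s))%R => //.
  by rewrite F'// opprK.
rewrite (integration_by_substitution_decreasing (ltW tT)) => //.
- rewrite -ge0_integralZl//=.
  + apply: eq_integral => s; rewrite inE/= in_itv/= => /andP[ts _].
    by have sp := s0 s ts; rewrite gE// gamma_dens_hprof.
  + apply/measurable_EFinP.
    apply: (eq_measurable_fun (fun s => gamma_dens (F D s) * (D / (4 * s ^+ 2)))%R).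
      by move=> s; rewrite inE/= in_itv/= => /andP[ts _]; rewrite gE ?s0.
    apply: subspace_continuous_measurable_fun => //.
    apply: continuous_in_subspaceT => x; rewrite inE/= in_itv/= => /andP[tx _].
    apply: cvgM.
      apply: (@cvg_comp _ _ _ (F D) gamma_dens _ (nbhs (F D x))); last exact: gamma_dens_continuous.
      by apply: F_continuous; exact: s0.
    by apply: slope_continuous; exact: s0.
  + move=> s; rewrite in_itv/= => /andP[ts _]; have sp := s0 s ts.
    by rewrite gE// lee_fin mulr_ge0 ?gamma_dens_ge0// divr_ge0 ?(ltW D0)// mulr_ge0// exprn_ge0// ltW.
- move=> x y; rewrite !in_itv/= => /andP[tx _] /andP[ty _] xy.
  have xp := s0 x tx; have yp := s0 y ty.
  have x4 : (4 * x \is Num.pos)%R by rewrite posrE mulr_gt0.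
  have y4 : (4 * y \is Num.pos)%R by rewrite posrE mulr_gt0.
  by rewrite /F (ltr_pM2l D0) (ltf_pV2 x4 y4) ltr_pM2l.
- move=> x; rewrite in_itv/= => /andP[tx _]; rewrite /continuous_at F' ?s0 ?ltW//.
  by apply: cF'; rewrite s0 ?ltW.
- by apply/cvg_ex; eexists; apply: cvg_at_right_filter; exact: cF'.
- by apply/cvg_ex; eexists; apply: cvg_at_left_filter; exact: cF'.
- split.
  + by move=> x; rewrite in_itv/= => /andP[tx _]; have [] := dF D x (s0 x (ltW tx)).
  + by apply: cvg_at_right_filter; exact: F_continuous.
  + by apply: cvg_at_left_filter; exact: F_continuous.
- by apply: continuous_subspaceT; exact: gamma_dens_continuous.
Unshelve. all: by end_near.
Qed.

(** The substitution u = D / (4 s) is made on compact segments, and monotone limits are taken on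
    both sides. *)
Lemma integral_hprof D (t : R) : (0 < n)%N -> (0 < D)%R -> (0 < t)%R ->
  \int[leb1]_(s in `[t, +oo[) (hprof D s / Num.sqrt s)%:E =
  ((Num.sqrt pi ^+ n * Num.sqrt D ^+ n.+1)^-1)%:E *
    \int[leb1]_(u in `]0%R, (D / (4 * t))%R]) (gamma_dens u)%:E.
Proof.
move=> n0 D0 t0.
pose A i := `[t, (t + i.+1%:R)%R]%classic : set R.
pose B i := `[(D / (4 * (t + i.+1%:R)))%R, (D / (4 * t))%R]%classic : set R.
have tS i : (t < t + i.+1%:R)%R by rewrite ltrDl.
have tS0 i : (0 < t + i.+1%:R)%R by exact: lt_trans (tS i).
have ndA : nondecreasing_seq A.
  apply/nondecreasing_seqP => i; apply/subsetPset => x; rewrite /A/= !in_itv/= => /andP[-> xi]/=.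
  by rewrite (le_trans xi)// lerD2l ler_nat.
have ndB : nondecreasing_seq B.
  apply/nondecreasing_seqP => i; apply/subsetPset => x; rewrite /B/= !in_itv/= => /andP[xi ->]; rewrite andbT.
  apply: le_trans xi; rewrite ler_pM2l// lef_pV2 ?posrE ?mulr_gt0// ler_pM2l// lerD2l ler_nat//.
have AU : \bigcup_i A i = `[t, +oo[%classic.
  apply/seteqP; split=> [x [i _]|x]; rewrite /A/= !in_itv/= => /andP[tx]; first by rewrite tx.
  move=> _; exists (trunc (x - t)) => //; rewrite /A/= in_itv/= tx/= -lerBlDl ltW// truncnS_gt//.
have BU : \bigcup_i B i = `]0%R, (D / (4 * t))%R]%classic.
  apply/seteqP; split=> [x [i _]|x]; rewrite /B/= !in_itv/= => /andP[xi xt]; rewrite ?xt ?andbT.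
    by rewrite (lt_le_trans _ xi)// divr_gt0// mulr_gt0.
  exists (trunc (D / (4 * x))) => //; rewrite /B/= in_itv/= xt andbT.
  rewrite ler_pdivrMr ?mulr_gt0//.
  have := truncnS_gt (D / (4 * x)); rewrite ltr_pdivrMr ?mulr_gt0//.
  have := mulr_gt0 xi t0; lra.
have c0 : (0 <= (Num.sqrt pi ^+ n * Num.sqrt D ^+ n.+1)^-1 :> R)%R.
  by rewrite invr_ge0 mulr_ge0// exprn_ge0// sqrtr_ge0.
have cA : \int[leb1]_(s in A i) (hprof D s / Num.sqrt s)%:E @[i --> \oo] -->
    \int[leb1]_(s in `[t, +oo[) (hprof D s / Num.sqrt s)%:E.
  rewrite -AU; apply: ge0_nondecreasing_set_cvg_integral => //.
  - by move=> i; exact: measurable_itv.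
  - move=> i; apply/measurable_EFinP; apply: subspace_continuous_measurable_fun => //.
      exact: measurable_itv.
    apply: (@continuous_in_subspaceT _ _ (A i)) => x; rewrite inE /A/= in_itv/= => /andP[tx _].
    have x0 := lt_le_trans t0 tx.
    apply: cvgM; first exact: hprof_continuous.
    by apply: cvgV; [rewrite gt_eqF// sqrtr_gt0|exact: sqrt_continuous].
  - move=> i x; rewrite /A/= in_itv/= => /andP[tx _]; have x0 := lt_le_trans t0 tx.
    by rewrite lee_fin divr_ge0 ?hprof_ge0// sqrtr_ge0.
have cB : \int[leb1]_(s in B i) (gamma_dens s)%:E @[i --> \oo] -->
    \int[leb1]_(s in `]0%R, (D / (4 * t))%R]) (gamma_dens s)%:E.
  rewrite -BU; apply: ge0_nondecreasing_set_cvg_integral => //.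
  - by move=> i; exact: measurable_itv.
  - move=> i; apply/measurable_EFinP; apply: measurable_funTS.
    by apply: continuous_measurable_fun; exact: gamma_dens_continuous.
  - by move=> i x _; rewrite lee_fin gamma_dens_ge0.
have yf : ((Num.sqrt pi ^+ n * Num.sqrt D ^+ n.+1)^-1)%:E \is a @fin_num R by [].
have := cvgeZl yf cB.
under eq_fun do rewrite -integral_hprof_segment//.
exact: (cvg_unique _ cA).
Qed.

End heat_profile.

Section signed_integrals.
Context d (T : measurableType d) (R : realType) (mu : {measure set T -> \bar R}).
Local Open Scope ereal_scope.

(** Encodes a finite signed integral by two nonnegative ones, so that identities proved by Tonelli
    can be read back as signed ones. *)
Lemma integral_max0 (g : T -> R) (r : R) : \int[mu]_z (g z)%:E = r%:E ->
  exists2 a : R, \int[mu]_z (Num.max (- g z) 0)%:E = a%:E &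
    \int[mu]_z (Num.max (g z) 0)%:E = (a + r)%:E.
Proof.
have gp : (fun z => (g z)%:E)^\+ = (fun z => (Num.max (g z) 0)%:E).
  by apply/funext => z; rewrite unlock -EFin_max.
have gn : (fun z => (g z)%:E)^\- = (fun z => (Num.max (- g z) 0)%:E).
  by apply/funext => z; rewrite unlock -EFinN -EFin_max.
rewrite integralE gp gn.
have : 0 <= \int[mu]_z (Num.max (g z) 0)%:E.
  by apply: integral_ge0 => z _; rewrite lee_fin le_max lexx orbT.
have : 0 <= \int[mu]_z (Num.max (- g z) 0)%:E.
  by apply: integral_ge0 => z _; rewrite lee_fin le_max lexx orbT.
case: (\int[mu]_z (Num.max (g z) 0)%:E) => [a| |]//; case: (\int[mu]_z (Num.max (- g z) 0)%:E) => [b| |]// _ _.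
by rewrite -EFinB => -[<-]; exists b; rewrite // addrC subrK.
Qed.

Lemma Rintegral_max0 (g : T -> R) : mu.-integrable setT (EFin \o g) ->
  exists2 a : R, \int[mu]_z (Num.max (- g z) 0)%:E = a%:E &
    \int[mu]_z (Num.max (g z) 0)%:E = (a + (\int[mu]_z g z)%R)%:E.
Proof.
by move=> ig; apply: integral_max0; rewrite fineK//; exact: (integrable_fin_num _ ig).
Qed.

End signed_integrals.

Section gradient_kernel.
Context {R : realType} (n : nat).
Notation E := (euclid R n).
Notation mu := (@leb R n).
Context (tau : R) (tau0 : (0 < tau)%R).
Notation h := (hk n tau).
Local Open Scope ereal_scope.

Let ktau0 k : (0 < k.+1%:R * tau)%R. Proof. by rewrite mulr_gt0// ltr0n. Qed.

Lemma nnm_weight_hk (P : E -> \bar R) k : nnm P ->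
  nnm (fun y => \int[mu]_z (P z * (hk n (k.+1%:R * tau) z y)%:E)).
Proof.
move=> nP; have Ph0 z y : 0 <= P z * (hk n (k.+1%:R * tau) z y)%:E.
  by rewrite mule_ge0 ?nP.2// lee_fin ltW// hk_gt0.
split; last by move=> y; apply: integral_ge0 => z _; exact: Ph0.
apply: (measurable_fun_fubini_tonelli_G (m1 := mu) (fun zy : E * E => P zy.1 * (hk n (k.+1%:R * tau) zy.1 zy.2)%:E)) => //.
apply: emeasurable_funM; first exact: (measurableT_comp nP.1).
by apply/measurable_EFinP; exact: measurable_hk.
Qed.

(** The condition bt 0 = 0 removes the identity operator, the only power of H without a density. *)
Lemma integral_weight_Sop (bt : nat -> R) (P f : E -> \bar R) : nnm P -> nnm f ->
  (forall k, 0 <= bt k)%R -> bt 0%N = 0%R ->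
  \int[mu]_z (P z * Sop mu h bt f z) =
  \int[mu]_y ((\sum_(k <oo) (bt k)%:E * \int[mu]_z (P z * (hk n (k%:R * tau) z y)%:E)) * f y).
Proof.
move=> nP nf b0 b00.
have h0 x y : (0 <= h x y)%R by rewrite ltW// hk_gt0.
have mh := measurable_hk n tau (R := R).
have nk k : nnm (fun z : E => P z * iter k (Hop mu h) f z).
  by apply: nnmM => //; exact: nnm_iter_Hop.
pose A k y := \int[mu]_z (P z * (hk n (k%:R * tau) z y)%:E).
have mPh k : measurable_fun setT (fun zy : E * E => P zy.1 * (hk n (k.+1%:R * tau) zy.1 zy.2)%:E).
  apply: emeasurable_funM; first exact: (measurableT_comp nP.1).
  by apply/measurable_EFinP; exact: measurable_hk.
have Ph0 k z y : 0 <= P z * (hk n (k.+1%:R * tau) z y)%:E.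
  by rewrite mule_ge0 ?nP.2// lee_fin ltW// hk_gt0.
have nA k : nnm (A k.+1) by exact: nnm_weight_hk.
have AE k : \int[mu]_z (P z * iter k.+1 (Hop mu h) f z) = \int[mu]_y (A k.+1 y * f y).
  transitivity (\int[mu]_z \int[mu]_y (P z * (hk n (k.+1%:R * tau) z y)%:E * f y)).
    apply: eq_integral => z _; rewrite iter_Hop_hk// -ge0_integralZl ?nP.2//.
    - by apply: eq_integral => y _; rewrite muleA.
    - apply: emeasurable_funM; last exact: nf.1.
      by apply/measurable_EFinP; exact: measurable_hkr.
    - by move=> y _; rewrite mule_ge0 ?nf.2// lee_fin ltW// hk_gt0.
  rewrite (fubini_tonelli (fun zy : E * E => P zy.1 * (hk n (k.+1%:R * tau) zy.1 zy.2)%:E * f zy.2))/=; last 2 first.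
  - by apply: emeasurable_funM => //; exact: (measurableT_comp nf.1).
  - by move=> [z y]; rewrite mule_ge0 ?nf.2//; exact: Ph0.
  apply: eq_integral => y _; rewrite /A -ge0_integralZr ?nf.2//.
  - apply: emeasurable_funM; first exact: nP.1.
    exact: (nnm_hkl n _ _ (ktau0 k)).1.
have nbA k : nnm (fun y => (bt k)%:E * A k y * f y).
  case: k => [|k]; last by apply: nnmM => //; exact: nnmZ.
  by rewrite b00; under eq_fun do rewrite mul0e mul0e; split.
under [RHS]eq_integral => y _.
  rewrite muleC -nneseriesMl ?nf.2//; last first.
    move=> [|k]; first by rewrite b00 mul0e.
    by rewrite mule_ge0 ?lee_fin//; exact: (nA k).2.
  under eq_eseriesr do rewrite muleC.
  over.
rewrite integral_nneseries//; [|by move=> k; exact: (nbA k).1|by move=> k y _; exact: (nbA k).2].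
under [LHS]eq_integral => z _.
  rewrite /Sop -nneseriesMl ?nP.2//; last first.
    by move=> k; rewrite mule_ge0 ?lee_fin//; exact: (nnm_iter_Hop _ _ _ mu _ h0 mh k _ nf).2.
  under eq_eseriesr do rewrite muleCA.
  over.
rewrite integral_nneseries//; [|by move=> k; exact: (nnmZ (b0 k) (nk k)).1
  |by move=> k y _; exact: (nnmZ (b0 k) (nk k)).2].
apply: eq_eseriesr => k _; rewrite (integralZ_nnm mu (nk k) (b0 k)).
case: k => [|k].
  by rewrite b00 mul0e; under eq_integral do rewrite !mul0e; rewrite integral0.
under eq_integral do rewrite -muleA.
by rewrite (integralZ_nnm mu (nnmM (nA k) nf) (b0 _)) AE.
Qed.

Context (x : E) (j : 'I_n).
Let p (y : E) : R := Num.max (tnth y j - tnth x j)%R 0%R.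
Let m (y : E) : R := Num.max (- (tnth y j - tnth x j))%R 0%R.

Let maxM (a b : R) : (0 <= a)%R -> (Num.max (a * b) 0 = a * Num.max b 0)%R.
Proof. by move=> a0; rewrite maxr_pMr// mulr0. Qed.

(* The semigroup law for the gradient kernel, split into positive and negative
   parts so that Tonelli's theorem applies. *)
Lemma integral_posneg_hk k y :
  \int[mu]_z ((h x z * p z)%:E * (hk n (k.+1%:R * tau) z y)%:E) +
    (m y * hk n (k.+2%:R * tau) x y / k.+2%:R)%:E =
  \int[mu]_z ((h x z * m z)%:E * (hk n (k.+1%:R * tau) z y)%:E) +
    (p y * hk n (k.+2%:R * tau) x y / k.+2%:R)%:E.
Proof.
have tt : (tau + k.+1%:R * tau = k.+2%:R * tau)%R by rewrite -[k.+2]addn1 natrD mulrDl mul1r addrC.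
have := hk_grad_semigroup n tau (k.+1%:R * tau)%R x y j tau0 (ktau0 k).
rewrite tt => /integral_max0[a].
have h0 z : (0 <= h x z * hk n (k.+1%:R * tau) z y)%R by rewrite mulr_ge0// ltW// hk_gt0.
under eq_integral do rewrite mulrAC -mulrN maxM// mulrAC EFinM.
move=> Im; under eq_integral do rewrite mulrAC maxM// mulrAC EFinM.
move=> Ip; rewrite Ip Im -!EFinD; congr EFin; rewrite -addrA; congr +%R.
have -> : (tau / (k.+2%:R * tau) = k.+2%:R^-1)%R.
  by rewrite invfM mulrCA divff ?mulr1// gt_eqF.
have -> : (tnth y j - tnth x j = p y - m y)%R.
  rewrite /p /m; set w := (_ - _)%R; case: (leP 0%R w) => w0.
    by rewrite [in X in (_ - X)%R]max_r ?subr0 ?oppr_le0// max_l.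
  by rewrite max_l ?sub0r ?opprK// oppr_ge0 ltW.
by rewrite mulrC; ring.
Qed.

Lemma heat_grad_Sop (K : nat) (t q : R) (f : E -> R) (v : E -> R) : (0 < n)%N -> (1 < K)%N ->
  tau = (t / K%:R)%R -> (0 < t)%R -> q = damping K ->
  mu.-integrable setT (EFin \o f) -> (forall y, 0 <= f y)%R ->
  bounded_measurable n v ->
  (forall z, (v z)%:E = Sop mu h (fun k => cb_tail R K k * q ^+ k)%R (EFin \o f) z) ->
  (Num.sqrt tau * heat_grad n tau j v x =
    \int[mu]_y ((tnth y j - tnth x j) * fine (hphi n K t (dsq n x y)) * f y))%R.
Proof.
move=> n0 K1 tauE t0 qE intf f0 bv vE.
have K0 : (0 < K)%N by exact: ltnW.
have nf : nnm (EFin \o f).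
  by split=> [|y]; [case/integrableP: intf|rewrite lee_fin].
have h0 z : (0 <= h x z)%R by rewrite ltW// hk_gt0.
have p0 y : (0 <= p y)%R by rewrite /p le_max lexx orbT.
have m0 y : (0 <= m y)%R by rewrite /m le_max lexx orbT.
have mw : measurable_fun setT (fun y : E => tnth y j - tnth x j)%R by exact: measurable_coord_diff.
have mp : measurable_fun setT p by exact: measurable_maxr.
have mm : measurable_fun setT m.
  by apply: measurable_maxr => //; exact: measurable_funN.
have nh (w : E -> R) : measurable_fun setT w -> (forall y, 0 <= w y)%R ->
    nnm (fun z => (h x z * w z)%:E).
  move=> mw' w0; split=> [|z]; last by rewrite lee_fin mulr_ge0.
  by apply/measurable_EFinP; apply: measurable_funM => //; exact: measurable_hkr.
have nhp := nh _ mp p0; have nhm := nh _ mm m0.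
pose b k := (cb_tail R K k * q ^+ k)%R.
have q0 : (0 < q)%R by rewrite qE damping_gt0.
have q1 : (q < 1)%R by rewrite qE damping_lt1.
have b0 k : (0 <= b k)%R by rewrite mulr_ge0 ?cb_tail_ge0// exprn_ge0// ltW.
have b00 : b 0%N = 0%R by rewrite /b /cb_tail K0 mul0r.
have v0 z : (0 <= v z)%R.
  by rewrite -lee_fin vE; apply: (nnm_Sop _ _ _ mu _ _ _ _ _ b0 nf).2 => [a y|]; [rewrite ltW// hk_gt0|exact: measurable_hk].
pose C y := hphi n K t (dsq n x y).
pose c k y := (hk n (k.+1%:R * tau) x y / k.+1%:R)%R.
have c0 k y : (0 <= c k y)%R by rewrite divr_ge0// ltW// hk_gt0.
pose W y := \sum_(k <oo) (b k * c k y)%:E.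
have s0 : (0 < 2 * Num.sqrt tau)%R by rewrite mulr_gt0// sqrtr_gt0.
have tt0 : (0 < t / K%:R)%R by rewrite -tauE.
(* The factor 1 / (k + 1) in [c] is tau / ((k + 1) tau) from the semigroup law of the gradient; it
   matches the 1 / (2 r) in [hprof]. *)
have CE y : (2 * Num.sqrt tau)%:E * C y = W y.
  rewrite /C /hphi -tauE -nneseriesMl ?lee_fin ?(ltW s0)//; last first.
    by move=> k; rewrite lee_fin mulr_ge0 ?(ltW tau0)// hcoef_ge0.
  apply: eq_eseriesr => k _; rewrite -EFinM; congr EFin.
  rewrite /hcoef /c /b /hprof -qE /hk.
  have k0 : (k.+1%:R != 0 :> R)%R by rewrite pnatr_eq0.
  have sq0 : (Num.sqrt tau != 0)%R by rewrite gt_eqF// sqrtr_gt0.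
  have : (tau = Num.sqrt tau ^+ 2)%R by rewrite sqr_sqrtr// ltW.
  move: (expR _) (gauss_cst _ ^+ n)%R (cb_tail R K k * q ^+ k)%R => e g w.
  move: sq0; set z := Num.sqrt tau; clearbody z => z0 ->.
  by move: (k.+1%:R : R)%R k0 => k1 k10; field; rewrite ?z0 ?k10.
have nW : nnm W.
  apply: (nnm_nneseries _ _ _ (fun k y => (b k * c k y)%:E)) => k.
  split=> [|y]; last by rewrite lee_fin mulr_ge0.
  apply/measurable_EFinP; apply: measurable_funM => //; apply: measurable_funM => //.
  exact: measurable_hkr.
pose S (w : E -> R) y := \sum_(k <oo) (b k)%:E * \int[mu]_z ((h x z * w z)%:E * (hk n (k%:R * tau) z y)%:E).
have nS (w : E -> R) : nnm (fun z => (h x z * w z)%:E) -> nnm (S w).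
  move=> nw; apply: (nnm_nneseries _ _ _ (fun k y => (b k)%:E * \int[mu]_z ((h x z * w z)%:E * (hk n (k%:R * tau) z y)%:E))) => k.
  case: k => [|k]; last by apply: nnmZ => //; exact: nnm_weight_hk.
  by rewrite b00; under eq_fun do rewrite mul0e; split.
(* [integral_posneg_hk] summed against the weights, free of subtractions; the index 0 contributes
   nothing on either side. *)
have key y : S p y + (m y)%:E * W y = S m y + (p y)%:E * W y.
  have tm (w : E -> R) k : nnm (fun z => (h x z * w z)%:E) ->
      0 <= (b k)%:E * \int[mu]_z ((h x z * w z)%:E * (hk n (k%:R * tau) z y)%:E).
    move=> nw; case: k => [|k]; first by rewrite b00 mul0e.
    by rewrite mule_ge0 ?lee_fin//; exact: (nnm_weight_hk _ k nw).2.
  rewrite /W -!nneseriesMl ?lee_fin//; last 2 first.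
  - by move=> k; rewrite lee_fin mulr_ge0.
  - by move=> k; rewrite lee_fin mulr_ge0.
  rewrite /S -!nneseriesD//; last 4 first.
  - by move=> k _ _; exact: tm.
  - by move=> k _ _; rewrite -EFinM lee_fin; apply: mulr_ge0 => //; exact: mulr_ge0.
  - by move=> k _ _; exact: tm.
  - by move=> k _ _; rewrite -EFinM lee_fin; apply: mulr_ge0 => //; exact: mulr_ge0.
  apply: eq_eseriesr => -[|k] _; first by rewrite b00 !mul0r !mul0e !mule0.
  have mv (I : \bar R) (w : R) : 0 <= I -> (0 <= w)%R ->
      (b k.+1)%:E * I + w%:E * (b k.+1 * c k.+1 y)%:E = (b k.+1)%:E * (I + (w * c k.+1 y)%:E).
    by move=> I0 w0; rewrite ge0_muleDr// ?lee_fin ?(mulr_ge0 w0)// -!EFinM mulrCA.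
  have := integral_posneg_hk k y.
  have cE w : (w * hk n (k.+2%:R * tau) x y / k.+2%:R = w * c k.+1 y)%R by rewrite /c mulrA.
  rewrite !cE => H; rewrite !mv ?H//; exact: (nnm_weight_hk _ k _).2.
have Iw (w : E -> R) : nnm (fun z => (h x z * w z)%:E) ->
    \int[mu]_z (h x z * w z * v z)%:E = \int[mu]_y (S w y * (f y)%:E).
  move=> nw; under eq_integral do rewrite EFinM vE.
  by rewrite (integral_weight_Sop b _ (EFin \o f))//.
have mC : measurable_fun setT C.
  have -> : C = (fun y => ((2 * Num.sqrt tau)^-1)%:E * W y).
    by apply/funext => y; rewrite -CE muleA -EFinM mulVf ?mul1e// gt_eqF.
  by apply: emeasurable_funM => //; exact: nW.1.
have C0 y : 0 <= C y by apply: nneseries_ge0 => k _ _; rewrite lee_fin mulr_ge0 ?hcoef_ge0// ltW.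
pose cB : R := (gauss_cst t ^+ n.-1 * (2 / Num.sqrt t))%R.
have wle y : (`|tnth y j - tnth x j| <= Num.sqrt (dsq n x y))%R.
  rewrite -sqrtr_sqr ler_wsqrtr// /dsq (bigD1 j)//= lerDl.
  by apply: sumr_ge0 => i _; exact: sqr_ge0.
have wC (w : E -> R) y : (0 <= w y)%R -> (w y <= `|tnth y j - tnth x j|)%R ->
    (w y)%:E * C y = (w y * fine (C y))%:E /\ (w y * fine (C y) <= cB)%R.
  move=> wy0 wyle.
  have H : (w y)%:E * C y <= cB%:E.
    apply: le_trans (hphi_bound n K t (dsq n x y) n0 K1 t0 (dsq_ge0 n x y)).
    by rewrite lee_wpmul2r ?C0// lee_fin (le_trans wyle).
  have E1 : (w y)%:E * C y = (w y * fine (C y))%:E.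
    move: wy0; rewrite le_eqVlt => /predU1P[<-|wp]; first by rewrite mul0e mul0r.
    rewrite EFinM fineK// ge0_fin_numE ?C0//.
    by rewrite -(@lte_pmul2l _ (w y)%:E) ?lte_fin// (le_lt_trans H)// mulr_infty gtr0_sg// mul1e ltry.
  by split=> //; rewrite -lee_fin -E1.
have ple y : (p y <= `|tnth y j - tnth x j|)%R by rewrite /p ge_max normr_ge0 ler_norm.
have mle y : (m y <= `|tnth y j - tnth x j|)%R by rewrite /m ge_max normr_ge0 -normrN ler_norm.
have Jw (w : E -> R) : measurable_fun setT w -> (forall y, 0 <= w y)%R ->
    (forall y, w y <= `|tnth y j - tnth x j|)%R ->
    \int[mu]_y ((w y)%:E * W y * (f y)%:E) = (2 * Num.sqrt tau)%:E * \int[mu]_y (w y * fine (C y) * f y)%:E.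
  move=> mw' w0 wl; rewrite -(integralZ_nnm mu _ (ltW s0)); last first.
    split=> [|y]; last by rewrite lee_fin !mulr_ge0// fine_ge0.
    apply/measurable_EFinP; apply: measurable_funM; last by apply/measurable_EFinP; exact: nf.1.
    by apply: measurable_funM => //; exact: measurableT_comp.
  apply: eq_integral => y _; rewrite -CE muleCA -muleA; congr (_ * _).
  by rewrite (wC w y (w0 y) (wl y)).1 -EFinM.
have nwW (w : E -> R) : measurable_fun setT w -> (forall y, 0 <= w y)%R ->
    nnm (fun y => (w y)%:E * W y).
  move=> mw' w0; apply: nnmM => //.
  by split=> [|y]; [exact/measurable_EFinP|rewrite lee_fin].
clearbody S W.
have int_key : \int[mu]_z (h x z * p z * v z)%:E +
     (2 * Num.sqrt tau)%:E * \int[mu]_y (m y * fine (C y) * f y)%:E =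
   \int[mu]_z (h x z * m z * v z)%:E +
     (2 * Num.sqrt tau)%:E * \int[mu]_y (p y * fine (C y) * f y)%:E.
  have sumE (A B : E -> \bar R) : nnm A -> nnm B ->
      \int[mu]_y (A y * (f y)%:E) + \int[mu]_y (B y * (f y)%:E) =
      \int[mu]_y ((A y + B y) * (f y)%:E).
    move=> nA nB; rewrite -(integralD_nnm mu (nnmM nA nf) (nnmM nB nf)).
    by apply: eq_integral => y _; rewrite ge0_muleDl ?nA.2 ?nB.2.
  rewrite (Iw p nhp) (Iw m nhm) -(Jw m mm m0 mle) -(Jw p mp p0 ple).
  apply: (etrans (sumE _ _ (nS _ nhp) (nwW _ mm m0))).
  apply: (etrans _ (esym (sumE _ _ (nS _ nhm) (nwW _ mp p0)))).
  by apply: eq_integral => y _; rewrite key.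
have [a Im Ip] := Rintegral_max0 _ _ _ mu _ (integrable_hk_coord n tau x j v tau0 bv).
have iG : mu.-integrable setT (EFin \o (fun y => (tnth y j - tnth x j) * fine (C y) * f y)%R).
  apply: (le_integrable measurableT _ _ (integrableZl measurableT cB intf)) => /=.
  - apply/measurable_EFinP; apply: measurable_funM; last by apply/measurable_EFinP; exact: nf.1.
    by apply: measurable_funM => //; exact: measurableT_comp.
  - move=> y _; rewrite lee_fin normrM [X in (_ * X)%R]ger0_norm//.
    rewrite [leRHS]ger0_norm; last first.
      rewrite mulr_ge0// !mulr_ge0 ?invr_ge0 ?sqrtr_ge0// exprn_ge0// ltW// gauss_cst_gt0//.
    rewrite ler_wpM2r// normrM [X in (_ * X)%R]ger0_norm ?fine_ge0//.
    exact: (wC (fun y => `|tnth y j - tnth x j|)%R y _ _).2.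
have [b' Jm Jp] := Rintegral_max0 _ _ _ mu _ iG.
move: int_key.
have mE1 (u w z : R) : (0 <= u)%R -> (0 <= z)%R -> (Num.max (u * w * z) 0 = u * Num.max w 0 * z)%R.
  by move=> u0 z0; rewrite mulrAC maxM ?(mulr_ge0 u0)// mulrAC.
have mE2 (u w z : R) : (0 <= u)%R -> (0 <= z)%R -> (Num.max (w * u * z) 0 = Num.max w 0 * u * z)%R.
  by move=> u0 z0; rewrite [(w * u)%R]mulrC mE1// [(u * _)%R]mulrC.
have -> : \int[mu]_z (h x z * p z * v z)%:E = (a + (\int[mu]_z (h x z * (tnth z j - tnth x j) * v z))%R)%:E.
  by rewrite -Ip; apply: eq_integral => z _; congr EFin; exact/esym/mE1.
have -> : \int[mu]_z (h x z * m z * v z)%:E = a%:E.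
  rewrite -Im; apply: eq_integral => z _; congr EFin.
  by apply/esym; rewrite -mulNr -mulrN; exact: mE1.
have -> : \int[mu]_y (p y * fine (C y) * f y)%:E =
    (b' + (\int[mu]_y ((tnth y j - tnth x j) * fine (C y) * f y))%R)%:E.
  by rewrite -Jp; apply: eq_integral => y _; congr EFin; apply/esym/mE2 => //; exact: fine_ge0.
have -> : \int[mu]_y (m y * fine (C y) * f y)%:E = b'%:E.
  rewrite -Jm; apply: eq_integral => y _; congr EFin.
  by apply/esym; rewrite -mulNr -mulNr; apply: mE2 => //; exact: fine_ge0.
rewrite /heat_grad; set Rg := (\int[mu]_z (h x z * _ * _))%R; set RG := (\int[mu]_y _)%R.
rewrite -!EFinM -!EFinD => -[] H.
have HR : (Rg = 2 * Num.sqrt tau * RG)%R by lra.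
have st : (Num.sqrt tau * Num.sqrt tau = tau)%R by rewrite -expr2 sqr_sqrtr// ltW.
have sq0 : (Num.sqrt tau != 0)%R by rewrite gt_eqF// sqrtr_gt0.
by rewrite HR -[in (2 * tau)%R]st; field.
Qed.

End gradient_kernel.

(** * Passage to continuous time *)

Section measure_covers.
Context d (T : measurableType d) (R : realType) (mu : {measure set T -> \bar R}).
Local Open Scope ereal_scope.

(** The cover is the lower limit of the given covers, an increasing union of intersections, each of
    measure at most the limit of [c]. Stating everything with measurable covers makes no demand on
    the superlevel sets themselves. *)
Lemma liminf_cover (A : set T) (P : nat -> T -> Prop) (c : nat -> R) (l : R) :
  (\forall K \near \oo, exists N : set T,
    [/\ measurable N, mu N <= (c K)%:E & forall x, P K x -> N x]) ->
  c K @[K --> \oo] --> l ->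
  (forall x, A x -> \forall K \near \oo, P K x) ->
  exists N : set T, [/\ measurable N, mu N <= l%:E & forall x, A x -> N x].
Proof.
move=> [K0 _ hK0] cl AP.
have /choice[N hN] : forall K, exists N : set T, (K0 <= K)%N ->
    [/\ measurable N, mu N <= (c K)%:E & forall x, P K x -> N x].
  move=> K; have [KK|KK] := leqP K0 K; last by exists set0.
  by have [N hN] := hK0 K KK; exists N.
pose I m := \bigcap_(k in [set k | (K0 + m <= k)%N]) N k.
have mI m : measurable (I m).
  apply: bigcap_measurable; first by exists (K0 + m)%N => /=.
  by move=> k /= mk; have [] := hN k (leq_trans (leq_addr _ _) mk).
have ndI : nondecreasing_seq I.
  apply/nondecreasing_seqP => m; apply/subsetPset => x Ix k /= mk.
  by apply: Ix => /=; rewrite (leq_trans _ mk)// addnS.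
have Il m : mu (I m) <= l%:E.
  have cl' : (c K)%:E @[K --> \oo] --> l%:E by apply: cvg_EFin => //; exact: nearW.
  apply: (cvge_ge _ cl').
  exists (K0 + m)%N => // k /= mk.
  have [mN Nk _] := hN k (leq_trans (leq_addr _ _) mk).
  by rewrite (le_trans _ Nk)// le_measure ?inE// => x; exact.
exists (\bigcup_m I m); split.
- exact: bigcup_measurable.
- have H : mu (I m) @[m --> \oo] --> mu (\bigcup_m I m).
    exact: (nondecreasing_cvg_mu mI (bigcup_measurable (fun k _ => mI k)) ndI).
  apply: (cvge_le _ H).
  by apply: nearW => m; exact: Il.
- move=> x /AP[m _ hm]; exists m => // k /= mk.
  have [_ _] := hN k (leq_trans (leq_addr _ _) mk); apply.
  by apply: hm => /=; rewrite (leq_trans _ mk)// leq_addl.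
Qed.

Lemma integrable_bounded_mul (k f : T -> R) (B : R) : measurable_fun setT k ->
  (forall x, `|k x| <= B)%R -> mu.-integrable setT (EFin \o f) ->
  mu.-integrable setT (EFin \o (fun x => k x * f x)%R).
Proof.
move=> mk kB intf; have mf : measurable_fun setT f.
  by apply/measurable_EFinP; case/integrableP: intf.
apply: (le_integrable measurableT _ _ (integrableZl measurableT B intf)) => /=.
  by apply/measurable_EFinP; exact: measurable_funM.
move=> x _; rewrite lee_fin !normrM ler_wpM2r//.
by rewrite (le_trans (kB x))// ler_norm.
Qed.

End measure_covers.

(** * The Riesz transform at discrete and at continuous time *)

Section kernel_operators.
Context {R : realType} (n : nat) (n0 : (0 < n)%N).
Notation E := (euclid R n).
Notation mu := (@leb R n).
Local Open Scope ereal_scope.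

Definition hphi_bnd (t : R) : R := (gauss_cst t ^+ n.-1 * (2 / Num.sqrt t))%R.

Lemma measurable_hphi K (t : R) : (1 < K)%N -> (0 < t)%R -> measurable_fun setT (hphi n K t).
Proof.
move=> K1 t0; have tau0 : (0 < t / K%:R)%R by rewrite divr_gt0// ltr0n ltnW.
apply: ge0_emeasurable_sum => [k D _ _|k _].
  by rewrite lee_fin mulr_ge0 ?(ltW tau0)// hcoef_ge0.
apply/measurable_EFinP; apply: measurable_funM => //; apply: measurable_funM => //.
apply: measurable_funM => //; apply: measurable_funM => //; apply: measurableT_comp => //.
by apply: measurable_funN; exact: measurable_funM.
Qed.

Lemma hphi_ge0 K (t D : R) : (1 < K)%N -> (0 < t)%R -> 0 <= hphi n K t D.
Proof.
move=> K1 t0; have tau0 : (0 < t / K%:R)%R by rewrite divr_gt0// ltr0n ltnW.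
by apply: nneseries_ge0 => k _ _; rewrite lee_fin mulr_ge0 ?(ltW tau0)// hcoef_ge0.
Qed.

Lemma coord_le_dsq (x y : E) (j : 'I_n) : (`|tnth y j - tnth x j| <= Num.sqrt (dsq n x y))%R.
Proof.
rewrite -sqrtr_sqr ler_wsqrtr// /dsq (bigD1 j)//= lerDl.
by apply: sumr_ge0 => i _; exact: sqr_ge0.
Qed.

Lemma hphi_kernel_le K (t : R) (x y : E) (j : 'I_n) : (1 < K)%N -> (0 < t)%R ->
  (`|(tnth y j - tnth x j) * fine (hphi n K t (dsq n x y))| <= hphi_bnd t)%R.
Proof.
move=> K1 t0; have C0 := hphi_ge0 K t (dsq n x y) K1 t0.
have D0 := dsq_ge0 n x y.
have := hphi_bound n K t (dsq n x y) n0 K1 t0 D0; have := coord_le_dsq x y j.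
rewrite normrM (ger0_norm (fine_ge0 C0)).
case: (hphi n K t (dsq n x y)) C0 => [r| |]//= r0 wD H.
  by rewrite (le_trans (ler_wpM2r r0 wD)).
by rewrite mulr0 mulr_ge0 ?divr_ge0 ?sqrtr_ge0// exprn_ge0// ltW// gauss_cst_gt0.
Qed.

Lemma measurable_hphi_kernel K (t : R) (x : E) (j : 'I_n) : (1 < K)%N -> (0 < t)%R ->
  measurable_fun setT (fun y : E => (tnth y j - tnth x j) * fine (hphi n K t (dsq n x y)))%R.
Proof.
move=> K1 t0; apply: measurable_funM; first exact: measurable_coord_diff.
apply: measurableT_comp => //; apply: measurableT_comp; first exact: measurable_hphi.
exact: (measurableT_comp (measurable_dsq n) (pair1_measurable x)).
Qed.

Definition riesz_step K (t : R) (j : 'I_n) (f : E -> R) (x : E) : R :=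
  (\int[mu]_y ((tnth y j - tnth x j) * fine (hphi n K t (dsq n x y)) * f y))%R.

Definition hphi_lim (c t D : R) : R :=
  fine (\int[@lebesgue_measure R]_(s in `[t, +oo[) (c / Num.sqrt s * hprof n D s)%:E).

(** For c = 1 / sqrt pi this is the gradient of the integral over s >= t of (pi s)^(-1/2) times the
    heat flow of [f]: the subordination formula for the inverse square root of minus the Laplacian,
    cut off at time [t]. *)
Definition riesz_heat (c t : R) (j : 'I_n) (f : E -> R) (x : E) : R :=
  (\int[mu]_y ((tnth y j - tnth x j) * hphi_lim c t (dsq n x y) * f y))%R.

Lemma hphi_lim_cvg (c t D : R) : (0 < t)%R -> (0 < D)%R -> scb k @[k --> \oo] --> c ->
  fine (hphi n K.+2 t D) @[K --> \oo] --> hphi_lim c t D.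
Proof.
move=> t0 D0 cc; have H := hphi_cvg n t D c n0 t0 D0 cc.
have sD : (0 < Num.sqrt D)%R by rewrite sqrtr_gt0.
apply: fine_cvg; rewrite fineK//.
set L := \int[_]_(s in _) _ in H *.
have L0 : 0 <= L by apply: (cvge_ge _ H); apply: nearW => K; exact: hphi_ge0.
rewrite ge0_fin_numE//; apply: (@le_lt_trans _ _ (hphi_bnd t / Num.sqrt D)%:E); last exact: ltry.
apply: (cvge_le _ H); apply: nearW => K.
rewrite EFinM lee_pdivlMr// muleC; apply: hphi_bound => //; exact: ltW.
Qed.

Lemma riesz_step_cvg (c t : R) (j : 'I_n) (f : E -> R) (x : E) : (0 < t)%R ->
  scb k @[k --> \oo] --> c -> mu.-integrable setT (EFin \o f) ->
  riesz_step K.+2 t j f x @[K --> \oo] --> riesz_heat c t j f x.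
Proof.
move=> t0 cc intf; have mf : measurable_fun setT f.
  by apply/measurable_EFinP; case/integrableP: intf.
pose F K (y : E) := ((tnth y j - tnth x j) * fine (hphi n K.+2 t (dsq n x y)) * f y)%:E.
have mF K : measurable_fun setT (F K).
  by apply/measurable_EFinP; apply: measurable_funM => //; exact: measurable_hphi_kernel.
have cF y : F K y @[K --> \oo] --> ((tnth y j - tnth x j) * hphi_lim c t (dsq n x y) * f y)%:E.
  apply: cvg_EFin; first exact: nearW.
  apply: cvgM; last exact: cvg_cst.
  have := dsq_ge0 n x y; rewrite le_eqVlt => /predU1P[D0|D0].
    have -> : (tnth y j - tnth x j = 0)%R.
      by apply/eqP; rewrite -normr_le0 (le_trans (coord_le_dsq x y j))// -D0 sqrtr0.
    by rewrite mul0r; under eq_fun do rewrite mul0r; exact: cvg_cst.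
  by apply: cvgM; [exact: cvg_cst|exact: hphi_lim_cvg].
have ig : mu.-integrable setT (fun y => (hphi_bnd t * `|f y|)%:E).
  exact: (integrableZl measurableT (hphi_bnd t) (integrable_abse intf)).
have mlim : measurable_fun setT (fun y : E => ((tnth y j - tnth x j) * hphi_lim c t (dsq n x y) * f y)%:E).
  by apply: (emeasurable_fun_cvg F) => // y _; exact: cF.
have dF y K : `|F K y| <= (hphi_bnd t * `|f y|)%:E.
  by rewrite lee_fin normrM ler_wpM2r// hphi_kernel_le.
have [il _ H] := @dominated_convergence _ _ _ mu setT measurableT F _ _ mF mlim
  (aeW _ (fun y _ => cF y)) ig (aeW _ (fun y K _ => dF y K)).
apply: fine_cvg; rewrite fineK; last exact: (integrable_fin_num _ il).
exact: H.
Qed.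

Lemma Sop_tail_bounded K (q tau M : R) (f : E -> \bar R) : (0 < tau)%R -> (0 < q)%R -> (q < 1)%R ->
  nnm f -> (0 <= M)%R ->
  (forall k x, (K <= k)%N -> iter k (Hop mu (hk n tau)) f x <= M%:E) ->
  let v x := fine (Sop mu (hk n tau) (fun k => cb_tail R K k * q ^+ k)%R f x) in
  bounded_measurable n v /\
  (forall x, (v x)%:E = Sop mu (hk n tau) (fun k => cb_tail R K k * q ^+ k)%R f x).
Proof.
move=> tau0 q0 q1 nf M0 fM v.
have h0 x y : (0 <= hk n tau x y)%R by rewrite ltW// hk_gt0.
have mh := measurable_hk n tau (R := R).
have b0 k : (0 <= cb_tail R K k * q ^+ k)%R by rewrite mulr_ge0 ?cb_tail_ge0// exprn_ge0// ltW.
have nS := nnm_Sop _ _ _ mu _ h0 mh _ _ b0 nf.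
have [S S1 SE] := sum_cb_fin _ _ q0 q1.
have SM x : Sop mu (hk n tau) (fun k => cb_tail R K k * q ^+ k)%R f x <= (M * S)%:E.
  rewrite EFinM -SE -nneseriesMl ?lee_fin//; last first.
    by move=> k; rewrite lee_fin mulr_ge0 ?exprn_ge0 ?ltW// cb_gt0.
  apply: lee_nneseries => k *.
    by rewrite mule_ge0 ?lee_fin//; exact: (nnm_iter_Hop _ _ _ mu _ h0 mh k _ nf).2.
  have c0 : (0 <= cb R k * q ^+ k)%R by rewrite mulr_ge0 ?exprn_ge0 ?ltW// cb_gt0.
  rewrite /cb_tail; case: (ltnP k K) => kK; first by rewrite mul0r mul0e mule_ge0 ?lee_fin.
  by rewrite muleC lee_wpmul2r ?lee_fin// fM.
have vE x : (v x)%:E = Sop mu (hk n tau) (fun k => cb_tail R K k * q ^+ k)%R f x.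
  by rewrite /v fineK// ge0_fin_numE ?nS.2// (le_lt_trans (SM x)) ?ltry.
split=> //; split.
  apply/measurable_EFinP.
  by rewrite (_ : EFin \o v = Sop mu (hk n tau) (fun k => cb_tail R K k * q ^+ k)%R f);
    [exact: nS.1|apply/funext => x; exact: vE].
exists (M * S)%R => x; rewrite ger0_norm; first by rewrite -lee_fin vE SM.
by rewrite -lee_fin vE nS.2.
Qed.

(** At least [K] steps of length t / K have run, so the kernel is below its maximum at time [t]. *)
Lemma iter_Hop_le_mass K (t G : R) (f : E -> \bar R) k x : (0 < K)%N -> (0 < t)%R -> nnm f ->
  \int[mu]_y f y <= G%:E -> (K <= k)%N ->
  iter k (Hop mu (hk n (t / K%:R))) f x <= (gauss_cst t ^+ n * G)%:E.
Proof.
move=> K0 t0 nf fG Kk; have tau0 : (0 < t / K%:R)%R by rewrite divr_gt0// ltr0n.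
have g0 : (0 <= gauss_cst t ^+ n)%R by rewrite exprn_ge0// ltW// gauss_cst_gt0.
case: k Kk => [|k] Kk; first by rewrite leqNgt K0 in Kk.
rewrite iter_Hop_hk//.
have kt : (t <= k.+1%:R * (t / K%:R))%R.
  by rewrite mulrCA ler_peMr ?(ltW t0)// ler_pdivlMr ?ltr0n// mul1r ler_nat.
have kt0 := lt_le_trans t0 kt.
apply: (@le_trans _ _ (\int[mu]_y ((gauss_cst t ^+ n)%:E * f y))); last first.
  by rewrite integralZ_nnm// EFinM lee_wpmul2l.
apply: (le_integral_nnm mu _ (nnmZ g0 nf)) => [|y].
  apply: nnmM => //; split=> [|y]; last by rewrite lee_fin ltW// hk_gt0.
  by apply/measurable_EFinP; exact: measurable_hkr.
rewrite lee_wpmul2r ?nf.2// lee_fin (le_trans (hk_le _ _ _ _ kt0))//.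
by apply: lerXn2r; rewrite ?nnegrE ?(ltW (gauss_cst_gt0 _ _))//; exact: gauss_cst_le.
Qed.

(** Both [cb] and the Lipschitz modulus decay like k^(-1/2), so their product is harmonic. *)
Lemma damped_harmonic_sum K : (1 < K)%N ->
  \sum_(k <oo) ((fun k0 => cb R k0 * damping K ^+ k0) k.+1 / Num.sqrt k.+1%:R)%:E <=
  (2 + 2 * ln (K%:R : R))%:E.
Proof.
move=> K1; apply: le_trans (geometric_harmonic_le _ K1).
have q0 := damping_gt0 (R := R) _ K1.
apply: lee_nneseries => k *.
  by rewrite lee_fin divr_ge0 ?sqrtr_ge0// mulr_ge0 ?exprn_ge0 ?(ltW q0)// ltW// cb_gt0.
rewrite lee_fin [X in (X / _)%R]mulrC -[X in (X <= _)%R]mulrA ler_wpM2l ?exprn_ge0 ?(ltW q0)//.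
have s0 : (0 < Num.sqrt k.+1%:R :> R)%R by rewrite sqrtr_gt0.
rewrite ler_pdivrMr// (le_trans (cbS_le R k))// (le_trans (cb_le_sqrt R k))//.
by rewrite -{2}(sqr_sqrtr (ler0n R k.+1)) expr2 invfM -mulrA mulVf ?mulr1// gt_eqF.
Qed.

(** The truncation height [e] grows like sqrt K, the largest growth that [cb K] can compensate; the
    power eta^3 leaves a factor eta after the division by eta^2 in the leakage bound. *)
Theorem riesz_step_weak_bound K (t l eta G : R) (f : E -> R) : (1 < K)%N -> (0 < t)%R ->
  (0 < l)%R -> (0 < eta)%R -> mu.-integrable setT (EFin \o f) ->
  \int[mu]_y `|f y|%:E = G%:E ->
  let e := (eta ^+ 3 * Num.sqrt (K%:R / t))%R in
  let C := (gauss_cst t ^+ n * G + l)%R in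
  (2 * C <= e)%R ->
  (16384 * Num.sqrt 2 ^+ n * (C * (2 + 2 * ln (K%:R : R))) ^+ 4 <= (e * eta) ^+ 2)%R ->
  exists N : set E, [/\ measurable N,
    mu N <= (G / l + G / (damping K * l) + 4 * eta * G / (damping K * Num.sqrt t))%:E &
    forall x, ~ N x -> (\sum_(j < n) riesz_step K t j f x ^+ 2 <= (l + eta) ^+ 2)%R].
Proof.
move=> K1 t0 l0 eta0 intf fG e C eC eL.
have K0 : (0 < K)%N by exact: ltnW.
have k0 : (0 < K%:R :> R)%R by rewrite ltr0n.
pose tau := (t / K%:R)%R; have tau0 : (0 < tau)%R by rewrite divr_gt0.
have q0 := damping_gt0 (R := R) _ K1; have q1 := damping_lt1 (R := R) _ K0.
have mf : measurable_fun setT f by apply/measurable_EFinP; case/integrableP: intf.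
pose f1 y := Num.max (f y) 0%R. pose f2 y := Num.max (- f y)%R 0%R.
have f10 y : (0 <= f1 y)%R by rewrite /f1 le_max lexx orbT.
have f20 y : (0 <= f2 y)%R by rewrite /f2 le_max lexx orbT.
have mf1 : measurable_fun setT f1 by exact: measurable_maxr.
have mf2 : measurable_fun setT f2 by apply: measurable_maxr => //; exact: measurable_funN.
have nE (g : E -> R) : measurable_fun setT g -> (forall y, 0 <= g y)%R -> nnm (EFin \o g).
  by move=> mg g0; split=> [|y]; [exact/measurable_EFinP|rewrite lee_fin].
have nf1 := nE _ mf1 f10; have nf2 := nE _ mf2 f20.
have fabs y : `|f y|%R = (f1 y + f2 y)%R.
  rewrite /f1 /f2; case: (ger0P (f y)) => fy.
    by rewrite max_r ?addr0// oppr_le0.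
  by rewrite add0r max_l// oppr_ge0 ltW.
have fE y : f y = (f1 y - f2 y)%R.
  rewrite /f1 /f2; case: (leP 0 (f y))%R => fy.
    by rewrite max_r ?subr0// oppr_le0.
  by rewrite max_l ?sub0r ?opprK// oppr_ge0 ltW.
have sumG : \int[mu]_y (f1 y)%:E + \int[mu]_y (f2 y)%:E = G%:E.
  rewrite -fG -(integralD_nnm mu nf1 nf2); apply: eq_integral => y _.
  by rewrite fabs EFinD.
have [G1 [G2 [I1 I2 GE]]] : exists G1 G2 : R,
    [/\ \int[mu]_y (f1 y)%:E = G1%:E, \int[mu]_y (f2 y)%:E = G2%:E & G = (G1 + G2)%R].
  have : 0 <= \int[mu]_y (f1 y)%:E by apply: integral_ge0 => y _; rewrite lee_fin.
  have : 0 <= \int[mu]_y (f2 y)%:E by apply: integral_ge0 => y _; rewrite lee_fin.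
  move: sumG; case: (\int[mu]_y (f1 y)%:E) => [a| |]//; case: (\int[mu]_y (f2 y)%:E) => [b| |]//.
  by rewrite -EFinD => -[<-] _ _; exists a, b.
have G10 : (0 <= G1)%R by rewrite -lee_fin -I1; apply: integral_ge0 => y _; rewrite lee_fin.
have G20 : (0 <= G2)%R by rewrite -lee_fin -I2; apply: integral_ge0 => y _; rewrite lee_fin.
have G0 : (0 <= G)%R by rewrite GE addr_ge0.
have g0 : (0 <= gauss_cst t ^+ n)%R by rewrite exprn_ge0// ltW// gauss_cst_gt0.
pose M := (gauss_cst t ^+ n * G)%R; have M0 : (0 <= M)%R by rewrite mulr_ge0.
have M1 k x : (K <= k)%N -> iter k (Hop mu (hk n tau)) (EFin \o f1) x <= M%:E.
  by apply: iter_Hop_le_mass => //; rewrite I1 lee_fin GE lerDl.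
have M2 k x : (K <= k)%N -> iter k (Hop mu (hk n tau)) (EFin \o f2) x <= M%:E.
  by apply: iter_Hop_le_mass => //; rewrite I2 lee_fin GE lerDr.
have [bv1 v1E] := Sop_tail_bounded K _ _ M _ tau0 q0 q1 nf1 M0 M1.
have [bv2 v2E] := Sop_tail_bounded K _ _ M _ tau0 q0 q1 nf2 M0 M2.
set v1 := (fun x : E => fine _) in bv1 v1E; set v2 := (fun x : E => fine _) in bv2 v2E.
have Lam0 : (0 <= 2 + 2 * ln (K%:R : R))%R.
  by rewrite addr_ge0// mulr_ge0// ln_ge0// ler1n.
have [N [mN Nle hN]] := heat_gradient_weak_bound n tau tau0 _ q0 q1 K K0 M l eta e _ M0 l0 eta0 eC Lam0
  (damped_harmonic_sum _ K1) eL _ _ G1 G2 v1 v2 nf1 nf2 (eq_ind_r (fun z => z <= _) (lexx _) I1)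
  (eq_ind_r (fun z => z <= _) (lexx _) I2) M1 M2 v1E v2E.
exists N; split=> //.
  rewrite (le_trans Nle)// lee_fin -GE lerD2l.
  have st : (0 < Num.sqrt t)%R by rewrite sqrtr_gt0.
  (* [scb_le1] makes this bound uniform in [K]. *)
  have ecb : (e * cb R K <= eta ^+ 3 / Num.sqrt t)%R.
    rewrite /e sqrtrM ?ler0n// sqrtrV ?(ltW t0)// mulrA -mulrA [X in (_ * X)%R]mulrC mulrA ler_wpM2r ?invr_ge0 ?(ltW st)//.
    rewrite -mulrA ler_piMr ?exprn_ge0 ?(ltW eta0)//.
    apply: le_trans (scb_le1 (R := R) K); rewrite /scb ler_wpM2r ?(ltW (cb_gt0 R K))//.
    by rewrite ler_wsqrtr// ler_nat.
  have -> : (4 * e * cb R K * G / (damping K * eta ^+ 2) = (4 * G / (damping K * eta ^+ 2)) * (e * cb R K))%R.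
    by ring.
  have -> : (4 * eta * G / (damping K * Num.sqrt t) =
      (4 * G / (damping K * eta ^+ 2)) * (eta ^+ 3 / Num.sqrt t))%R.
    by field; rewrite !gt_eqF.
  apply: ler_wpM2l => //.
  by rewrite divr_ge0 ?mulr_ge0 ?exprn_ge0 ?(ltW q0) ?(ltW eta0).
move=> x xN; apply: le_trans (hN x xN).
have inti (g : E -> R) : measurable_fun setT g -> (forall y, 0 <= g y <= `|f y|)%R ->
    mu.-integrable setT (EFin \o g).
  move=> mg gf; apply: (le_integrable measurableT _ _ intf); first exact/measurable_EFinP.
  by move=> y _; rewrite lee_fin; have /andP[gy0 gy] := gf y; rewrite ger0_norm.
have int1 : mu.-integrable setT (EFin \o f1).
  by apply: inti => // y; rewrite f10 fabs lerDl f20.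
have int2 : mu.-integrable setT (EFin \o f2).
  by apply: inti => // y; rewrite f20 fabs lerDr f10.
have st : (Num.sqrt tau ^+ 2 = tau)%R by rewrite sqr_sqrtr// ltW.
rewrite -{1}st mulr_sumr le_eqVlt; apply/orP; left; apply/eqP.
apply: eq_bigr => j _; rewrite -exprMn; congr (_ ^+ 2)%R.
rewrite (heat_gradB n tau j _ _ x tau0 bv1 bv2) mulrBr.
rewrite (heat_grad_Sop n tau tau0 x j K t _ f1 v1 n0 K1 erefl t0 erefl int1 f10 bv1 v1E).
rewrite (heat_grad_Sop n tau tau0 x j K t _ f2 v2 n0 K1 erefl t0 erefl int2 f20 bv2 v2E).
have ki (g : E -> R) : mu.-integrable setT (EFin \o g) -> mu.-integrable setT
    (EFin \o (fun y => (tnth y j - tnth x j) * fine (hphi n K t (dsq n x y)) * g y)%R).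
  move=> ig; apply: (integrable_bounded_mul _ _ _ _ _ _ (hphi_bnd t)) => //.
    exact: measurable_hphi_kernel.
  by move=> y; exact: hphi_kernel_le.
rewrite /riesz_step -RintegralB//; [|exact: ki|exact: ki].
by apply: eq_Rintegral => y _; rewrite -mulrBr -fE.
Qed.

End kernel_operators.

Section heat_weak_bound.
Context {R : realType} (n : nat) (n0 : (0 < n)%N).
Notation E := (euclid R n).
Notation mu := (@leb R n).

Lemma damping_cvg : damping K.+2 @[K --> \oo] --> (1 : R).
Proof.
have H := @cvg_over_SS R 1.
have -> : (fun K => damping K.+2) = (fun K => 1 - (1 / K.+2%:R) * (1 / K.+2%:R)) :> (nat -> R).
  by apply/funext => K; rewrite /damping !div1r expr2 invfM.
rewrite -[X in _ --> X]subr0 -[X in _ - X](mulr0 0).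
by apply: cvgB; [exact: cvg_cst|exact: cvgM].
Qed.

(** Since K^(1/8) >= 1, the base is at most (2 + 2 * 8) K^(1/8). *)
Lemma ln_pow4_le (K : nat) : (0 < K)%N ->
  (2 + 2 * ln (K%:R : R)) ^+ 4 <= 18 ^+ 4 * Num.sqrt K%:R.
Proof.
move=> K0; have k1 : 1 <= K%:R :> R by rewrite ler1n.
have H := ln_le_root (R := R) K K0.
set s := Num.sqrt (Num.sqrt (Num.sqrt K%:R)) in H.
have h1 (x : R) : 1 <= x -> 1 <= Num.sqrt x by move=> x1; rewrite -{1}(@sqrtr1 R) ler_wsqrtr.
have s1 : 1 <= s by apply/h1/h1/h1.
have s4 : s ^+ 4 = Num.sqrt K%:R.
  by rewrite -[4%N]/(2 * 2)%N exprM !sqr_sqrtr// ?sqrtr_ge0.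
rewrite -s4 -exprMn; apply: lerXn2r; rewrite ?nnegrE ?addr_ge0 ?mulr_ge0 ?ln_ge0//.
  by rewrite (le_trans _ s1).
lra.
Qed.

Theorem heat_weak_bound (c t l eta G : R) (f : E -> R) : 0 < t -> 0 < l -> 0 < eta ->
  scb k @[k --> \oo] --> c -> mu.-integrable setT (EFin \o f) ->
  (\int[mu]_y `|f y|%:E = G%:E)%E ->
  exists N : set E, [/\ measurable N,
    (mu N <= (2 * G / l + 4 * eta * G / Num.sqrt t)%:E)%E &
    forall x, (l + 2 * eta) ^+ 2 < \sum_(j < n) riesz_heat n c t j f x ^+ 2 -> N x].
Proof.
move=> t0 l0 eta0 cc intf fG.
pose b K := G / l + G / (damping K.+2 * l) + 4 * eta * G / (damping K.+2 * Num.sqrt t).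
apply: (@liminf_cover _ _ _ mu _
  (fun K x => (l + eta) ^+ 2 < \sum_(j < n) riesz_step n K.+2 t j f x ^+ 2) b).
- pose C := gauss_cst t ^+ n * G + l.
  have st : 0 < Num.sqrt t by rewrite sqrtr_gt0.
  have C0 : 0 <= C.
    rewrite addr_ge0 ?(ltW l0)// mulr_ge0 ?exprn_ge0 ?(ltW (gauss_cst_gt0 _ t0))//.
    by rewrite -lee_fin -fG; apply: integral_ge0 => y _; rewrite lee_fin.
  (* [A] and [B] are the thresholds for sqrt K beyond which the two smallness conditions on [e]
     hold. *)
  pose A := 16384 * Num.sqrt 2 ^+ n * C ^+ 4 * 18 ^+ 4 * t / eta ^+ 8.
  pose B := 2 * C * Num.sqrt t / eta ^+ 3.
  near=> K; have kA : A <= Num.sqrt K.+2%:R.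
    rewrite (le_trans (ler_norm A))// -sqrtr_sqr ler_wsqrtr//.
    rewrite (@le_trans _ _ K%:R)//; last by rewrite ler_nat !leqW.
    by near: K; exact: nbhs_infty_ger.
  have kB : B <= Num.sqrt K.+2%:R.
    rewrite (le_trans (ler_norm B))// -sqrtr_sqr ler_wsqrtr//.
    rewrite (@le_trans _ _ K%:R)//; last by rewrite ler_nat !leqW.
    by near: K; exact: nbhs_infty_ger.
  have sK : Num.sqrt (K.+2%:R / t) = Num.sqrt K.+2%:R / Num.sqrt t.
    by rewrite sqrtrM ?ler0n// sqrtrV// ltW.
  have s0 : 0 <= Num.sqrt K.+2%:R :> R by exact: sqrtr_ge0.
  have [||N [mN Nb hN]] := riesz_step_weak_bound n n0 K.+2 t l eta G f isT t0 l0 eta0 intf fG.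
  + rewrite sK mulrA ler_pdivlMr// -/C.
    by move: kB; rewrite /B ler_pdivrMr ?exprn_gt0// [Num.sqrt _ * _]mulrC.
  + rewrite -/C exprMn mulrA; apply: le_trans (ler_wpM2l _ (ln_pow4_le K.+2 isT)) _.
      apply: mulr_ge0; last exact: exprn_ge0.
      by apply: mulr_ge0; [exact: ler0n|apply: exprn_ge0; exact: sqrtr_ge0].
    rewrite sK; move: kA; rewrite /A ler_pdivrMr ?exprn_gt0// => kA.
    have -> : (eta ^+ 3 * (Num.sqrt K.+2%:R / Num.sqrt t) * eta) ^+ 2 =
        Num.sqrt K.+2%:R * eta ^+ 8 * Num.sqrt K.+2%:R / t.
      rewrite -[t in RHS](sqr_sqrtr (ltW t0)); field; exact: lt0r_neq0.
    rewrite ler_pdivlMr// [leLHS](_ : _ = 16384 * Num.sqrt 2 ^+ n * C ^+ 4 * 18 ^+ 4 * t * Num.sqrt K.+2%:R).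
      exact: ler_wpM2r.
    by rewrite !mulrA; ring.
  exists N; split=> // x; apply: contraPP => xN; apply/negP; rewrite -leNgt; exact: hN.
- have H := damping_cvg.
  have -> : 2 * G / l + 4 * eta * G / Num.sqrt t =
     G / l + G / (1 * l) + 4 * eta * G / (1 * Num.sqrt t) by rewrite !mul1r; ring.
  have st : 0 < Num.sqrt t by rewrite sqrtr_gt0.
  apply: cvgD; first (apply: cvgD; first exact: cvg_cst).
    apply: cvgM; first exact: cvg_cst.
    by apply: cvgV; [rewrite mul1r gt_eqF|apply: cvgM => //; exact: cvg_cst].
  apply: cvgM; first exact: cvg_cst.
  by apply: cvgV; [rewrite mul1r gt_eqF|apply: cvgM => //; exact: cvg_cst].
- move=> x xl.
  have H : \sum_(j < n) riesz_step n K.+2 t j f x ^+ 2 @[K --> \oo] -->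
      \sum_(j < n) riesz_heat n c t j f x ^+ 2.
    apply: cvg_big => [|j _]; first exact: add_continuous.
    rewrite expr2; under eq_fun do rewrite expr2.
    by apply: cvgM; exact: riesz_step_cvg.
  have /cvgr_gt := H; apply.
  apply: le_lt_trans xl; apply: lerXn2r; rewrite ?nnegrE ?addr_ge0 ?mulr_ge0 ?(ltW l0) ?(ltW eta0)//.
  lra.
Unshelve. all: by end_near.
Qed.

End heat_weak_bound.

(** * Averages of truncated Riesz transforms *)

Section gamma_density.
Context {R : realType} (n : nat).
Notation leb1 := (@lebesgue_measure R).

(** With x = (1 + u) / 2, the polynomial factor is at most (2 x)^n <= 2^n n! exp x, which costs half
    of the exponential decay; integrability is then read off the exponential law of rate 1/2. *)
Lemma gamma_dens_le (u : R) : 0 <= u ->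
  gamma_dens n u <= (2 ^+ n * n`!%:R * expR (1 / 2)) * expR (- (1 / 2) * u).
Proof.
move=> u0; pose x := (1 + u) / 2.
have x0 : 0 <= x by rewrite divr_ge0// addr_ge0.
have h1 : x ^+ n <= n`!%:R * expR x.
  case: (n) => [|k]; first by rewrite expr0 fact0 mul1r -expR0 ler_expR.
  have := expR_ge1Dxn k x0; rewrite -ler_pdivrMl ?ltr0n ?fact_gt0// => H.
  by rewrite mulrC (le_trans _ H)// lerDr.
have h2 : Num.sqrt u ^+ n.-1 <= 2 ^+ n * x ^+ n.
  rewrite -exprMn /x [2 * _]mulrC divfK ?pnatr_eq0//.
  have su : Num.sqrt u <= 1 + u.
    by rewrite -(@ger0_norm _ (1 + u)) ?addr_ge0// -sqrtr_sqr ler_wsqrtr//; nra.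
  apply: (@le_trans _ _ ((1 + u) ^+ n.-1)).
    by apply: lerXn2r => //; rewrite nnegrE ?sqrtr_ge0 ?addr_ge0.
  by apply: ler_weXn2l; [rewrite lerDl|exact: leq_pred].
rewrite /gamma_dens -mulrA -expRD (_ : 1 / 2 + _ = x - u); last by rewrite /x; field.
rewrite expRD mulrA ler_wpM2r ?expR_ge0// (le_trans h2)// -mulrA.
by apply: ler_wpM2l => //; exact: exprn_ge0.
Qed.

Lemma gamma_dens_integrable : leb1.-integrable `]0, +oo[ (EFin \o gamma_dens n).
Proof.
have mg : measurable_fun (setT : set R) (gamma_dens n).
  exact: continuous_measurable_fun (gamma_dens_continuous n).
pose C : R := 2 ^+ n * n`!%:R * expR (1 / 2) * 2.
have ip : leb1.-integrable setT (EFin \o exponential_pdf (1 / 2 : R)).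
  apply/integrableP; split; first by apply/measurable_EFinP; exact: measurable_exponential_pdf.
  under eq_integral => x _ do rewrite /= ger0_norm ?exponential_pdf_ge0//.
  by rewrite integral_exponential_pdf// ltry.
have ip' : leb1.-integrable `]0, +oo[ (EFin \o exponential_pdf (1 / 2 : R)).
  exact: integrableS ip.
apply: (le_integrable _ _ _ (integrableZl _ C ip')) => //.
  by apply/measurable_EFinP; exact: measurable_funTS.
move=> u /=; rewrite in_itv/= andbT => u0.
rewrite lee_fin ger0_norm ?gamma_dens_ge0// (le_trans _ (ler_norm _))//.
rewrite /exponential_pdf patchE mem_set/= ?in_itv/= ?(ltW u0)//.
rewrite (le_trans (gamma_dens_le u (ltW u0)))// /C.
set e := expR (_ * u); set A := _ * expR (1 / 2); rewrite le_eqVlt; apply/orP; left.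
by apply/eqP; field.
Qed.

End gamma_density.

Section riesz_heat_truncations.
Context {R : realType} (n : nat) (n0 : (0 < n)%N).
Notation E := (euclid R n).
Notation mu := (@leb R n).
Notation leb1 := (@lebesgue_measure R).

Definition riesz_kernel (j : 'I_n) (x y : E) : R :=
  (tnth y j - tnth x j) / Num.sqrt (dsq n x y) ^+ n.+1.

Definition riesz_kernel_trunc (j : 'I_n) (x : E) (e : R) (y : E) : R :=
  if e < Num.sqrt (dsq n x y) then riesz_kernel j x y else 0.

Lemma measurable_dist (x : E) : measurable_fun setT (fun y : E => Num.sqrt (dsq n x y)).
Proof.
have -> : (fun y : E => Num.sqrt (dsq n x y)) = Num.sqrt \o dsq n x by [].
apply: measurableT_comp; last exact: (measurableT_comp (measurable_dsq n) (pair1_measurable x)).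
by apply: continuous_measurable_fun; exact: sqrt_continuous.
Qed.

Lemma measurable_riesz_kernel j x : measurable_fun setT (riesz_kernel j x).
Proof.
have -> : riesz_kernel j x = fun y => (tnth y j - tnth x j) * (Num.sqrt (dsq n x y) ^+ n.+1) `^ (-1).
  by apply/funext => y; rewrite /riesz_kernel powR_inv1// exprn_ge0// sqrtr_ge0.
apply: measurable_funM; first exact: measurable_coord_diff.
apply: (measurableT_comp (measurable_powR _)).
by apply: measurable_funX; exact: measurable_dist.
Qed.

Lemma measurable_riesz_kernel_trunc j x (d : measure_display) (T : measurableType d) (g : T -> R) (h : T -> E) :
  measurable_fun setT g -> measurable_fun setT h ->
  measurable_fun setT (fun z => riesz_kernel_trunc j x (g z) (h z)).
Proof.
move=> mg mh; apply: measurable_fun_ifT.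
- by apply: measurable_fun_ltr => //; exact: (measurableT_comp (measurable_dist x)).
- exact: (measurableT_comp (measurable_riesz_kernel j x)).
- exact: measurable_cst.
Qed.

Lemma riesz_kernel_trunc_le j x e y : 0 < e -> `|riesz_kernel_trunc j x e y| <= (e ^+ n)^-1.
Proof.
move=> e0; rewrite /riesz_kernel_trunc; case: ifPn => [eD|_]; last first.
  by rewrite normr0 invr_ge0 exprn_ge0// ltW.
have D0 := lt_trans e0 eD.
rewrite /riesz_kernel; have := coord_le_dsq n x y j.
move: (Num.sqrt (dsq n x y)) eD D0 => D eD D0 H.
rewrite normrM normfV (ger0_norm (exprn_ge0 _ (ltW D0))) exprS invfM mulrA.
apply: (@le_trans _ _ (1 * (D ^+ n)^-1)).
  apply: ler_wpM2r; first by rewrite invr_ge0 exprn_ge0// ltW.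
  by rewrite ler_pdivrMr// mul1r.
rewrite mul1r lef_pV2 ?posrE ?exprn_gt0//; apply: lerXn2r; rewrite ?nnegrE ?(ltW e0) ?(ltW D0)//.
exact: ltW.
Qed.

Lemma riesz_truncE j f e x : riesz_trunc j f e x = (\int[mu]_y (riesz_kernel_trunc j x e y * f y))%R.
Proof.
rewrite /riesz_trunc Rintegral_mkcond; apply: eq_Rintegral => y _.
rewrite patchE /riesz_kernel_trunc -/(dsq n x y).
case: ifPn; rewrite ?inE/= => H.
  by rewrite ifT.
by rewrite ifF ?mul0r//; apply/negP => h; move: H; rewrite notin_setE.
Qed.

Lemma riesz_trunc_integrable j f e x : 0 < e -> mu.-integrable setT (EFin \o f) ->
  mu.-integrable setT (EFin \o (fun y => riesz_kernel_trunc j x e y * f y)).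
Proof.
move=> e0 intf; apply: (integrable_bounded_mul _ _ _ _ _ _ (e ^+ n)^-1) => //.
  by apply: measurable_riesz_kernel_trunc.
by move=> y; exact: riesz_kernel_trunc_le.
Qed.

Lemma riesz_trunc_le j f e x : 0 < e -> mu.-integrable setT (EFin \o f) ->
  `|riesz_trunc j f e x| <= (e ^+ n)^-1 * (\int[mu]_y `|f y|)%R.
Proof.
move=> e0 intf; rewrite riesz_truncE.
apply: (le_trans (le_normr_Rintegral measurableT (riesz_trunc_integrable j f e x e0 intf))).
have intf' := integrable_norm intf.
rewrite -RintegralZl//; apply: le_Rintegral => //.
- exact: (integrable_norm (riesz_trunc_integrable j f e x e0 intf)).
- exact: (integrableZl measurableT _ intf').
- by move=> y _; rewrite normrM ler_wpM2r// riesz_kernel_trunc_le.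
Qed.

Lemma gamma_dens_integrable_itv z : leb1.-integrable `]0, z[ (EFin \o gamma_dens n).
Proof.
apply: (@integrableS _ _ _ leb1 `]0, +oo[) => //; last exact: gamma_dens_integrable.
by move=> s /=; rewrite !in_itv/= andbT => /andP[].
Qed.

Definition gamma_cdf (z : R) : R := (\int[leb1]_(s in `]0, z[) gamma_dens n s)%R.

Lemma gamma_cdfE z : (\int[leb1]_(s in `]0%R, z[) (gamma_dens n s)%:E = (gamma_cdf z)%:E)%E.
Proof. by rewrite /gamma_cdf /Rintegral fineK//; exact: integrable_fin_num (gamma_dens_integrable_itv z). Qed.

Lemma hphi_limE (c t D : R) : 0 <= c -> 0 < t -> 0 < D ->
  hphi_lim n c t D = c / Num.sqrt pi ^+ n / Num.sqrt D ^+ n.+1 * gamma_cdf (D / (4 * t)).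
Proof.
move=> c0 t0 D0; rewrite /hphi_lim.
have mg : measurable_fun (setT : set R) (gamma_dens n).
  exact: continuous_measurable_fun (gamma_dens_continuous n).
rewrite (_ : (\int[leb1]_(s in `[t, +oo[) _)%E =
    (c%:E * \int[leb1]_(s in `[t, +oo[) (hprof n D s / Num.sqrt s)%:E)%E); last first.
  rewrite -ge0_integralZl//.
  - apply: eq_integral => s _; rewrite -EFinM; congr EFin.
    by move: (Num.sqrt s)^-1 (hprof n D s) => a b; ring.
  - apply/measurable_EFinP; apply: subspace_continuous_measurable_fun => //.
    apply: (@continuous_in_subspaceT _ _ `[t, +oo[%classic) => s; rewrite inE /= in_itv/= andbT => ts.
    have s0 := lt_le_trans t0 ts.
    apply: cvgM; first exact: hprof_continuous.
    by apply: cvgV; [rewrite gt_eqF// sqrtr_gt0|exact: sqrt_continuous].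
  - move=> s /=; rewrite in_itv/= andbT => ts; rewrite lee_fin divr_ge0 ?sqrtr_ge0//.
    by rewrite hprof_ge0// (lt_le_trans t0).
rewrite integral_hprof// -integral_itv_bndo_bndc; last first.
  by apply/measurable_EFinP; exact: measurable_funTS.
rewrite gamma_cdfE -!EFinM /= mulrA.
by congr (_ * _); rewrite invfM mulrA.
Qed.

Lemma gamma_cdf_ge0 z : 0 <= gamma_cdf z.
Proof. by apply: Rintegral_ge0 => s _; exact: gamma_dens_ge0. Qed.

Lemma hphi_lim_kernelE (c t : R) j x y : 0 <= c -> 0 < t ->
  (tnth y j - tnth x j) * hphi_lim n c t (dsq n x y) =
  c / Num.sqrt pi ^+ n * (riesz_kernel j x y * gamma_cdf (dsq n x y / (4 * t))).
Proof.
move=> c0 t0; have := dsq_ge0 n x y; rewrite le_eqVlt => /predU1P[D0|D0].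
  have w0 : tnth y j - tnth x j = 0.
    by apply/eqP; rewrite -normr_le0 (le_trans (coord_le_dsq n x y j))// -D0 sqrtr0.
  by rewrite /riesz_kernel w0 !mul0r mulr0.
rewrite hphi_limE// /riesz_kernel; move: (gamma_cdf _) (Num.sqrt (dsq n x y) ^+ n.+1)^-1 => g k.
by move: (c / _) => a; ring.
Qed.

(** The uniform bound of the discrete kernels passes to their limit. *)
Lemma hphi_lim_kernel_le (c t : R) j x y : 0 < t -> scb k @[k --> \oo] --> c ->
  `|(tnth y j - tnth x j) * hphi_lim n c t (dsq n x y)| <= hphi_bnd n t.
Proof.
move=> t0 cc; have := dsq_ge0 n x y; rewrite le_eqVlt => /predU1P[D0|D0].
  have -> : tnth y j - tnth x j = 0.
    by apply/eqP; rewrite -normr_le0 (le_trans (coord_le_dsq n x y j))// -D0 sqrtr0.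
  rewrite mul0r normr0 mulr_ge0 ?divr_ge0 ?sqrtr_ge0//.
  by rewrite exprn_ge0// ltW// gauss_cst_gt0.
have H : `|(tnth y j - tnth x j) * fine (hphi n K.+2 t (dsq n x y))| @[K --> \oo] -->
    `|(tnth y j - tnth x j) * hphi_lim n c t (dsq n x y)|.
  apply: cvg_norm; apply: cvgM; first exact: cvg_cst.
  exact: hphi_lim_cvg.
rewrite -(cvg_lim _ H)//; apply: limr_le; first by apply/cvg_ex; eexists; exact: H.
by apply: nearW => K; exact: hphi_kernel_le.
Qed.

(** In the first variable s the support is 0 < s < |y - x|^2 / (4 t), that is sqrt (4 t s) < |y -
    x|. Integrating s first gives the kernel of [riesz_heat]; integrating y first gives the
    truncated integral at radius sqrt (4 t s). *)
Definition fubini_riesz (t : R) (j : 'I_n) (f : E -> R) (x : E) (z : measurableTypeR R * E) : \bar R :=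
  (if 0 < (z.1 : R) then gamma_dens n z.1 *
    (riesz_kernel_trunc j x (Num.sqrt (4 * t * z.1)) z.2 * f z.2) else 0)%:E.

Lemma measurable_fubini_riesz (t : R) j f x : measurable_fun setT f ->
  measurable_fun setT (fubini_riesz t j f x).
Proof.
move=> mf; have mg : measurable_fun (setT : set R) (gamma_dens n).
  exact: continuous_measurable_fun (gamma_dens_continuous n).
have m1 : measurable_fun setT (fun z : measurableTypeR R * E => z.1 : R) by exact: measurable_fst.
apply/measurable_EFinP; apply: measurable_fun_ifT; last exact: measurable_cst.
  by apply: measurable_fun_ltr.
apply: measurable_funM; first exact: (measurableT_comp mg m1).
apply: measurable_funM; last by apply: (measurableT_comp mf); exact: measurable_snd.
apply: measurable_riesz_kernel_trunc; last exact: measurable_snd.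
have ms : measurable_fun (setT : set R) Num.sqrt.
  by apply: continuous_measurable_fun; exact: sqrt_continuous.
apply: (measurableT_comp ms); exact: measurable_funM.
Qed.

Lemma fubini_riesz_sectionE (t : R) j f x y : 0 < t ->
  (fun s => fubini_riesz t j f x (s, y)) =
  (fun s => (gamma_dens n s * (riesz_kernel j x y * f y))%:E) \_ `]0, dsq n x y / (4 * t)[.
Proof.
move=> t0; apply/funext => s; rewrite patchE /fubini_riesz /=.
have tE (s0 : 0 < s) : (Num.sqrt (4 * t * s) < Num.sqrt (dsq n x y)) = (s < dsq n x y / (4 * t)).
  rewrite ltr_pdivlMr ?mulr_gt0// [s * _]mulrC.
  have := dsq_ge0 n x y; rewrite le_eqVlt => /predU1P[<-|D0]; last by rewrite ltr_sqrt.
  by rewrite sqrtr0 !ltNge sqrtr_ge0 !mulr_ge0 ?(ltW t0) ?(ltW s0).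
case: ifPn => s0; last by rewrite memNset//= in_itv/= (negbTE s0).
rewrite /riesz_kernel_trunc tE//; case: ifPn => sD.
  by rewrite mem_set//= in_itv/= s0 sD.
by rewrite memNset/= ?in_itv/= ?(negbTE sD) ?andbF// mul0r mulr0.
Qed.

Lemma integral_fubini_riesz (t : R) j f x y : 0 < t ->
  (\int[leb1]_s fubini_riesz t j f x (s, y) =
   (riesz_kernel j x y * gamma_cdf (dsq n x y / (4 * t)) * f y)%:E)%E.
Proof.
move=> t0; rewrite fubini_riesz_sectionE// -integral_mkcond.
have ig := gamma_dens_integrable_itv (dsq n x y / (4 * t)).
under eq_integral => s _ do rewrite EFinM muleC.
rewrite integralZl//.
by rewrite (gamma_cdfE (dsq n x y / (4 * t))) -EFinM mulrAC.
Qed.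

Lemma integral_abs_fubini_riesz (t : R) j f x y : 0 < t ->
  (\int[leb1]_s `|fubini_riesz t j f x (s, y)| =
   `|riesz_kernel j x y * gamma_cdf (dsq n x y / (4 * t)) * f y|%:E)%E.
Proof.
move=> t0; have ig := gamma_dens_integrable_itv (dsq n x y / (4 * t)).
have := fubini_riesz_sectionE t j f x y t0.
move=> /(congr1 (fun h => \int[leb1]_s `|h s|))%E ->.
transitivity (\int[leb1]_(s in `]0%R, (dsq n x y / (4 * t))%R[)
    (`|riesz_kernel j x y * f y|%:E * (gamma_dens n s)%:E))%E.
  rewrite [RHS]integral_mkcond; apply: eq_integral => s _; rewrite !patchE.
  case: ifPn => _; last by rewrite abse0.
  by rewrite /= normrM (ger0_norm (gamma_dens_ge0 n s)) mulrC EFinM.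
rewrite integralZl//.
rewrite (gamma_cdfE (dsq n x y / (4 * t))) -EFinM.
by rewrite [in RHS]mulrAC [in RHS]normrM (ger0_norm (gamma_cdf_ge0 _)).
Qed.

Lemma riesz_kernel_gamma_le (c t : R) j x y : 0 < c -> 0 < t -> scb k @[k --> \oo] --> c ->
  `|riesz_kernel j x y * gamma_cdf (dsq n x y / (4 * t))| <= hphi_bnd n t / (c / Num.sqrt pi ^+ n).
Proof.
move=> c0 t0 cc.
have sp : 0 < Num.sqrt (pi : R) ^+ n by rewrite exprn_gt0// sqrtr_gt0 pi_gt0.
rewrite ler_pdivlMr ?divr_gt0//.
rewrite -[X in _ * X](@ger0_norm _ (c / _)) ?divr_ge0 ?(ltW c0) ?(ltW sp)// -normrM mulrC.
by rewrite -hphi_lim_kernelE ?(ltW c0)//; exact: hphi_lim_kernel_le.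
Qed.

Lemma fubini_riesz_integrable (c t : R) j f x : 0 < c -> 0 < t -> scb k @[k --> \oo] --> c ->
  mu.-integrable setT (EFin \o f) ->
  (leb1 \x mu)%E.-integrable setT (fubini_riesz t j f x).
Proof.
move=> c0 t0 cc intf; have mf : measurable_fun setT f.
  by apply/measurable_EFinP; case/integrableP: intf.
have mF := measurable_fubini_riesz t j f x mf.
apply/integrable21ltyP => //.
have sp : 0 < Num.sqrt (pi : R) ^+ n by rewrite exprn_gt0// sqrtr_gt0 pi_gt0.
pose B := hphi_bnd n t / (c / Num.sqrt pi ^+ n).
apply: (@le_lt_trans _ _ (\int[mu]_y (B%:E * `|f y|%:E))%E).
  apply: ge0_le_integral => //.
  - by move=> y _; exact: integral_ge0.
  - apply: (@measurable_fun_fubini_tonelli_G _ _ _ _ _ leb1 (abse \o fubini_riesz t j f x)).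
      by apply: measurableT_comp.
    by move=> z; exact: abse_ge0.
  - apply: emeasurable_funM => //; apply/measurable_EFinP; exact: measurableT_comp.
  - move=> y _; rewrite integral_abs_fubini_riesz// -EFinM lee_fin normrM ler_wpM2r//.
    exact: riesz_kernel_gamma_le.
have /integrableP[_] := integrableZl measurableT `|B| (integrable_abse intf).
apply: le_lt_trans; apply: ge0_le_integral => //.
- move=> y _; rewrite -EFinM lee_fin mulr_ge0// /B /hphi_bnd.
  rewrite divr_ge0 ?divr_ge0 ?(ltW c0) ?(ltW sp)// mulr_ge0 ?divr_ge0 ?sqrtr_ge0//.
  by rewrite exprn_ge0// ltW// gauss_cst_gt0.
- apply: emeasurable_funM => //; apply/measurable_EFinP; exact: measurableT_comp.
- apply: measurableT_comp => //; apply: emeasurable_funM => //; apply/measurable_EFinP; exact: measurableT_comp.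
- move=> y _; rewrite -EFinM /= lee_fin normrM normr_id normr_id ler_wpM2r//; exact: ler_norm.
Qed.

Lemma integral_fubini_riesz_y (t : R) j f x s : 0 < t -> mu.-integrable setT (EFin \o f) ->
  (\int[mu]_y fubini_riesz t j f x (s, y) =
   ((fun s => (gamma_dens n s * riesz_trunc j f (Num.sqrt (4 * t * s)) x)%:E) \_ `]0%R, +oo[) s)%E.
Proof.
move=> t0 intf; rewrite patchE /fubini_riesz /=.
case: (boolP (0 < (s : R))) => s0; last by rewrite memNset/= ?in_itv/= ?(negbTE s0)// integral0.
rewrite mem_set/= ?in_itv/= ?s0//.
have e0 : 0 < Num.sqrt (4 * t * s) by rewrite sqrtr_gt0 !mulr_gt0.
have ig := riesz_trunc_integrable j f _ x e0 intf.
under eq_integral => y _ do rewrite EFinM.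
rewrite integralZl// riesz_truncE [in RHS]EFinM /Rintegral fineK//.
exact: (integrable_fin_num _ ig).
Qed.

Lemma measurable_gamma_trunc (c t : R) j f x : 0 < c -> 0 < t -> scb k @[k --> \oo] --> c ->
  mu.-integrable setT (EFin \o f) ->
  measurable_fun (`]0, +oo[ : set (measurableTypeR R))
    (fun s : R => (gamma_dens n s * riesz_trunc j f (Num.sqrt (4 * t * s)) x)%:E).
Proof.
move=> c0 t0 cc intf; apply: (measurable_restrictT _ (measurable_itv _)).2.
have := measurable_fubini_F (fubini_riesz_integrable c t j f x c0 t0 cc intf).
by rewrite /fubini_F; under eq_fun => s do rewrite integral_fubini_riesz_y//.
Qed.

Lemma riesz_heatE (c t : R) j f x : 0 < c -> 0 < t -> scb k @[k --> \oo] --> c ->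
  mu.-integrable setT (EFin \o f) ->
  riesz_heat n c t j f x = c / Num.sqrt pi ^+ n *
    fine (\int[leb1]_(s in `]0%R, +oo[) (gamma_dens n s * riesz_trunc j f (Num.sqrt (4 * t * s)) x)%:E).
Proof.
move=> c0 t0 cc intf; have iF := fubini_riesz_integrable c t j f x c0 t0 cc intf.
have := Fubini iF.
under eq_integral => s _ do rewrite integral_fubini_riesz_y//.
under [in RHS]eq_integral => y _ do rewrite integral_fubini_riesz//.
rewrite -integral_mkcond => ->.
rewrite -[fine _]/(Rintegral _ _ _) -RintegralZl//; last first.
  pose B := hphi_bnd n t / (c / Num.sqrt pi ^+ n).
  apply: (le_integrable measurableT _ _ (integrableZl measurableT B intf)).
    have := measurable_fubini_G iF.
    by rewrite /fubini_G; under eq_fun => s do rewrite integral_fubini_riesz//.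
  move=> y _; rewrite /= lee_fin normrM [leRHS]normrM ler_wpM2r// (le_trans _ (ler_norm _))//.
  exact: riesz_kernel_gamma_le.
apply: eq_Rintegral => y _; rewrite hphi_lim_kernelE ?(ltW c0)//.
by rewrite -mulrA.
Qed.

Lemma riesz_cstE : riesz_cst n = fine (\int[leb1]_(s in `]0%R, +oo[) (gamma_dens n s)%:E) / Num.sqrt pi ^+ n.+1 :> R.
Proof.
have hpow (a : R) : 0 <= a -> forall k : nat, a `^ (2^-1 * k%:R) = Num.sqrt a ^+ k.
  by move=> a0 k; rewrite powRrM powR12_sqrt// powR_mulrn// sqrtr_ge0.
rewrite /riesz_cst; congr (_ / _); last by rewrite mulrC hpow// pi_ge0.
rewrite /Gamma; apply: eq_Rintegral => s; rewrite inE /= in_itv/= andbT => s0.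
rewrite /gamma_dens -(hpow _ (ltW s0)); congr (_ `^ _ * _).
by rewrite -(prednK n0) -addn2 natrD /=; field.
Qed.

(** At a point where the principal value exists the radii sqrt (4 t s) tend to 0 for each s, and the
    Gamma density dominates. Its total mass is the Gamma factor of [riesz_cst]; the remaining powers
    of sqrt pi leave c sqrt pi. *)
Lemma riesz_heat_cvg (c L : R) j f x : 0 < c -> scb k @[k --> \oo] --> c ->
  mu.-integrable setT (EFin \o f) ->
  riesz_trunc j f e x @[e --> 0^'+] --> L ->
  riesz_heat n c (m.+1%:R^-1) j f x @[m --> \oo] --> c * Num.sqrt pi * (riesz_cst n * L).
Proof.
move=> c0 cc intf TL.
have t0 (m : nat) : 0 < (m.+1%:R^-1 : R) by rewrite invr_gt0.
(* Small radii are bounded by convergence, the others by the size of the truncated kernel. *)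
have [M HM] : exists M, forall e, 0 < e -> `|riesz_trunc j f e x| <= M.
  have /cvgr_dist_lt/(_ _ ltr01) := TL.
  move=> [d /= d0 hd]; exists ((`|L| + 1) + (d ^+ n)^-1 * (\int[mu]_y `|f y|)%R) => e e0.
  have I0 : 0 <= (\int[mu]_y `|f y|)%R by apply: Rintegral_ge0.
  have [ed|de] := ltP e d.
    have := hd e; rewrite /ball/= sub0r normrN gtr0_norm// => /(_ ed e0) H.
    apply: ler_wpDr; first by rewrite mulr_ge0// invr_ge0 exprn_ge0// ltW.
    have := ler_distD L 0 (riesz_trunc j f e x); rewrite !sub0r !normrN => H2.
    by rewrite (le_trans H2)// lerD2l ltW.
  apply: ler_wpDl; first by rewrite addr_ge0.
  rewrite (le_trans (riesz_trunc_le j f e x e0 intf))// ler_wpM2r//.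
  rewrite lef_pV2 ?posrE ?exprn_gt0//; apply: lerXn2r => //; rewrite nnegrE; exact: ltW.
pose F (m : nat) (s : measurableTypeR R) := (gamma_dens n s * riesz_trunc j f (Num.sqrt (4 * m.+1%:R^-1 * s)) x)%:E.
have mF m : measurable_fun (`]0, +oo[ : set (measurableTypeR R)) (F m).
  exact: measurable_gamma_trunc c _ j f x c0 (t0 m) cc intf.
have ig := @gamma_dens_integrable R n.
have mI : measurable (`]0, +oo[%classic : set (measurableTypeR R)) by exact: measurable_itv.
have igL := integrableZl mI L ig.
have FL (s : measurableTypeR R) : `]0, +oo[%classic s -> F m s @[m --> \oo] --> (L%:E * (EFin \o gamma_dens n) s)%E.
  rewrite /= in_itv/= andbT => s0; rewrite -EFinM mulrC; apply: cvg_EFin; first exact: nearW.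
  apply: cvgM; first exact: cvg_cst.
  have /cvg_at_rightP := TL; apply; split=> [m|].
    by rewrite sqrtr_gt0 !mulr_gt0.
  rewrite -(@sqrtr0 R); apply: (@cvg_comp _ _ _ (fun m : nat => 4 * m.+1%:R^-1 * s) Num.sqrt); last exact: sqrt_continuous.
  have : 4 * m.+1%:R^-1 * s @[m --> \oo] --> 4 * 0 * s.
    apply: cvgM; last exact: cvg_cst.
    by apply: cvgM; [exact: cvg_cst|exact: cvg_harmonic].
  by rewrite mulr0 mul0r.
have dF (s : measurableTypeR R) m : `]0, +oo[%classic s -> (`|F m s| <= M%:E * (EFin \o gamma_dens n) s)%E.
  rewrite /= in_itv/= andbT => s0; rewrite lee_fin normrM (ger0_norm (gamma_dens_ge0 n s)) mulrC.
  by apply: ler_wpM2r; [exact: gamma_dens_ge0|apply: HM; rewrite sqrtr_gt0 !mulr_gt0].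
have [_ _ H] := @dominated_convergence _ _ _ leb1 `]0, +oo[%classic mI F _ _ mF
  (measurable_int _ igL) (aeW _ FL) (integrableZl mI M ig) (aeW _ dF).
have iE : (\int[leb1]_(s in `]0%R, +oo[) (L%:E * (EFin \o gamma_dens n) s) =
   (L * fine (\int[leb1]_(s in `]0%R, +oo[) (gamma_dens n s)%:E))%:E)%E.
  rewrite integralZl// EFinM fineK//; exact: integrable_fin_num ig.
rewrite iE in H.
under eq_fun => m do rewrite (riesz_heatE c _ j f x c0 (t0 m) cc intf).
have -> : c * Num.sqrt pi * (riesz_cst n * L) = c / Num.sqrt pi ^+ n *
    (L * fine (\int[leb1]_(s in `]0%R, +oo[) (gamma_dens n s)%:E)).
  rewrite riesz_cstE exprS; move: (fine _) => g.
  have sp : Num.sqrt (pi : R) != 0 by rewrite gt_eqF// sqrtr_gt0 pi_gt0.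
  by field; rewrite expf_neq0.
by apply: cvgM; [exact: cvg_cst|exact: fine_cvg H].
Qed.

End riesz_heat_truncations.

(** * The weak-type bound *)

Section weak_type_bound.
Context {R : realType}.

(* No measurability is assumed, so that of [riesz] need not be proved. *)
Lemma leb_mono n (A B : set (euclid R n)) : A `<=` B -> (leb A <= leb B)%E.
Proof.
elim: n A B => [|n IH] A B AB.
  rewrite /= /dirac !indicE lee_fin ler_nat; case: (boolP (_ \in A)) => // At.
  by rewrite mem_set//; apply: AB; rewrite -inE.
rewrite /= /pushforward /product_measure1 !ge0_integralE//.
apply: le_ereal_sup => _ [h /= hA <-]; exists h => //= x.
apply: le_trans (hA x) _; rewrite !patch_setT /=; apply: IH => y; rewrite /xsection/= !inE.
exact: AB.
Qed.

(* Where some principal value does not exist, the default of [lim] makes the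
   corresponding component of [riesz] vanish, which only helps. *)
Lemma riesz_superlevel_cover n (n0 : (0 < n)%N) (f : euclid R n -> R) (G l : R) : 0 < l ->
  (@leb R n).-integrable setT (EFin \o f) -> (\int[@leb R n]_y `|f y|%:E = G%:E)%E ->
  exists N : set (euclid R n), [/\ measurable N, (leb N <= (2 * G / l)%:E)%E &
    forall x, l < enorm (fun j : 'I_n => riesz j f x) -> N x].
Proof.
move=> l0 intf fG; have [c cc c1] := @scb_cvg R.
have sp : 0 < Num.sqrt (pi : R) by rewrite sqrtr_gt0 pi_gt0.
have c0 : 0 < c by rewrite -(pmulr_lgt0 c sp) (lt_le_trans _ c1).
have t0 (m : nat) : 0 < (m.+1%:R^-1 : R) by rewrite invr_gt0.
have tL : m.+1%:R^-1 @[m --> \oo] --> (0 : R) by exact: cvg_harmonic.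
(* With t = eta = 1 / (m + 1) the level l + 2 eta tends to l, and the error 4 eta G / sqrt t = 4 G
   sqrt t vanishes. *)
apply: (@liminf_cover _ _ _ (@leb R n) _
  (fun m x => (l + 2 * m.+1%:R^-1) ^+ 2 < \sum_(j < n) riesz_heat n c m.+1%:R^-1 j f x ^+ 2)
  (fun m => 2 * G / l + 4 * m.+1%:R^-1 * G / Num.sqrt m.+1%:R^-1)).
- by apply: nearW => m; exact: heat_weak_bound.
- have -> : (fun m : nat => 2 * G / l + 4 * m.+1%:R^-1 * G / Num.sqrt m.+1%:R^-1) =
     (fun m : nat => 2 * G / l + 4 * G * Num.sqrt m.+1%:R^-1) :> (nat -> R).
    apply/funext => m; have s0 : 0 < Num.sqrt (m.+1%:R^-1 : R) by rewrite sqrtr_gt0.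
    congr (_ + _); rewrite -{1}(sqr_sqrtr (ltW (t0 m))); move: (Num.sqrt _) s0 => s s0.
    by field; rewrite gt_eqF.
  have : 2 * G / l + 4 * G * Num.sqrt m.+1%:R^-1 @[m --> \oo] --> 2 * G / l + 4 * G * Num.sqrt 0.
    apply: cvgD; first exact: cvg_cst.
    apply: cvgM; first exact: cvg_cst.
    by apply: (@cvg_comp _ _ _ (fun m : nat => m.+1%:R^-1) Num.sqrt); [exact: tL|exact: sqrt_continuous].
  by rewrite sqrtr0 mulr0 addr0.
- move=> x xl; set k := c * Num.sqrt pi.
  pose b j (m : nat) := if `[< cvg (riesz_trunc j f e x @[e --> 0^'+]) >]
    then riesz_heat n c m.+1%:R^-1 j f x else 0.
  have bL j : b j m @[m --> \oo] --> k * riesz j f x.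
    rewrite /b /riesz; case: asboolP => [H|H].
      exact: riesz_heat_cvg.
    by rewrite (dvgP H) /point/= !mulr0; exact: cvg_cst.
  have bS m : \sum_(j < n) b j m ^+ 2 <= \sum_(j < n) riesz_heat n c m.+1%:R^-1 j f x ^+ 2.
    apply: ler_sum => j _; rewrite /b; case: asboolP => // _.
    by rewrite expr0n/= sqr_ge0.
  have SL : \sum_(j < n) b j m ^+ 2 - (l + 2 * m.+1%:R^-1) ^+ 2 @[m --> \oo] -->
      \sum_(j < n) (k * riesz j f x) ^+ 2 - (l + 2 * 0) ^+ 2.
    apply: cvgB.
      apply: cvg_big => [|j _]; first exact: add_continuous.
      by rewrite expr2; under eq_fun do rewrite expr2; apply: cvgM; exact: bL.
    have H : l + 2 * m.+1%:R^-1 @[m --> \oo] --> l + 2 * 0.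
      by apply: cvgD; [exact: cvg_cst|apply: cvgM => //; exact: cvg_cst].
    by rewrite expr2; under eq_fun do rewrite expr2; apply: cvgM; exact: H.
  have S0 : 0 <= \sum_(j < n) riesz j f x ^+ 2 by apply: sumr_ge0 => j _; exact: sqr_ge0.
  have lS : l ^+ 2 < \sum_(j < n) riesz j f x ^+ 2.
    by rewrite -(sqr_sqrtr S0); apply: ltrXn2r => //; rewrite ?nnegrE ?(ltW l0) ?sqrtr_ge0.
  (* As k = c sqrt pi >= 1, the limit of the heat versions is at least as large as the Riesz
     transform. *)
  have pos : 0 < \sum_(j < n) (k * riesz j f x) ^+ 2 - (l + 2 * 0) ^+ 2.
    rewrite mulr0 addr0 subr_gt0 (lt_le_trans lS)//; apply: ler_sum => j _.
    by move: (riesz j f x) => r; rewrite (exprMn 2 k r) ler_peMl ?sqr_ge0// exprn_ege1.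
  have /cvgr_gt/(_ _ pos) := SL; apply: filterS => m.
  by rewrite subr_gt0 => /lt_le_trans; apply; exact: bS.
Qed.

End weak_type_bound.

Theorem theorem1p1 (R : realType) (n : nat) (hn : (1 <= n)%N)
    (f : euclid R n -> R)
    (hf : (@leb R n).-integrable setT (EFin \o f)) :
  (weak_L1 (fun x : euclid R n => enorm (fun j : 'I_n => riesz j f x))
     <= 2%:E * 'N[@leb R n]_1 [EFin \o f])%E.
Proof.
have Gfin : (\int[@leb R n]_y `|f y|%:E \is a fin_num)%E.
  by have /integrable_fin_num := integrable_abse hf; apply.
have fG := esym (fineK Gfin); set G := fine _ in fG.
rewrite Lnorm1 [X in (_ <= _ * X)%E]fG; apply: ge_ereal_sup => _ [l /= l0 <-].
have [N [mN Nl hN]] := riesz_superlevel_cover n hn f G l l0 hf fG.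
have H : (leb [set x | (l < enorm (fun j : 'I_n => riesz j f x))%R] <= (2 * G / l)%:E)%E.
  exact: le_trans (leb_mono n _ N hN) Nl.
apply: (@le_trans _ _ (l%:E * (2 * G / l)%:E)%E).
  by apply: lee_wpmul2l => //; rewrite lee_fin ltW.
by rewrite -!EFinM lee_fin mulrC divfK// gt_eqF.
Qed.
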